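(* Let $Q$ be a quiver with vertex set $I=\{1,\dots,n\}$ without loops and oriented $2$-cycles, $W$ a finite potential on $Q$, and $\mathbf{k}=(k_1,\dots,k_l)\in I^l$ such that $(Q^{\mathrm{pf}},W)$ is successively f-mutatable with respect to $\mathbf{k}$. Then for every $i\in I$ the polynomial $F_{\mathbf{k},i}(\underline y)$ has constant term $1$.
   Context: $Q(i,j)$ is the number of arrows $i\to j$ in $Q$. The quiver with principal framing $Q^{\mathrm{pf}}$ has vertices $I\sqcup I^*$, $I^*=\{1^*,\dots,n^*\}$, and arrows those of $Q$ together with one arrow $i^*\to i$ for each $i\in I$. Quiver mutation. $\mu_k^{\mathrm{pre}}Q$ is obtained from $Q$ by adding an arrow $[\beta\alpha]:u\to v$ for each pair $u\xrightarrow{\alpha}k\xrightarrow{\beta}v$ and replacing each arrow $a$ incident to $k$ by an opposite arrow $a^*$; $\mu_kQ$ is obtained by then removing a maximal collection of disjoint oriented $2$-cycles. Seeds. The mutation at $k$ of a seed $(Q\mid\underline u)$ is $(\mu_kQ\mid\underline u^{\mathrm{new}})$, where $u_k$ is replaced by $u_k^{-1}(\prod_iu_i^{Q(i,k)}+\prod_iu_i^{Q(k,i)})$ and other variables are unchanged. $\mathrm{FZ}^{\mathrm{pf}}_{\mathbf{k},i}(\underline X)$ is the variable at vertex $i$ of the seed $\mu_{k_l}\cdots\mu_{k_1}(Q^{\mathrm{pf}}\mid\underline X)$, with initial variables $X_j,X_{j^*}$ ($j\in I$). The $F$-polynomial is $F_{\mathbf{k},i}(\underline y):=\mathrm{FZ}^{\mathrm{pf}}_{\mathbf{k},i}(\underline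 X)|_{X_j=1,\,X_{j^*}=y_j}$. QP mutation. A finite potential $W$ is a finite linear combination of oriented cycles (up to rotation); a potential on $Q$ is also one on $Q^{\mathrm{pf}}$. The Jacobi algebra is $\mathbb{C}Q/\langle\partial_aW\rangle$ with $\partial_a(a_1\cdots a_m)=\sum_i\delta_{a,a_i}a_{i+1}\cdots a_ma_1\cdots a_{i-1}$. $\mu_k^{\mathrm{pre}}W:=[W]+\Delta$, where $[W]$ replaces each composition of $\alpha,\beta$ through $k$ by $[\beta\alpha]$ and $\Delta$ is the sum of the $3$-cycles formed by $[\beta\alpha],\beta^*,\alpha^*$. Two finite QPs are right f-equivalent if there is an algebra isomorphism of their (uncompleted) path algebras, fixing vertices, taking one potential to the other. A potential is reduced if it has no cycles of length $<3$; a QP is trivial if its Jacobi algebra is spanned by the vertex idempotents. A finite QP is f-reducible if right f-equivalent to a direct sum (union of arrow sets, sum of potentials) of a finite reduced QP and a finite trivial QP; $\mu_k(Q,W)$ is the reduced part of $(\mu_k^{\mathrm{pre}}Q,\mu_k^{\mathrm{pre}}W)$. $(Q,W)$ is f-mutatable at $k$ if $(\mu_k^{\mathrm{pre}}Q,\mu_k^{\mathrm{pre}}W)$ is f-reducible and the quiver of $\mu_k(Q,W)$ is $\mu_kQ$; it is successively f-mutatable with respect to $\mathbf{k}$ if $\mu_{k_{s-1}}\cdots\mu_{k_1}(Q,W)$ is f-mutatable at $k_s$ for all $s\le l$. *)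

(* Defs.v *)
From HB Require Import structures.
From mathcomp Require Import all_boot all_order all_algebra finmap.
From mathcomp Require Import complex reals.
From mathcomp.multinomials Require Import -(notations) monalg.
From mathcomp.multinomials Require Import mpoly.

Set Implicit Arguments.
Unset Strict Implicit.
Unset Printing Implicit Defensive.

Import GRing.Theory.
Local Open Scope ring_scope.

Record quiver (V : finType) := Quiver {
  arrow : finType;
  src : arrow -> V;
  tgt : arrow -> V }.

Section Quivers.
Variable V : finType.
Implicit Types Q : quiver V.

Definition narrows Q (i j : V) : nat :=
  #|[set a : arrow Q | (src a == i) && (tgt a == j)]|.

(* Equality of quivers up to renaming of arrows; vertices are fixed. *)
Definition quiver_iso Q Q' : Prop :=
  exists2 f : arrow Q -> arrow Q', bijective f &
    forall a, src (f a) = src a /\ tgt (f a) = tgt a.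

Definition loopless Q : Prop := forall a : arrow Q, src a != tgt a.

Definition two_cycle Q (c : {set arrow Q}) : bool :=
  [exists a, exists b,
    [&& src a != tgt a, src b == tgt a, tgt b == src a & c == [set a; b]]].

Definition disjoint_two_cycles Q (C : {set {set arrow Q}}) : bool :=
  [forall c in C, two_cycle c] && trivIset C.

Lemma disjoint_two_cycles_ex Q :
  exists C : {set {set arrow Q}}, disjoint_two_cycles C.
Proof.
exists set0; apply/andP; split; first by apply/forall_inP => c; rewrite inE.
by apply/trivIsetP => A B; rewrite inE.
Qed.

(* An arbitrary choice; the quiver below does not depend on it up to
   [quiver_iso]. *)
Definition max_two_cycles Q : {set {set arrow Q}} :=
  sval (ex_maxset (disjoint_two_cycles_ex Q)).

Definition cancel_two_cycles Q : quiver V :=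
  @Quiver V {a : arrow Q | a \notin cover (max_two_cycles Q)}
    (fun a => src (val a)) (fun a => tgt (val a)).

Section Mutation.
Variables (k : V) (Q : quiver V).

Definition incident (a : arrow Q) : bool := (src a == k) || (tgt a == k).

(* The pair (alpha, beta) stands for u --alpha--> k --beta--> v. *)
Definition through : finType :=
  {p : arrow Q * arrow Q | (tgt p.1 == k) && (src p.2 == k)}.

(* [inl (alpha, beta)] is the arrow [beta alpha]; [inr a] is a* if a is
   incident to k, and a otherwise. *)
Definition premut_quiver : quiver V :=
  @Quiver V (through + arrow Q)%type
    (fun x => match x with
              | inl p => src (val p).1
              | inr a => if incident a then tgt a else src a
              end)
    (fun x => match x with
              | inl p => tgt (val p).2
              | inr a => if incident a then src a else tgt a
              end).

Definition mut_quiver : quiver V := cancel_two_cycles premut_quiver.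
End Mutation.

(* Words are read from right to left, as compositions of maps: in
   [:: a1; ..; am] the arrow am is followed first, and the vertex v is the
   target of the path. *)
Fixpoint is_word Q (v : V) (s : seq (arrow Q)) : bool :=
  if s is a :: s' then (tgt a == v) && is_word (src a) s' else true.

Definition wsrc Q (v : V) (s : seq (arrow Q)) : V := last v (map (@src V Q) s).

Definition qpath Q := {p : V * seq (arrow Q) | is_word p.1 p.2}.

Definition ptgt Q (p : qpath Q) : V := (val p).1.
Definition pword Q (p : qpath Q) : seq (arrow Q) := (val p).2.
Definition psrc Q (p : qpath Q) : V := wsrc (ptgt p) (pword p).

Definition is_cycle Q (p : qpath Q) : bool :=
  (pword p != [::]) && (psrc p == ptgt p).

Lemma is_word_cat Q v (s t : seq (arrow Q)) :
  is_word v (s ++ t) = is_word v s && is_word (wsrc v s) t.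
Proof. by elim: s v => [|a s IH] v //=; rewrite IH andbA. Qed.

Lemma wsrc_cat Q v (s t : seq (arrow Q)) :
  wsrc v (s ++ t) = wsrc (wsrc v s) t.
Proof. by rewrite /wsrc map_cat last_cat. Qed.
End Quivers.

(* Finitely supported functions from paths to K.  The operations are sealed
   so that unification does not unfold them. *)
Record pathalg (K : fieldType) (V : finType) (Q : quiver V) :=
  PathAlg { pa_val : malg (qpath Q) K }.

HB.instance Definition _ (K : fieldType) (V : finType) (Q : quiver V) :=
  [isNew for @pa_val K V Q].
HB.instance Definition _ (K : fieldType) (V : finType) (Q : quiver V) :=
  [Choice of pathalg K Q by <:].

HB.lock
Definition pzero (K : fieldType) (V : finType) (Q : quiver V) : pathalg K Q :=
  PathAlg 0.

HB.lock
Definition popp (K : fieldType) (V : finType) (Q : quiver V)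
  (x : pathalg K Q) : pathalg K Q := PathAlg (- pa_val x).

HB.lock
Definition padd (K : fieldType) (V : finType) (Q : quiver V)
  (x y : pathalg K Q) : pathalg K Q := PathAlg (pa_val x + pa_val y).

HB.lock
Definition pscale (K : fieldType) (V : finType) (Q : quiver V)
  (c : K) (x : pathalg K Q) : pathalg K Q := PathAlg (c *: pa_val x).

HB.lock
Definition pbasis (K : fieldType) (V : finType) (Q : quiver V) (p : qpath Q)
  : pathalg K Q := PathAlg (mkmalgU p 1).

Definition pcoef (K : fieldType) (V : finType) (Q : quiver V) (p : qpath Q)
  (x : pathalg K Q) : K := monalg.mcoeff p (pa_val x).

Definition psupp (K : fieldType) (V : finType) (Q : quiver V)
  (x : pathalg K Q) : {fset qpath Q} := monalg.msupp (pa_val x).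

Section PathModule.
Variables (K : fieldType) (V : finType) (Q : quiver V).
Local Notation pathalg := (pathalg K Q).
Local Notation pzero := (@pzero K V Q).
Local Notation popp := (@popp K V Q).
Local Notation padd := (@padd K V Q).
Local Notation pscale := (@pscale K V Q).

Lemma paddA : associative padd.
Proof. by move=> x y z; rewrite padd.unlock /= addrA. Qed.
Lemma paddC : commutative padd.
Proof. by move=> x y; rewrite padd.unlock addrC. Qed.
Lemma padd0 : left_id pzero padd.
Proof. by case=> x; rewrite padd.unlock pzero.unlock add0r. Qed.
Lemma paddN : left_inverse pzero popp padd.
Proof. by case=> x; rewrite padd.unlock pzero.unlock popp.unlock addNr. Qed.

HB.instance Definition _ :=
  GRing.isZmodule.Build pathalg paddA paddC padd0 paddN.

Lemma pscaleA c d x : pscale c (pscale d x) = pscale (c * d) x.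
Proof. by rewrite pscale.unlock /= scalerA. Qed.
Lemma pscale1 : left_id 1 pscale.
Proof. by case=> x; rewrite pscale.unlock scale1r. Qed.
Lemma pscaleDr : right_distributive pscale +%R.
Proof.
move=> c x y; change (pscale c (padd x y) = padd (pscale c x) (pscale c y)).
by rewrite padd.unlock pscale.unlock /= scalerDr.
Qed.
Lemma pscaleDl x : {morph pscale^~ x : c d / c + d}.
Proof.
move=> c d; change (pscale (c + d) x = padd (pscale c x) (pscale d x)).
by rewrite padd.unlock pscale.unlock /= scalerDl.
Qed.

HB.instance Definition _ := GRing.Zmodule_isLmodule.Build K pathalg
  pscaleA pscale1 pscaleDr pscaleDl.

Implicit Types (x y : pathalg) (p q : qpath Q).

Lemma pa_val0 : pa_val (0 : pathalg) = 0.
Proof. by change (pa_val pzero = 0); rewrite pzero.unlock. Qed.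
Lemma pa_valD x y : pa_val (x + y) = pa_val x + pa_val y.
Proof. by change (pa_val (padd x y) = pa_val x + pa_val y); rewrite padd.unlock. Qed.
Lemma pa_valZ c x : pa_val (c *: x) = c *: pa_val x.
Proof. by change (pa_val (pscale c x) = c *: pa_val x); rewrite pscale.unlock. Qed.

Lemma pcoefD p x y : pcoef p (x + y) = pcoef p x + pcoef p y.
Proof. by rewrite /pcoef pa_valD monalg.mcoeffD. Qed.
Lemma pcoefZ p c x : pcoef p (c *: x) = c * pcoef p x.
Proof. by rewrite /pcoef pa_valZ monalg.mcoeffZ. Qed.
Lemma pcoef0 p : pcoef p (0 : pathalg) = 0.
Proof. by rewrite /pcoef pa_val0 monalg.mcoeff0. Qed.
Lemma pcoef_basis p q : pcoef q (pbasis K p) = (p == q)%:R.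
Proof. by rewrite pbasis.unlock; exact: monalg.mcoeffU. Qed.
Lemma pcoef_sum p I (r : seq I) (P : pred I) (F : I -> pathalg) :
  pcoef p (\sum_(i <- r | P i) F i) =
  \sum_(i <- r | P i) pcoef p (F i).
Proof. exact: (big_morph (fun x : pathalg => pcoef p x) (pcoefD p) (pcoef0 p)). Qed.
Lemma psuppP p x : (p \in psupp x) = (pcoef p x != 0).
Proof. by rewrite /psupp /pcoef monalg.mcoeff_neq0. Qed.
Lemma pathalgP x y : (forall p, pcoef p x = pcoef p y) -> x = y.
Proof. by move=> h; apply/val_inj/monalg.malgP. Qed.
End PathModule.

HB.lock
Definition linext (K : fieldType) (V : finType) (Q : quiver V)
    (M : lmodType K) (f : qpath Q -> M) (x : pathalg K Q) : M :=
  \sum_(p <- psupp x) pcoef p x *: f p.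

(* 0 on ill-formed words. *)
HB.lock
Definition mkpath (K : fieldType) (V : finType) (Q : quiver V)
    (v : V) (s : seq (arrow Q)) : pathalg K Q :=
  if insub (v, s) is Some p then pbasis K p else 0.

Definition idem (K : fieldType) (V : finType) (Q : quiver V) (v : V) :
  pathalg K Q := mkpath K v [::].

(* p * q is the path q followed by p. *)
HB.lock
Definition pmul (K : fieldType) (V : finType) (Q : quiver V)
    (x y : pathalg K Q) : pathalg K Q :=
  linext (fun p => linext (fun q =>
    if psrc p == ptgt q then mkpath K (ptgt p) (pword p ++ pword q) else 0) y) x.

Section PathAlgebra.
Variables (K : fieldType) (V : finType) (Q : quiver V).
Local Notation pathalg := (pathalg K Q).
Local Notation pbasis := (@pbasis K V Q).
Local Notation mkpath := (@mkpath K V Q).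
Local Notation linext := (@linext K V Q _).
Local Notation idem := (@idem K V Q).
Local Notation pmul := (@pmul K V Q).
Implicit Types x y z : pathalg.

Definition pone : pathalg := \sum_v idem v.

Lemma linextE (M : lmodType K) (f : qpath Q -> M) x :
  linext f x = \sum_(p <- psupp x) pcoef p x *: f p.
Proof. by rewrite linext.unlock. Qed.

Lemma linextEw (M : lmodType K) (f : qpath Q -> M) (d : {fset qpath Q}) x :
  (psupp x `<=` d)%fset -> linext f x = \sum_(p <- d) pcoef p x *: f p.
Proof.
move=> sxd; rewrite linextE (big_fset_incl _ sxd) // => p _ px.
by move: px; rewrite psuppP negbK => /eqP ->; rewrite scale0r.
Qed.

Lemma linext_is_linear (M : lmodType K) (f : qpath Q -> M) : linear (linext f).
Proof.
move=> c x y.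
pose d := (psupp x `|` psupp y `|` psupp (c *: x + y)%R)%fset.
rewrite !(@linextEw M f d) /d ?fsubsetUr //; last first.
- by rewrite -fsetUA fsubsetUl.
- by rewrite [X in (X `|` _)%fset]fsetUC -fsetUA fsubsetUl.
rewrite scaler_sumr -big_split /=; apply: eq_bigr => p _.
by rewrite pcoefD pcoefZ scalerDl scalerA.
Qed.

HB.instance Definition _ (M : lmodType K) (f : qpath Q -> M) :=
  GRing.isLinear.Build K pathalg M *:%R (linext f) (linext_is_linear f).

Lemma psupp_basis p : psupp (pbasis p) = [fset p]%fset.
Proof.
apply/fsetP => q; rewrite psuppP pcoef_basis in_fset1 [q == p]eq_sym.
by case: (p == q); rewrite ?oner_eq0 ?eqxx.
Qed.

Lemma linext_basis (M : lmodType K) (f : qpath Q -> M) p :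
  linext f (pbasis p) = f p.
Proof.
by rewrite linextE psupp_basis big_seq_fset1 pcoef_basis eqxx scale1r.
Qed.

Lemma pathalgE x : x = \sum_(p <- psupp x) pcoef p x *: pbasis p.
Proof.
apply: pathalgP => q; rewrite pcoef_sum.
have [qx|qx] := boolP (q \in psupp x).
  rewrite (big_fsetD1 q) //= pcoefZ pcoef_basis eqxx mulr1 big_seq big1 ?addr0 //.
  move=> p; rewrite in_fsetD1 => /andP [pq _].
  by rewrite pcoefZ pcoef_basis (negPf pq) mulr0.
rewrite big_seq big1 => [|p px].
  by move: qx; rewrite psuppP negbK => /eqP.
rewrite pcoefZ pcoef_basis; case: eqP px qx => [-> ->|_ _ _] //.
by rewrite mulr0.
Qed.

Lemma mkpath_basis v s (vs : is_word v s) :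
  mkpath v s = pbasis (exist _ (v, s) vs).
Proof. by rewrite mkpath.unlock insubT. Qed.

Lemma mkpath_eq0 v s : ~~ is_word v s -> mkpath v s = 0.
Proof. by move=> vs; rewrite mkpath.unlock insubN. Qed.

Lemma basisE p : pbasis p = mkpath (ptgt p) (pword p).
Proof.
case: p => [[v s] vs]; rewrite /ptgt /pword /=.
by rewrite mkpath_basis; congr pbasis; apply/val_inj.
Qed.

Lemma pathalg_ind (P : pathalg -> Prop) :
  P 0 -> (forall v s, P (mkpath v s)) ->
  (forall c x y, P x -> P y -> P (c *: x + y)) -> forall x, P x.
Proof.
move=> P0 Pm PD x; rewrite (pathalgE x); elim: (enum_fset _) => [|p r IH].
  by rewrite big_nil.
by rewrite big_cons basisE; apply: PD.
Qed.

Lemma linext0 (M : lmodType K) (f : qpath Q -> M) : linext f 0 = 0.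
Proof. by rewrite linextE /psupp pa_val0 monalg.msupp0 big_nil. Qed.

Lemma linext_mkpath (M : lmodType K) (f : V -> seq (arrow Q) -> M) v s :
  linext (fun p => f (ptgt p) (pword p)) (mkpath v s) =
  if is_word v s then f v s else 0.
Proof.
case: ifP => vs; first by rewrite (mkpath_basis vs) linext_basis.
by rewrite mkpath_eq0 ?vs // linext0.
Qed.

Lemma pmulDl x y z c : pmul (c *: x + y) z = c *: pmul x z + pmul y z.
Proof. by rewrite pmul.unlock linext_is_linear. Qed.

Lemma scale_linextP (M : lmodType K) (f : qpath Q -> M) a c x y :
  a *: linext f (c *: x + y) = c *: (a *: linext f x) + a *: linext f y.
Proof. by rewrite linext_is_linear scalerDr !scalerA mulrC. Qed.

Lemma pmulDr x y z c : pmul x (c *: y + z) = c *: pmul x y + pmul x z.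
Proof.
rewrite pmul.unlock !(linextE _ x) scaler_sumr -big_split /=.
by apply: eq_bigr => p _; exact: scale_linextP.
Qed.

Lemma pmul0x x : pmul 0 x = 0.
Proof. by rewrite pmul.unlock linext0. Qed.

Lemma pmulx0 x : pmul x 0 = 0.
Proof. by rewrite pmul.unlock (linextE _ x) big1 // => p _; rewrite linext0 scaler0. Qed.

Lemma mkpathM v s w t :
  pmul (mkpath v s) (mkpath w t) =
  if wsrc v s == w then mkpath v (s ++ t) else 0.
Proof.
rewrite pmul.unlock.
rewrite (@linext_mkpath _ (fun v0 s0 => linext (fun q =>
  if wsrc v0 s0 == ptgt q then mkpath v0 (s0 ++ pword q) else 0)
  (mkpath w t))).
rewrite (@linext_mkpath _ (fun w0 t0 =>
  if wsrc v s == w0 then mkpath v (s ++ t0) else 0)).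
case: (eqVneq (wsrc v s) w) => [<-|_]; last by rewrite !if_same.
case: ifP => [vs|/negbT vs]; last first.
  by rewrite mkpath_eq0 // is_word_cat (negPf vs).
case: ifP => // /negbT wt.
by rewrite mkpath_eq0 // is_word_cat (negPf wt) andbF.
Qed.

Lemma pmulA : associative pmul.
Proof.
move=> x y z; elim/pathalg_ind: x => [|v s|c x x' IH IH'].
- by rewrite !pmul0x.
- elim/pathalg_ind: y => [|w t|c y y' IH IH'].
  + by rewrite pmulx0 !pmul0x pmulx0.
  + elim/pathalg_ind: z => [|u r|c z z' IH IH'].
    * by rewrite !pmulx0.
    * rewrite !mkpathM; case: (eqVneq (wsrc v s) w) => [<-|ne]; last first.
        by rewrite pmul0x; case: ifP => _;
          rewrite ?pmulx0 // mkpathM (negPf ne).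
      by rewrite mkpathM wsrc_cat; case: ifP => _;
        rewrite ?pmulx0 // mkpathM eqxx catA.
    * by rewrite !pmulDr IH IH'.
  + by rewrite pmulDl !pmulDr pmulDl IH IH'.
- by rewrite !pmulDl IH IH'.
Qed.

Lemma pmul_addl : left_distributive pmul +%R.
Proof. by move=> x y z; have := pmulDl x y z 1; rewrite !scale1r. Qed.

Lemma pmul_addr : right_distributive pmul +%R.
Proof. by move=> x y z; have := pmulDr x y z 1; rewrite !scale1r. Qed.

Lemma pmul_sumr x (f : V -> pathalg) :
  pmul x (\sum_v f v) = \sum_v pmul x (f v).
Proof. exact: (big_morph (pmul x) (pmul_addr x) (pmulx0 x)). Qed.

Lemma pmul_suml x (f : V -> pathalg) :
  pmul (\sum_v f v) x = \sum_v pmul (f v) x.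
Proof.
exact: (big_morph (fun y => pmul y x) (fun y z => pmul_addl y z x) (pmul0x x)).
Qed.

Lemma pmul1x : left_id pone pmul.
Proof.
move=> x; elim/pathalg_ind: x => [|w t|c x y IH IH'].
- exact: pmulx0.
- rewrite pmul_suml (bigD1 w) //= mkpathM eqxx big1 ?addr0 // => v vw.
  by rewrite mkpathM (negPf vw).
- by rewrite pmulDr; congr (_ *: _ + _).
Qed.

Lemma pmulx1 : right_id pone pmul.
Proof.
move=> x; elim/pathalg_ind: x => [|w t|c x y IH IH'].
- exact: pmul0x.
- rewrite pmul_sumr (bigD1 (wsrc w t)) //= mkpathM eqxx cats0.
  rewrite big1 ?addr0 // => v vw.
  by rewrite mkpathM eq_sym (negPf vw).
- by rewrite pmulDl; congr (_ *: _ + _).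
Qed.

(* Possibly trivial, since V may be empty. *)
HB.instance Definition _ := GRing.Zmodule_isPzRing.Build pathalg
  pmulA pmul1x pmulx1 pmul_addl pmul_addr.

Lemma pathalg_scaleAl (c : K) (x y : pathalg) : c *: (x * y) = (c *: x) * y.
Proof. by have := pmulDl x 0 y c; rewrite addr0 pmul0x addr0. Qed.

Lemma pathalg_scaleAr (c : K) (x y : pathalg) : c *: (x * y) = x * (c *: y).
Proof. by have := pmulDr x y 0 c; rewrite addr0 pmulx0 addr0. Qed.
End PathAlgebra.

(* The linear map induced on paths by maps of vertices and arrows. *)
Definition pathalg_map (K : fieldType) (V V' : finType) (Q : quiver V)
    (Q' : quiver V') (fV : V -> V') (fA : arrow Q -> arrow Q') :
    pathalg K Q -> pathalg K Q' :=
  linext (fun p => mkpath K (fV (ptgt p)) (map fA (pword p))).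

Section Potentials.
Variables (K : fieldType) (V : finType).
Implicit Types Q : quiver V.

(* A potential is represented by a linear combination of based cycles;
   potentials are compared by [cyc_equiv]. *)
Definition is_potential Q (W : pathalg K Q) : Prop :=
  forall p, p \in psupp W -> is_cycle p.

Definition rotate Q (p : qpath Q) : pathalg K Q :=
  if pword p is a :: s then mkpath K (src a) (rcons s a) else pbasis K p.

Definition cyc_equiv Q (W W' : pathalg K Q) : Prop :=
  exists2 r : seq (K * qpath Q),
    all (fun t => is_cycle t.2) r &
    W - W' = \sum_(t <- r) t.1 *: (pbasis K t.2 - rotate t.2).

Definition cyc_deriv Q (a : arrow Q) : pathalg K Q -> pathalg K Q :=
  linext (fun p => let s := pword p in
    \sum_(i < size s | tnth (in_tuple s) i == a)
      mkpath K (src a) (drop i.+1 s ++ take i s)).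

(* Membership in the two-sided ideal generated by the cyclic derivatives. *)
Definition jacobi_ideal Q (W : pathalg K Q) (x : pathalg K Q) : Prop :=
  exists r : seq (pathalg K Q * arrow Q * pathalg K Q),
    x = \sum_(t <- r) t.1.1 * cyc_deriv t.1.2 W * t.2.

Record qp := QP { qp_quiver : quiver V; qp_pot : pathalg K qp_quiver }.

Definition finite_qp (P : qp) : Prop := is_potential (qp_pot P).

Definition reduced_qp (P : qp) : Prop :=
  forall p, p \in psupp (qp_pot P) -> (3 <= size (pword p))%N.

(* The Jacobi algebra, i.e. the quotient of the path algebra by the ideal
   above, is spanned by the classes of the vertex idempotents. *)
Definition trivial_qp (P : qp) : Prop :=
  forall x : pathalg K (qp_quiver P), exists c : V -> K,
    jacobi_ideal (qp_pot P) (x - \sum_v c v *: idem K (qp_quiver P) v).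

Definition dsum_quiver Q1 Q2 : quiver V :=
  @Quiver V (arrow Q1 + arrow Q2)%type
    (fun x => match x with inl a => src a | inr a => src a end)
    (fun x => match x with inl a => tgt a | inr a => tgt a end).

Definition dsum_qp (P1 P2 : qp) : qp :=
  @QP (dsum_quiver (qp_quiver P1) (qp_quiver P2))
    (pathalg_map (Q' := dsum_quiver _ _) id inl (qp_pot P1)
     + pathalg_map (Q' := dsum_quiver _ _) id inr (qp_pot P2)).

Definition right_fequiv (P P' : qp) : Prop :=
  exists phi : {rmorphism pathalg K (qp_quiver P) -> pathalg K (qp_quiver P')},
    [/\ scalable phi, bijective phi,
        forall v, phi (idem K (qp_quiver P) v) = idem K (qp_quiver P') v
      & cyc_equiv (phi (qp_pot P)) (qp_pot P')].

(* Reduced parts are only defined up to right f-equivalence, hence the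
   relation; P is f-reducible if it has a reduced part. *)
Definition reduced_part (P Pred : qp) : Prop :=
  [/\ finite_qp Pred, reduced_qp Pred
    & exists Ptriv, [/\ finite_qp Ptriv, trivial_qp Ptriv
                      & right_fequiv P (dsum_qp Pred Ptriv)]].

Section Mutation.
Variables (k : V) (Q : quiver V).

(* Replaces every factor beta alpha through k by the arrow [beta alpha]. *)
Fixpoint bracket_word (s : seq (arrow Q)) : seq (arrow (premut_quiver k Q)) :=
  match s with
  | [::] => [::]
  | b :: s1 =>
    match s1 with
    | [::] => [:: inr b]
    | a :: s2 => if insub (a, b) is Some c then inl c :: bracket_word s2
                 else inr b :: bracket_word s1
    end
  end.

(* A cycle based at k is first rotated once. *)
Definition bracket_cycle (p : qpath Q) : pathalg K (premut_quiver k Q) :=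
  match pword p with
  | [::] => 0
  | a :: s => if ptgt p == k then mkpath K (src a) (bracket_word (rcons s a))
              else mkpath K (ptgt p) (bracket_word (a :: s))
  end.

(* alpha* beta* [beta alpha] *)
Definition delta_word (c : through k Q) : seq (arrow (premut_quiver k Q)) :=
  [:: inr (val c).1; inr (val c).2; inl c].

Definition premut_delta : pathalg K (premut_quiver k Q) :=
  \sum_(c : through k Q)
    mkpath K (src (val c).1) (delta_word c).
End Mutation.

Definition premut_qp (k : V) (P : qp) : qp :=
  @QP (premut_quiver k (qp_quiver P))
    (linext (@bracket_cycle k (qp_quiver P)) (qp_pot P)
     + premut_delta k (qp_quiver P)).

(* P is f-mutatable at k and P' is (a representative of) mu_k(P). *)
Definition f_mutation (k : V) (P P' : qp) : Prop :=
  reduced_part (premut_qp k P) P' /\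
  quiver_iso (qp_quiver P') (mut_quiver k (qp_quiver P)).

Fixpoint succ_f_mutatable (P : qp) (ks : seq V) : Prop :=
  if ks is k :: ks' then
    exists P', f_mutation k P P' /\ succ_f_mutatable P' ks'
  else True.
End Potentials.

(* [inl i] is the vertex i and [inr i] the vertex i*. *)
Definition framed (n : nat) (Q : quiver 'I_n) : quiver ('I_n + 'I_n)%type :=
  @Quiver ('I_n + 'I_n)%type (arrow Q + 'I_n)%type
    (fun x => match x with inl a => inl (src a) | inr i => inr i end)
    (fun x => match x with inl a => inl (tgt a) | inr i => inl i end).

Definition framed_qp (K : fieldType) (n : nat) (Q : quiver 'I_n)
    (W : pathalg K Q) : qp K ('I_n + 'I_n)%type :=
  QP (pathalg_map (Q' := framed Q) inl inl W).

Record seed (F : fieldType) (V : finType) := Seed {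
  seed_quiver : quiver V;
  seed_var : V -> F }.

Definition mut_seed (F : fieldType) (V : finType) (k : V) (S : seed F V) :
    seed F V :=
  let Q := seed_quiver S in
  let u := seed_var S in
  Seed (mut_quiver k Q)
    (fun v => if v == k then
       (u k)^-1 * (\prod_i u i ^+ narrows Q i k + \prod_i u i ^+ narrows Q k i)
     else u v).

Section FPolynomials.
Variable n : nat.

(* X_j is the variable of index [lshift n j] and X_{j*} that of index
   [rshift n j]. *)
Definition ratfun : fieldType := {fraction {mpoly rat[n + n]}}.

Definition init_seed (Q : quiver 'I_n) : seed ratfun ('I_n + 'I_n)%type :=
  Seed (framed Q)
    (fun v => match v with
              | inl j => tofrac 'X_(lshift n j)
              | inr j => tofrac 'X_(rshift n j)
              end).

Definition FZ (Q : quiver 'I_n) (ks : seq 'I_n) (i : 'I_n) : ratfun :=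
  seed_var (foldl (fun S k => mut_seed (inl k) S) (init_seed Q) ks) (inl i).

(* Substitution X_j := 1, X_{j*} := y_j. *)
Definition specialize (p : {mpoly rat[n + n]}) : {mpoly rat[n]} :=
  p \mPo [tuple match split v with inl _ => 1 | inr j => 'X_j end
         | v < n + n].

(* The value of a rational function under the substitution, for those that
   can be written with a denominator which does not specialize to 0. *)
Definition specializes_to (r : ratfun) (f : {mpoly rat[n]}) : Prop :=
  exists p q : {mpoly rat[n + n]},
    [/\ specialize q != 0, r = tofrac p / tofrac q
      & specialize p = f * specialize q].

Lemma specializes_to_uniq r f g :
  specializes_to r f -> specializes_to r g -> f = g.
Proof.
move=> [p [q [q0 rE pE]]] [p' [q' [q'0 r'E p'E]]].
have nz s : specialize s != 0 -> tofrac s != 0 :> ratfun.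
  by apply: contraNneq => /eqP; rewrite tofrac_eq0 => /eqP ->;
     rewrite /specialize rmorph0.
have /eqP : tofrac p / tofrac q = tofrac p' / tofrac q' :> ratfun.
  by rewrite -rE.
rewrite eqr_div ?nz // -!tofracM tofrac_eq => /eqP /(congr1 specialize).
rewrite /specialize !rmorphM /= -!/(specialize _) pE p'E => E.
apply: (mulIf q0); apply: (mulIf q'0); rewrite E.
by rewrite mulrAC.
Qed.

Definition is_Fpoly (Q : quiver 'I_n) (ks : seq 'I_n) (i : 'I_n)
    (f : {mpoly rat[n]}) : Prop :=
  specializes_to (FZ Q ks i) f.
End FPolynomials.

(* Sanity: no term of a premutated or framed potential, or of a cyclic
   derivative, is lost to the default value 0 of [mkpath]. *)
Section WellFormed.
Variables (K : fieldType) (V : finType).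
Implicit Types Q : quiver V.

Lemma is_potential0 Q : is_potential (0 : pathalg K Q).
Proof. by move=> p; rewrite psuppP pcoef0 eqxx. Qed.

Lemma is_potentialD Q (W W' : pathalg K Q) :
  is_potential W -> is_potential W' -> is_potential (W + W').
Proof.
move=> PW PW' p; rewrite psuppP pcoefD => pWW'.
have [/PW //|] := boolP (p \in psupp W); rewrite psuppP negbK => /eqP W0.
by apply: PW'; rewrite psuppP; rewrite W0 add0r in pWW'.
Qed.

Lemma is_potentialZ Q c (W : pathalg K Q) :
  is_potential W -> is_potential (c *: W).
Proof.
move=> PW p; rewrite psuppP pcoefZ mulf_eq0 negb_or -psuppP.
by move=> /andP [_ /PW].
Qed.

Lemma is_potential_mkpath Q v (s : seq (arrow Q)) :
  s != [::] -> wsrc v s == v -> is_potential (mkpath K v s).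
Proof.
move=> s0 sv; have [vs|vs] := boolP (is_word v s); last first.
  by rewrite mkpath_eq0 //; apply: is_potential0.
move=> p; rewrite (mkpath_basis _ vs) psupp_basis in_fset1 => /eqP ->.
by rewrite /is_cycle /pword /psrc /ptgt /= s0.
Qed.

Lemma is_potential_linext (V' : finType) (Q' : quiver V') Q
    (f : qpath Q' -> pathalg K Q) W :
  (forall p, is_cycle p -> is_potential (f p)) ->
  is_potential W -> is_potential (linext f W).
Proof.
move=> Pf PW; rewrite linextE big_seq.
elim/big_ind: _ => [|x y Px Py|p /PW /Pf Pp].
- exact: is_potential0.
- exact: is_potentialD.
- exact: is_potentialZ.
Qed.

Lemma is_word_map (V' : finType) (Q' : quiver V') Q (fV : V' -> V)
    (fA : arrow Q' -> arrow Q) v s :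
  (forall a, src (fA a) = fV (src a)) -> (forall a, tgt (fA a) = fV (tgt a)) ->
  is_word v s ->
  is_word (fV v) (map fA s) /\ wsrc (fV v) (map fA s) = fV (wsrc v s).
Proof.
move=> fs ft; elim: s v => [|a s IH] v //= /andP [/eqP <- ws].
by rewrite ft eqxx /wsrc /= !fs; apply: IH.
Qed.

Lemma is_potential_map (V' : finType) (Q' : quiver V') Q (fV : V' -> V)
    (fA : arrow Q' -> arrow Q) (W : pathalg K Q') :
  (forall a, src (fA a) = fV (src a)) -> (forall a, tgt (fA a) = fV (tgt a)) ->
  is_potential W -> is_potential (pathalg_map fV fA W).
Proof.
move=> fs ft; apply: is_potential_linext => -[[v s] vs] /andP [s0 /eqP sv].
rewrite /pword /psrc /ptgt /= in s0 sv *; apply: is_potential_mkpath.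
  by case: s s0 {vs sv}.
by have [_ ->] := is_word_map fs ft vs; rewrite sv.
Qed.

Lemma is_word_delta k Q (c : through k Q) :
  is_word (src (val c).1) (delta_word c) /\
  wsrc (src (val c).1) (delta_word c) = src (val c).1.
Proof.
have /andP [/eqP ta /eqP sb] := valP c.
by rewrite /wsrc /= /incident ta sb !eqxx !orbT !eqxx; split.
Qed.

Lemma is_word_bracket k Q v (s : seq (arrow Q)) :
  loopless Q -> v != k -> wsrc v s != k -> is_word v s ->
  is_word v (bracket_word k s) /\ wsrc v (bracket_word k s) = wsrc v s.
Proof.
move=> ll; have [m] := ubnP (size s).
elim: m s v => // m IH [|b [|a s]] v //= sm vk.
  rewrite /wsrc /= andbT => bk /eqP tb.
  by rewrite /incident tb (negPf vk) (negPf bk) /= eqxx.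
move=> wk /and3P [/eqP tb /eqP ta ws].
have [sb|sb] := eqVneq (src b) k.
  have h : (tgt (a, b).1 == k) && (src (a, b).2 == k).
    by rewrite /= ta sb eqxx.
  rewrite insubT /= tb eqxx /=.
  apply: IH => //; first by move: sm; rewrite /= ltnS => /ltnW.
  by rewrite -sb -ta ll.
have [|w1 w2] := IH (a :: s) (src b) sm sb wk; first by rewrite /= ta eqxx.
rewrite -/(bracket_word k [:: b, a & s]).
have -> : bracket_word k [:: b, a & s] = inr b :: bracket_word k (a :: s).
  by rewrite [LHS]/= insubN //= negb_and sb orbT.
move: (bracket_word k (a :: s)) w1 w2 => t w1 w2.
by rewrite /wsrc /= /incident tb (negPf vk) (negPf sb) /= eqxx.
Qed.

Lemma is_potential_premut k (P : qp K V) :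
  loopless (qp_quiver P) -> finite_qp P -> finite_qp (premut_qp k P).
Proof.
case: P => Q W; rewrite /finite_qp /= => ll PW; apply: is_potentialD.
  apply: is_potential_linext PW => -[[v s] vs] /andP [s0 /eqP sv].
  rewrite /bracket_cycle /psrc /pword /ptgt /= in s0 sv *; rewrite /= in vs.
  case: s => [|a s] // in s0 sv vs *.
  rewrite -/(bracket_word k (a :: s)).
  have bw0 b (t : seq (arrow Q)) : bracket_word k (b :: t) != [::].
    by case: t => [|c t] //=; case: insub.
  have [/eqP ta ws] : tgt a == v /\ is_word (src a) s by apply/andP.
  case: (eqVneq v k) => [vk|vk]; last first.
    apply: is_potential_mkpath => //.
    by have [|_ ->] := is_word_bracket ll vk _ vs; rewrite sv.
  have ak : src a != k by rewrite -vk -ta ll.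
  have sr : wsrc (src a) (rcons s a) = src a.
    by rewrite /wsrc map_rcons last_rcons.
  have wr : is_word (src a) (rcons s a).
    by rewrite -cats1 is_word_cat ws /= andbT ta -[X in X == _]sv.
  apply: is_potential_mkpath; first by case: (s) => [|b t]; apply: bw0.
  by have [|_ ->] := is_word_bracket ll ak _ wr; rewrite sr.
apply: (big_ind (@is_potential K V _)) => [|x y|c _].
- exact: is_potential0.
- exact: is_potentialD.
- by apply: is_potential_mkpath => //; have [_ ->] := is_word_delta c.
Qed.

Lemma is_word_deriv Q v s (i : 'I_(size s)) (a : arrow Q) :
  is_word v s -> wsrc v s = v -> tnth (in_tuple s) i = a ->
  is_word (src a) (drop i.+1 s ++ take i s) /\
  wsrc (src a) (drop i.+1 s ++ take i s) = tgt a.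
Proof.
move=> vs sv; rewrite (tnth_nth a) /= => ai.
have es : s = take i s ++ a :: drop i.+1 s.
  by rewrite -{1}(cat_take_drop i s) (drop_nth a) ?ai.
move: vs sv; rewrite {1 2}es is_word_cat wsrc_cat => /andP [wt /andP [ta wd]] E.
have {}E : wsrc (src a) (drop i.+1 s) = v := E.
by rewrite is_word_cat wsrc_cat E (eqP ta) wt andbT.
Qed.
End WellFormed.

(* Main.v *)
(* Sign coherence. Let J be the Jacobi algebra of the framed quiver with
   potential and e the sum of the idempotents of the frozen vertices. Initially
   no arrow ends at a frozen vertex, so e J e is spanned by idempotents. The
   corner of the Jacobi algebra at the vertices other than k is not affected by
   premutation at k, and reduction does not change the Jacobi algebra; hence
   e J e is spanned by idempotents for every mutated quiver with potential.
   There the potential has no cycle of length < 3, so the Jacobian ideal has no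
   element with a term of length 1, which excludes arrows between frozen
   vertices; the terms of length 2 between frozen vertices come from derivatives
   along such arrows, which excludes paths i* -> k -> j*. So every c-vector has
   all entries >= 0 or all entries <= 0.

   Polynomiality. Sign coherence makes mutation a column operation on the
   C-matrix, which stays invertible. So the c-vector at k is not 0, exactly one
   of the two exchange monomials contains a frozen variable, and by induction
   each cluster variable is regular with value 1 at X_j = 1, X_{j*} = 0.
   Invertibility also makes the exchange polynomials of a seed coprime in pairs,
   and the upper bound argument of Berenstein, Fomin and Zelevinsky gives the
   Laurent phenomenon. A Laurent polynomial in y that is regular with value 1 at
   y = 0 is a polynomial with constant term 1. *)

Require Import Defs.
From HB Require Import structures.
From mathcomp Require Import all_boot all_order all_algebra finmap.
From mathcomp Require Import complex reals.
From mathcomp Require Import zify ring.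
From mathcomp.multinomials Require Import mpoly.

Set Implicit Arguments.
Unset Strict Implicit.
Unset Printing Implicit Defensive.

Import GRing.Theory Order.TTheory Num.Theory.
Local Open Scope ring_scope.

(** * Cyclic derivatives and the chain rule *)

Section CyclicDerivation.
Variables (K : fieldType) (V : finType).
Implicit Types Q : quiver V.

(** A reduction is an isomorphism that matches potentials only up to rotation of cycles, so
    derivatives have to be compared across algebra homomorphisms. A one-variable cyclic derivative
    has no product rule; letting [pderiv] carry the path that closes the cycle gives an exact
    Leibniz rule and chain rule in the path algebra itself, without a quotient by commutators. The
    Jacobi algebra is not formed either: statements about it are memberships in [jacobi_ideal]. The
    premutation step rests on one computation. Modulo the derivative along a composite arrow [b a],
    the passage a* b* through k equals minus the derivative of the bracketed potential along [b a].
    This removes the reversed arrows from any path between other vertices, and the derivatives along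
    reversed arrows become the old relations at k. On the cluster side the Laurent property is
    pulled back one mutation at a time towards the initial seed. Frozen variables are inverted
    throughout, so denominators in y are left over and are excluded by the value at y = 0. *)

Definition arr Q (a : arrow Q) : pathalg K Q := mkpath K (tgt a) [:: a].

Lemma mulE Q (x y : pathalg K Q) : pmul x y = x * y.
Proof. by []. Qed.

Lemma idem_mulM Q v w : idem K Q v * idem K Q w = (v == w)%:R *: idem K Q v.
Proof.
rewrite -[LHS]mulE /idem mkpathM; case: eqVneq; rewrite /= ?scale1r // => _.
by rewrite scale0r.
Qed.

Lemma idemK Q v : idem K Q v * idem K Q v = idem K Q v.
Proof. by rewrite idem_mulM eqxx scale1r. Qed.

Lemma idem_mk Q v w s : idem K Q v * mkpath K w s =
  if v == w then mkpath K w s else 0 :> pathalg K Q.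
Proof. by rewrite -[LHS]mulE mkpathM /wsrc /=; case: eqVneq => // ->. Qed.

Lemma mk_idem Q v w s : mkpath K w s * idem K Q v =
  if wsrc w s == v then mkpath K w s else 0 :> pathalg K Q.
Proof. by rewrite -[LHS]mulE mkpathM /= cats0. Qed.

Lemma mk_mul Q v w s t : wsrc v s = w ->
  mkpath K v s * mkpath K w t = mkpath K v (s ++ t) :> pathalg K Q.
Proof. by move=> <-; rewrite -[LHS]mulE mkpathM eqxx. Qed.

Lemma mk_mul0 Q v w s t : wsrc v s != w ->
  mkpath K v s * mkpath K w t = 0 :> pathalg K Q.
Proof. by move=> sw; rewrite -[LHS]mulE mkpathM (negPf sw). Qed.

Lemma mk_cons Q v (a : arrow Q) s : is_word v (a :: s) ->
  mkpath K v (a :: s) = arr a * mkpath K (src a) s.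
Proof. by move=> /andP [/eqP <- _]; rewrite /arr mk_mul. Qed.

Lemma scaleAl Q (c : K) (x y : pathalg K Q) : c *: x * y = c *: (x * y).
Proof. by rewrite pathalg_scaleAl. Qed.

Lemma scaleAr Q (c : K) (x y : pathalg K Q) : x * (c *: y) = c *: (x * y).
Proof. by rewrite pathalg_scaleAr. Qed.

Lemma idem_arr Q (a : arrow Q) : idem K Q (tgt a) * arr a = arr a.
Proof. by rewrite idem_mk eqxx. Qed.

Lemma arr_idem Q (a : arrow Q) : arr a * idem K Q (src a) = arr a.
Proof. by rewrite mk_idem /wsrc /= eqxx. Qed.

(* [word_deriv a v s y] is the sum of the [s2 * y * s1] over all
   decompositions [s = s1 ++ a :: s2]. *)
Fixpoint word_deriv Q (a : arrow Q) v s (y : pathalg K Q) : pathalg K Q :=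
  if s is b :: s' then
    (if b == a then mkpath K (src a) s' * y * idem K Q v else 0)
    + word_deriv a (src b) s' (y * mkpath K v [:: b])
  else 0.

(* Derivative of x along a with the cycle closed up by y; the cyclic derivative
   is the case y = 1. *)
Definition pderiv Q (a : arrow Q) (x y : pathalg K Q) : pathalg K Q :=
  linext (fun p => word_deriv a (ptgt p) (pword p) y) x.

Lemma word_derivP Q (a : arrow Q) v s c y z :
  word_deriv a v s (c *: y + z) = c *: word_deriv a v s y + word_deriv a v s z.
Proof.
elim: s v y z => [|b s IH] v y z /=; first by rewrite scaler0 addr0.
rewrite mulrDl scaleAl IH; case: ifP => _; last by rewrite !add0r.
rewrite mulrDr scaleAr mulrDl scaleAl scalerDr !addrA; congr (_ + _).
by rewrite -!addrA; congr (_ + _); rewrite addrC.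
Qed.

Lemma word_deriv0 Q (a : arrow Q) v s : word_deriv a v s 0 = 0.
Proof. by have := word_derivP a v s (-1) 0 0; rewrite scaler0 addr0 scaleN1r addNr. Qed.

Lemma word_deriv_idemr Q (a : arrow Q) v s y :
  word_deriv a v s (y * idem K Q v) = word_deriv a v s y.
Proof.
case: s => [|b s] //=; rewrite -!mulrA idemK.
by rewrite idem_mk eqxx.
Qed.

Lemma word_deriv_ideml Q (a : arrow Q) v s y :
  word_deriv a v s (idem K Q (wsrc v s) * y) = word_deriv a v s y.
Proof.
elim: s v y => [|b s IH] v y //=.
rewrite -/(wsrc (src b) s) -[_ * y * mkpath _ _ _]mulrA IH; congr (_ + _).
by case: eqP => // ->; rewrite mulrA mk_idem eqxx.
Qed.

Lemma pderivP Q (a : arrow Q) c x x' y :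
  pderiv a (c *: x + x') y = c *: pderiv a x y + pderiv a x' y.
Proof. exact: linext_is_linear. Qed.

Lemma pderivPr Q (a : arrow Q) c x y y' :
  pderiv a x (c *: y + y') = c *: pderiv a x y + pderiv a x y'.
Proof.
rewrite /pderiv !linextE scaler_sumr -big_split /=; apply: eq_bigr => p _.
by rewrite word_derivP scalerDr !scalerA mulrC.
Qed.

Lemma pderiv0 Q (a : arrow Q) y : pderiv a 0 y = 0.
Proof. exact: linext0. Qed.

Lemma pderivr0 Q (a : arrow Q) x : pderiv a x 0 = 0.
Proof. by rewrite /pderiv linextE big1 // => p _; rewrite word_deriv0 scaler0. Qed.

Lemma pderivD Q (a : arrow Q) x x' y :
  pderiv a (x + x') y = pderiv a x y + pderiv a x' y.
Proof. by have := pderivP a 1 x x' y; rewrite !scale1r. Qed.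

Lemma pderivDr Q (a : arrow Q) x y y' :
  pderiv a x (y + y') = pderiv a x y + pderiv a x y'.
Proof. by have := pderivPr a 1 x y y'; rewrite !scale1r. Qed.

Lemma pderivZ Q (a : arrow Q) c x y : pderiv a (c *: x) y = c *: pderiv a x y.
Proof. by have := pderivP a c x 0 y; rewrite !addr0 pderiv0 addr0. Qed.

Lemma pderivN Q (a : arrow Q) x y : pderiv a (- x) y = - pderiv a x y.
Proof. by rewrite -scaleN1r pderivZ scaleN1r. Qed.

Lemma pderiv_sum Q (a : arrow Q) I (r : seq I) (P : pred I) F y :
  pderiv a (\sum_(i <- r | P i) F i) y = \sum_(i <- r | P i) pderiv a (F i) y.
Proof.
exact: (big_morph (fun x => pderiv a x y) (fun x x' => pderivD a x x' y)
  (pderiv0 a y)).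
Qed.

Lemma pderiv_mk Q (a : arrow Q) v s y :
  pderiv a (mkpath K v s) y = if is_word v s then word_deriv a v s y else 0.
Proof. exact: (linext_mkpath (fun v s => word_deriv a v s y)). Qed.

Lemma pderiv_idem Q (a : arrow Q) v y : pderiv a (idem K Q v) y = 0.
Proof. by rewrite pderiv_mk. Qed.

Lemma pderiv_arr Q (a b : arrow Q) y : pderiv a (arr b) y =
  if b == a then idem K Q (src a) * y * idem K Q (tgt a) else 0.
Proof.
rewrite pderiv_mk /= eqxx /= addr0; case: eqP => // ->.
by [].
Qed.

Lemma word_deriv_cat Q (a : arrow Q) v s t z : is_word v (s ++ t) ->
  word_deriv a v (s ++ t) z = word_deriv a v s (mkpath K (wsrc v s) t * z)
    + word_deriv a (wsrc v s) t (z * mkpath K v s).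
Proof.
elim: s v z => [|b s IH] v z.
  by rewrite add0r /= => _; rewrite word_deriv_idemr.
rewrite /= => /andP [/eqP bv st]; rewrite IH // -/(wsrc (src b) s) !addrA; congr (_ + _ + _).
- by case: eqP => // <-; rewrite -(mk_mul _ (erefl _)) !mulrA.
- by rewrite !mulrA.
- by rewrite -mulrA; congr (word_deriv _ _ _ (_ * _)); rewrite mk_mul.
Qed.

(** Leibniz rule. An occurrence of [a] in x sees y and then z as the rest of the cycle, and an
    occurrence in y sees z and then x. For z = 1 the right side is symmetric in x and y, whence
    invariance under rotation. *)
Lemma pderivM Q (a : arrow Q) x y z :
  pderiv a (x * y) z = pderiv a x (y * z) + pderiv a y (z * x).
Proof.
elim/pathalg_ind: x y z => [|v s|c x x' IH IH'] y z; first last.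
- rewrite mulrDl mulrDr scaleAl scaleAr !pderivP pderivPr IH IH' scalerDr.
  by rewrite addrACA.
- elim/pathalg_ind: y z => [|w t|c y y' IH IH'] z; first last.
  + rewrite mulrDl mulrDr scaleAl scaleAr !pderivP pderivPr IH IH' scalerDr.
    by rewrite addrACA.
  + have [vs|vs] := boolP (is_word v s); last first.
      by rewrite (mkpath_eq0 _ vs) mul0r mulr0 !pderiv0 pderivr0 addr0.
    have [wt|wt] := boolP (is_word w t); last first.
      by rewrite (mkpath_eq0 _ wt) mul0r mulr0 !pderiv0 pderivr0 addr0.
    have [sw|sw] := eqVneq (wsrc v s) w; last first.
      rewrite mk_mul0 // pderiv0 !pderiv_mk vs wt -word_deriv_ideml mulrA idem_mk.
      rewrite (negPf sw) mul0r word_deriv0 -word_deriv_idemr -mulrA mk_idem.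
      by rewrite (negPf sw) mulr0 word_deriv0 addr0.
    rewrite (mk_mul _ sw) !pderiv_mk is_word_cat vs wt sw wt /=.
    by rewrite word_deriv_cat ?is_word_cat ?vs sw.
  + by rewrite mulr0 mul0r !pderiv0 pderivr0 addr0.
- by rewrite mulr0 mul0r !pderiv0 pderivr0 addr0.
Qed.

Lemma pderiv_commutator Q (a : arrow Q) x y :
  pderiv a (x * y) 1 = pderiv a (y * x) 1.
Proof. by rewrite !pderivM mul1r mulr1 mul1r mulr1 addrC. Qed.

Lemma pderiv_ends Q (a : arrow Q) x y :
  idem K Q (src a) * pderiv a x y * idem K Q (tgt a) = pderiv a x y.
Proof.
have wd v s z : is_word v s -> idem K Q (src a) * word_deriv a v s z * idem K Q (tgt a)
    = word_deriv a v s z.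
  elim: s v z => [|b s IH] v z /=; first by rewrite mulr0 mul0r.
  move=> /andP [/eqP bv bs]; rewrite mulrDr mulrDl IH //; congr (_ + _).
  case: eqP => [E|_]; last by rewrite mulr0 mul0r.
  by rewrite !mulrA idem_mk eqxx -bv E -!mulrA idemK.
elim/pathalg_ind: x => [|v s|c x x' IH IH'].
- by rewrite pderiv0 mulr0 mul0r.
- by rewrite pderiv_mk; case: ifP => vs; rewrite ?wd // mulr0 mul0r.
- by rewrite pderivP mulrDr mulrDl scaleAr scaleAl IH IH'.
Qed.

(** A predicate on plain functions, so that lifts, inverses of isomorphisms and composites are
    treated alike. The unit is preserved because it is the sum of the vertex idempotents. *)
Record alghom Q Q' (f : pathalg K Q -> pathalg K Q') : Prop := AlgHom {
  homP : forall c x y, f (c *: x + y) = c *: f x + f y;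
  homM : forall x y, f (x * y) = f x * f y;
  homI : forall v, f (idem K Q v) = idem K Q' v }.

Section Hom.
Variables (Q Q' : quiver V) (f : pathalg K Q -> pathalg K Q').
Hypothesis hf : alghom f.

Lemma hom0 : f 0 = 0.
Proof. by have := homP hf (-1) 0 0; rewrite scaler0 addr0 scaleN1r addNr. Qed.
Lemma homD x y : f (x + y) = f x + f y.
Proof. by have := homP hf 1 x y; rewrite !scale1r. Qed.
Lemma homZ c x : f (c *: x) = c *: f x.
Proof. by have := homP hf c x 0; rewrite !addr0 hom0 addr0. Qed.
Lemma homN x : f (- x) = - f x.
Proof. by rewrite -scaleN1r homZ scaleN1r. Qed.
Lemma homB x y : f (x - y) = f x - f y.
Proof. by rewrite homD homN. Qed.
Lemma hom_sum I (r : seq I) (P : pred I) F :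
  f (\sum_(i <- r | P i) F i) = \sum_(i <- r | P i) f (F i).
Proof. exact: (big_morph f homD hom0). Qed.
Lemma hom1 : f 1 = 1.
Proof. by rewrite [1 in LHS]/(pone K Q) hom_sum; apply: eq_bigr => v _; rewrite (homI hf). Qed.

(* The chain rule of Derksen, Weyman and Zelevinsky. *)
Lemma pderiv_hom a x z :
  pderiv a (f x) (f z) = \sum_b pderiv a (f (arr b)) (f (pderiv b x z)).
Proof.
have lin_sum F : (forall b, F b = 0) -> 
    \sum_b pderiv a (f (arr b)) (f (F b)) = 0.
  by move=> F0; rewrite big1 // => b _; rewrite F0 hom0 pderivr0.
elim/pathalg_ind: x => [|v s|c x x' IH IH']; first last.
- rewrite (homP hf) pderivP IH IH' scaler_sumr -big_split; apply: eq_bigr => b _.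
  by rewrite pderivP (homP hf) pderivPr.
- have [vs|vs] := boolP (is_word v s); last first.
    by rewrite (mkpath_eq0 _ vs) hom0 pderiv0 lin_sum // => b; rewrite pderiv0.
  elim: s v vs z => [|b s IH] v vs z.
    by rewrite (homI hf) pderiv_idem lin_sum // => b; rewrite pderiv_idem.
  have /andP [_ bs] := vs.
  rewrite (mk_cons vs) (homM hf) pderivM -!(homM hf) (IH _ bs).
  under [RHS]eq_bigr => c _ do rewrite pderivM homD pderivDr.
  rewrite big_split /=; congr (_ + _).
  rewrite (bigD1 b) //= big1 ?addr0 => [|c cb]; last first.
    by rewrite pderiv_arr eq_sym (negPf cb) hom0 pderivr0.
  rewrite pderiv_arr eqxx !(homM hf) !(homI hf).
  rewrite -{1}[arr b]arr_idem -{1}[arr b]idem_arr !(homM hf) !(homI hf).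
  by rewrite !pderivM !pderiv_idem add0r addr0 !mulrA.
- by rewrite hom0 pderiv0 lin_sum // => b; rewrite pderiv0.
Qed.
End Hom.

(* Cyclic words only: on other words [cyc_deriv] has spurious terms. *)
Lemma cyc_derivE Q (a : arrow Q) (W : pathalg K Q) : is_potential W ->
  cyc_deriv a W = pderiv a W 1.
Proof.
have wd v s y : word_deriv a v s y = \sum_(i < size s | tnth (in_tuple s) i == a)
    mkpath K (src a) (drop i.+1 s) * y * mkpath K v (take i s).
  elim: s v y => [|b s IH] v y; first by rewrite big_ord0.
  rewrite big_mkcond big_ord_recl /= (tnth_nth b) /= drop0; congr (_ + _).
  rewrite IH [LHS]big_mkcond; apply: eq_bigr => i _.
  rewrite !(tnth_nth b) /=; case: eqP => // _.
  by rewrite -!mulrA mk_mul.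
move=> PW; rewrite /cyc_deriv /pderiv !linextE !big_seq.
apply: eq_bigr => p /PW /andP [_ /eqP cp]; congr (_ *: _).
rewrite wd; apply: eq_bigr => i /eqP ai; rewrite mulr1 mk_mul //.
case: p cp i ai => [[v s] /= vs]; rewrite /psrc /ptgt /pword /= => sv i ai.
have [_] := is_word_deriv vs sv ai; rewrite wsrc_cat.
move: (ai); rewrite (tnth_nth a) /= => ai'.
have es : s = take i s ++ a :: drop i.+1 s.
  by rewrite -{1}(cat_take_drop i s) (drop_nth a) ?ai'.
by move=> _; move: sv; rewrite {1}es wsrc_cat.
Qed.

(** Cyclically equivalent potentials differ by commutators; [f] preserves commutators and [pderiv]
    with 1 kills them. *)
Lemma pderiv_cyc_equiv Q Q' (f : pathalg K Q -> pathalg K Q') W W' a :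
  alghom f -> cyc_equiv W W' -> pderiv a (f W) 1 = pderiv a (f W') 1.
Proof.
move=> hf [r /allP cr E]; apply/eqP; rewrite -subr_eq0 -pderivN -pderivD -(homB hf).
rewrite E (hom_sum hf) pderiv_sum big_seq big1 // => t /cr.
case: t => c [[v s] vs]; rewrite /is_cycle /psrc /ptgt /pword /= => /andP [s0 /eqP sv].
rewrite (homZ hf) pderivZ (homB hf) pderivD pderivN basisE /rotate /ptgt /pword /=.
case: s vs s0 sv => // b s vs _ sv; rewrite (mk_cons vs).
have bv : tgt b = v by case/andP: vs => /eqP.
have -> : mkpath K (src b) (rcons s b) = mkpath K (src b) s * arr b.
  by rewrite /arr bv mk_mul ?cats1.
by rewrite !(homM hf) pderiv_commutator subrr scaler0.
Qed.
End CyclicDerivation.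

(** * Jacobian ideals *)

Section JacobiIdeal.
Variables (K : fieldType) (V : finType).
Implicit Types Q : quiver V.

Record two_sided Q (I : pathalg K Q -> Prop) : Prop := TwoSided {
  ts0 : I 0;
  tsD : forall x y, I x -> I y -> I (x + y);
  tsMl : forall x y, I y -> I (x * y);
  tsMr : forall x y, I x -> I (x * y) }.

Section Ideal.
Variables (Q : quiver V) (I : pathalg K Q -> Prop).
Hypothesis hI : two_sided I.

Lemma tsZ c x : I x -> I (c *: x).
Proof. by move=> Ix; rewrite -[x]mul1r -scaleAl; apply: tsMl. Qed.

Lemma tsN x : I x -> I (- x).
Proof. by rewrite -scaleN1r; apply: tsZ. Qed.

Lemma tsB x y : I x -> I y -> I (x - y).
Proof. by move=> Ix Iy; apply: tsD => //; apply: tsN. Qed.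

Lemma ts_sum J (r : seq J) (P : pred J) F :
  (forall j, P j -> I (F j)) -> I (\sum_(j <- r | P j) F j).
Proof. by move=> IF; elim/big_ind: _ => //; [apply: ts0 | apply: tsD]. Qed.

(** Every term of [pderiv a x y] contains y as a factor. With the chain rule, this carries Jacobian
    ideals along homomorphisms. *)
Lemma pderiv_ideal (a : arrow Q) x y : I y -> I (pderiv a x y).
Proof.
move=> Iy; elim/pathalg_ind: x => [|v s|c x x' IH IH'].
- by rewrite pderiv0; apply: ts0.
- rewrite pderiv_mk; case: ifP => _; last exact: ts0.
  elim: s v y Iy => [|b s IH] v y Iy /=; first exact: ts0.
  apply: tsD => //; last by apply: IH; apply: tsMr.
  case: ifP => _; last exact: ts0.
  by apply: tsMr => //; apply: tsMl.
- by rewrite pderivP; apply: tsD => //; apply: tsZ.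
Qed.
End Ideal.

Lemma jacobi_two_sided Q (W : pathalg K Q) : two_sided (jacobi_ideal W).
Proof.
split.
- by exists [::]; rewrite big_nil.
- by move=> x y [r ->] [r' ->]; exists (r ++ r'); rewrite big_cat.
- move=> x y [r ->]; exists [seq (x * t.1.1, t.1.2, t.2) | t <- r].
  by rewrite big_map mulr_sumr; apply: eq_bigr => t _; rewrite !mulrA.
- move=> x y [r ->]; exists [seq (t.1.1, t.1.2, t.2 * y) | t <- r].
  by rewrite big_map mulr_suml; apply: eq_bigr => t _; rewrite !mulrA.
Qed.

Lemma jacobi_deriv Q (W : pathalg K Q) a : jacobi_ideal W (cyc_deriv a W).
Proof. by exists [:: (1, a, 1)]; rewrite big_seq1 mul1r mulr1. Qed.

Lemma jacobi_min Q (W : pathalg K Q) (I : pathalg K Q -> Prop) : two_sided I ->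
  (forall a, I (cyc_deriv a W)) -> forall x, jacobi_ideal W x -> I x.
Proof.
move=> hI hD x [r ->]; apply: ts_sum => // t _.
by apply: tsMr => //; apply: tsMl.
Qed.

Lemma two_sided_preim Q Q' (f : pathalg K Q -> pathalg K Q')
    (I : pathalg K Q' -> Prop) :
  alghom f -> two_sided I -> two_sided (fun x => I (f x)).
Proof.
move=> hf hI; split.
- by rewrite (hom0 hf); apply: ts0.
- by move=> x y; rewrite (homD hf); apply: tsD.
- by move=> x y; rewrite (homM hf); apply: tsMl.
- by move=> x y; rewrite (homM hf); apply: tsMr.
Qed.

Lemma hom_ext Q Q' (f g : pathalg K Q -> pathalg K Q') : alghom f -> alghom g ->
  (forall b, f (arr K b) = g (arr K b)) -> forall x, f x = g x.
Proof.
move=> hf hg fg x; elim/pathalg_ind: x => [|v s|c x y IH IH'].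
- by rewrite (hom0 hf) (hom0 hg).
- have [vs|vs] := boolP (is_word v s); last by rewrite mkpath_eq0 // (hom0 hf) (hom0 hg).
  elim: s v vs => [|b s IH] v vs; first by rewrite (homI hf) (homI hg).
  by have /andP [_ bs] := vs; rewrite (mk_cons _ vs) (homM hf) (homM hg) fg IH.
- by rewrite (homP hf) (homP hg) IH IH'.
Qed.

Lemma hom_id Q : alghom (@id (pathalg K Q)).
Proof. by []. Qed.

Lemma hom_comp Q Q' Q'' (f : pathalg K Q -> pathalg K Q')
    (g : pathalg K Q' -> pathalg K Q'') :
  alghom f -> alghom g -> alghom (fun x => g (f x)).
Proof.
by move=> hf hg; split=> [c x y|x y|v]; rewrite ?(homP hf, homM hf, homI hf)
  ?(homP hg, homM hg, homI hg).
Qed.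

Section Lift.
Variables (Q Q' : quiver V) (th : arrow Q -> pathalg K Q').
Hypothesis th_ends : forall b, idem K Q' (tgt b) * th b * idem K Q' (src b) = th b.

Fixpoint word_prod v s : pathalg K Q' :=
  if s is b :: s' then th b * word_prod (src b) s' else idem K Q' v.

Definition path_lift : pathalg K Q -> pathalg K Q' :=
  linext (fun p => word_prod (ptgt p) (pword p)).

Lemma path_lift_mk v s : is_word v s -> path_lift (mkpath K v s) = word_prod v s.
Proof. by move=> vs; rewrite /path_lift (linext_mkpath word_prod) vs. Qed.

(** Universal property of the path algebra. Products of paths that do not compose are 0 in the
    source; in the target they vanish because [th_ends] places two distinct idempotents next to each
    other. *)
Lemma path_lift_hom : alghom path_lift.
Proof.
have th_l b : idem K Q' (tgt b) * th b = th b.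
  by rewrite -th_ends !mulrA idemK.
have th_r b : th b * idem K Q' (src b) = th b.
  by rewrite -th_ends -!mulrA idemK.
have wpl v s : is_word v s -> idem K Q' v * word_prod v s = word_prod v s.
  case: s => [_|b s /andP [/eqP <- _]] /=; first exact: idemK.
  by rewrite mulrA th_l.
have wpc v s t : word_prod v (s ++ t) = word_prod v s * word_prod (wsrc v s) t \/ ~~ is_word v (s ++ t).
  have [vst|_] := boolP (is_word v (s ++ t)); [left | by right].
  elim: s v vst => [|b s IH] v /= vst; first by rewrite wpl.
  by have /andP [_ st] := vst; rewrite IH // mulrA.
have wpr v s : word_prod v s * idem K Q' (wsrc v s) = word_prod v s.
  elim: s v => [|b s IH] v /=; first exact: idemK.
  by rewrite -mulrA IH.
have lin c x y : path_lift (c *: x + y) = c *: path_lift x + path_lift y by exact: linext_is_linear.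
have l0 : path_lift 0 = 0 by exact: linext0.
split=> // [x y|v]; last by rewrite path_lift_mk.
elim/pathalg_ind: x y => [|v s|c x x' IH IH'] y.
- by rewrite mul0r l0 mul0r.
- elim/pathalg_ind: y => [|w t|c y y' IH IH'].
  + by rewrite mulr0 l0 mulr0.
  + have [vs|vs] := boolP (is_word v s); last first.
      by rewrite (mkpath_eq0 _ vs) mul0r l0 mul0r.
    have [wt|wt] := boolP (is_word w t); last first.
      by rewrite (mkpath_eq0 _ wt) mulr0 l0 mulr0.
    have [sw|sw] := eqVneq (wsrc v s) w; last first.
      rewrite mk_mul0 // l0 !path_lift_mk // -(wpr v s) -(wpl w t) // -mulrA.
      by rewrite [idem _ _ _ * (_ * _)]mulrA idem_mulM (negPf sw) scale0r mul0r mulr0.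
    rewrite mk_mul // !path_lift_mk ?is_word_cat ?vs ?sw //.
    by case: (wpc v s t) => [->|]; rewrite ?sw // is_word_cat vs sw wt.
  + by rewrite mulrDr scaleAr !lin IH IH' mulrDr scaleAr.
- by rewrite mulrDl scaleAl !lin IH IH' mulrDl scaleAl.
Qed.

Lemma path_lift_arr b : path_lift (arr K b) = th b.
Proof. by rewrite path_lift_mk /= ?eqxx // -th_ends -!mulrA idemK. Qed.
End Lift.

Lemma pathalg_map_mk Q Q' (g : arrow Q -> arrow Q') v s :
  (forall a, src (g a) = src a) -> (forall a, tgt (g a) = tgt a) ->
  pathalg_map id g (mkpath K v s) = mkpath K v (map g s).
Proof.
move=> gs gt; rewrite /pathalg_map (linext_mkpath (fun v s => mkpath K v (map g s))).
have -> : is_word v s = is_word v (map g s).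
  by elim: s v => //= a s IH v; rewrite gt gs IH.
by case: ifPn => // vs; rewrite mkpath_eq0.
Qed.

Lemma pathalg_map_hom Q Q' (g : arrow Q -> arrow Q') :
  (forall a, src (g a) = src a) -> (forall a, tgt (g a) = tgt a) ->
  alghom (pathalg_map id g : pathalg K Q -> pathalg K Q').
Proof.
move=> gs gt; set f := pathalg_map _ _.
have lin c x y : f (c *: x + y) = c *: f x + f y by exact: linext_is_linear.
have f0 : f 0 = 0 by exact: linext0.
split=> // [x y|v]; last by rewrite /f pathalg_map_mk.
elim/pathalg_ind: x y => [|v s|c x x' IH IH'] y.
- by rewrite mul0r f0 mul0r.
- elim/pathalg_ind: y => [|w t|c y y' IH IH'].
  + by rewrite mulr0 f0 mulr0.
  + have ws : wsrc v (map g s) = wsrc v s.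
      by rewrite /wsrc -map_comp; congr last; apply: eq_map => a /=.
    have [sw|sw] := eqVneq (wsrc v s) w.
      by rewrite mk_mul // /f !pathalg_map_mk // mk_mul ?ws // map_cat.
    by rewrite mk_mul0 // f0 /f !pathalg_map_mk // mk_mul0 ?ws.
  + by rewrite mulrDr scaleAr !lin IH IH' mulrDr scaleAr.
- by rewrite mulrDl scaleAl !lin IH IH' mulrDl scaleAl.
Qed.

Lemma pathalg_map_arr Q Q' (g : arrow Q -> arrow Q') b :
  (forall a, src (g a) = src a) -> (forall a, tgt (g a) = tgt a) ->
  pathalg_map id g (arr K b) = arr K (g b).
Proof. by move=> gs gt; rewrite pathalg_map_mk // /arr gt. Qed.

Lemma pcoef_mk Q v s (p : qpath Q) :
  pcoef p (mkpath K v s) = ((v, s) == val p)%:R.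
Proof.
have [vs|vs] := boolP (is_word v s).
  by rewrite mkpath_basis pcoef_basis -val_eqE.
rewrite mkpath_eq0 // pcoef0; case: eqP => // E.
by have := valP p; rewrite -E (negPf vs).
Qed.
End JacobiIdeal.

(** * Reduction of quivers with potential *)

Section Reduction.
Variables (K : fieldType) (V : finType).
Implicit Types Q : quiver V.

(** A path from v to v that passes through another vertex w consists of two nonempty pieces, so its
    length is at least 2. *)
Lemma pcoef_factor Q (v w : V) (p : qpath Q) (X Y : pathalg K Q) :
  w != v -> (val p).1 = v -> (size (pword p) <= 1)%N ->
  pcoef p (X * idem K Q w * (idem K Q w * Y * idem K Q v)) = 0.
Proof.
move=> wv pv sp; elim/pathalg_ind: X => [|v1 s1|c X X' IH IH'].
- by rewrite !mul0r pcoef0.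
- elim/pathalg_ind: Y => [|v2 s2|c Y Y' IH IH'].
  + by rewrite !(mul0r, mulr0) pcoef0.
  + rewrite mk_idem idem_mk; case: eqP => [s1w|_]; last by rewrite mul0r pcoef0.
    case: eqP => [<-|_]; last by rewrite mul0r mulr0 pcoef0.
    rewrite mk_idem; case: eqP => [s2v|_]; last by rewrite mulr0 pcoef0.
    rewrite mk_mul // pcoef_mk; case: eqP => // E.
    move: sp pv; rewrite /pword -E /= size_cat => sp v1v.
    case: s1 s1w sp E => [|a1 s1]; first by rewrite /wsrc /= v1v => E; rewrite E eqxx in wv.
    case: s2 s2v => [|a2 s2]; first by rewrite /wsrc /= => E; rewrite E eqxx in wv.
    by rewrite /= addnS.
  + rewrite mulrDr scaleAr !mulrDl !scaleAl mulrDr scaleAr pcoefD pcoefZ IH IH'.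
    by rewrite mulr0 addr0.
- by rewrite !mulrDl !scaleAl pcoefD pcoefZ IH IH' mulr0 addr0.
Qed.

(* If [a] were a loop at v, it would be the image of a combination of [e_v] and
   of products of two paths through vertices other than v. *)
Lemma hom_loopless Q Q' (f : pathalg K Q -> pathalg K Q') :
  alghom f -> (forall y, exists x, f x = y) -> loopless Q -> loopless Q'.
Proof.
move=> hf sf llQ a; apply/negP => /eqP av.
have [y fy] := sf (arr K a); set v := tgt a in av.
have aw : is_word v [:: a] by rewrite /= eqxx.
pose p : qpath Q' := exist _ (v, [:: a]) aw.
have coef0 x : pcoef p (f (idem K Q v * x * idem K Q v)) = 0.
  elim/pathalg_ind: x => [|w s|c x x' IH IH'].
  - by rewrite mulr0 mul0r (hom0 hf) pcoef0.
  - rewrite idem_mk; case: eqP => [<-|_]; last by rewrite mul0r (hom0 hf) pcoef0.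
    rewrite mk_idem; case: eqP => [sv|_]; last by rewrite (hom0 hf) pcoef0.
    have [vs|vs] := boolP (is_word v s); last by rewrite mkpath_eq0 // (hom0 hf) pcoef0.
    case: s vs sv => [_ _|b s vs sv]; first by rewrite (homI hf) pcoef_mk xpair_eqE andbF.
    have /andP [/eqP bv bs] := vs.
    have sv' : wsrc (src b) s = v by [].
    rewrite (mk_cons _ vs) -arr_idem (homM hf) (homM hf) (homI hf).
    have -> : mkpath K (src b) s = idem K Q (src b) * mkpath K (src b) s * idem K Q v.
      by rewrite idem_mk eqxx mk_idem sv' eqxx.
    rewrite !(homM hf) !(homI hf) pcoef_factor //.
    by rewrite -bv llQ.
  - by rewrite mulrDr mulrDl scaleAr scaleAl (homP hf) pcoefD pcoefZ IH IH' mulr0 addr0.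
have := coef0 y; rewrite !(homM hf) (homI hf) fy idem_arr -{1}av arr_idem.
by rewrite pcoef_mk eqxx => /eqP; rewrite oner_eq0.
Qed.

(** The corner of the Jacobi algebra at [F] is spanned by idempotents. The product of the two
    idempotents covers both cases: it is 0 when v and w differ. *)
Definition corner (F : pred V) (P : qp K V) : Prop :=
  forall v w x, F v -> F w -> exists c : K,
    jacobi_ideal (qp_pot P)
      (idem K (qp_quiver P) v * x * idem K (qp_quiver P) w
       - c *: (idem K _ v * idem K _ w)).

Lemma jacobi_hom Q Q' (f : pathalg K Q -> pathalg K Q') (W : pathalg K Q)
    (W' : pathalg K Q') : alghom f ->
  (forall a, jacobi_ideal W' (f (cyc_deriv a W))) ->
  forall x, jacobi_ideal W x -> jacobi_ideal W' (f x).
Proof.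
move=> hf fD x; apply: (@jacobi_min _ _ _ W (fun x => jacobi_ideal W' (f x))) => //.
by apply: two_sided_preim => //; apply: jacobi_two_sided.
Qed.

Lemma dsum_deriv (P1 P2 : qp K V) : finite_qp P1 -> finite_qp P2 ->
  let Q := dsum_quiver (qp_quiver P1) (qp_quiver P2) in
  (forall a : arrow (qp_quiver P1), cyc_deriv (inl a : arrow Q) (qp_pot (dsum_qp P1 P2)) =
    pathalg_map (Q' := Q) id inl (cyc_deriv a (qp_pot P1))) /\
  (forall a : arrow (qp_quiver P2), cyc_deriv (inr a : arrow Q) (qp_pot (dsum_qp P1 P2)) =
    pathalg_map (Q' := Q) id inr (cyc_deriv a (qp_pot P2))).
Proof.
move=> fP1 fP2 Q.
have f1 : is_potential (pathalg_map (Q' := Q) id inl (qp_pot P1)).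
  by apply: is_potential_map.
have f2 : is_potential (pathalg_map (Q' := Q) id inr (qp_pot P2)).
  by apply: is_potential_map.
have h1 : alghom (pathalg_map (Q' := Q) id inl : pathalg K (qp_quiver P1) -> _).
  exact: pathalg_map_hom.
have h2 : alghom (pathalg_map (Q' := Q) id inr : pathalg K (qp_quiver P2) -> _).
  exact: pathalg_map_hom.
have D1 (b : arrow Q) : pderiv b (pathalg_map (Q' := Q) id inl (qp_pot P1)) 1 =
    if b is inl a then pathalg_map (Q' := Q) id inl (pderiv a (qp_pot P1) 1) else 0.
  rewrite -(hom1 h1) (pderiv_hom h1); case: b => a.
    rewrite (bigD1 a) //= big1 => [|c ca].
      rewrite pathalg_map_arr // pderiv_arr eqxx addr0.
      have := pderiv_ends a (qp_pot P1) 1 => /(congr1 (pathalg_map (Q' := Q) id inl)).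
      by rewrite !(homM h1) !(homI h1).
    rewrite pathalg_map_arr // pderiv_arr; case: eqP => // -[E].
    by rewrite E eqxx in ca.
  by rewrite big1 // => c _; rewrite pathalg_map_arr // pderiv_arr.
have D2 (b : arrow Q) : pderiv b (pathalg_map (Q' := Q) id inr (qp_pot P2)) 1 =
    if b is inr a then pathalg_map (Q' := Q) id inr (pderiv a (qp_pot P2) 1) else 0.
  rewrite -(hom1 h2) (pderiv_hom h2); case: b => a.
    by rewrite big1 // => c _; rewrite pathalg_map_arr // pderiv_arr.
  rewrite (bigD1 a) //= big1 => [|c ca].
    rewrite pathalg_map_arr // pderiv_arr eqxx addr0.
    have := pderiv_ends a (qp_pot P2) 1 => /(congr1 (pathalg_map (Q' := Q) id inr)).
    by rewrite !(homM h2) !(homI h2).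
  rewrite pathalg_map_arr // pderiv_arr; case: eqP => // -[E].
  by rewrite E eqxx in ca.
have fd : is_potential (qp_pot (dsum_qp P1 P2)) by exact: is_potentialD.
have D b : pderiv b (qp_pot (dsum_qp P1 P2)) 1 =
    pderiv b (pathalg_map (Q' := Q) id inl (qp_pot P1)) 1
    + pderiv b (pathalg_map (Q' := Q) id inr (qp_pot P2)) 1 by exact: pderivD.
by split=> a; rewrite !cyc_derivE // D D1 D2 ?addr0 ?add0r.
Qed.

(** Relations travel along [phi] into the direct sum and then along [rho], which kills the arrows of
    the trivial summand. A derivative of the trivial potential dies under [rho] unless it has an
    idempotent term, which only a loop produces; loops are excluded by transporting looplessness
    through [phi]. *)
Lemma corner_reduced F (P Pr : qp K V) : loopless (qp_quiver P) -> finite_qp P ->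
  corner F P -> reduced_part P Pr -> corner F Pr.
Proof.
move=> llP fP cP [fPr _ [Pt [fPt _ [phi [phiZ [psi phiK psiK] phiI phiW]]]]].
set Q := dsum_quiver (qp_quiver Pr) (qp_quiver Pt).
have hphi : alghom (phi : pathalg K (qp_quiver P) -> pathalg K Q).
  by split=> [c x y|x y|v]; rewrite ?rmorphD ?phiZ ?rmorphM ?phiI.
have phi_inj := can_inj phiK.
have hpsi : alghom psi.
  split=> [c x y|x y|v]; apply: phi_inj.
  - by rewrite psiK (homP hphi) !psiK.
  - by rewrite psiK (homM hphi) !psiK.
  - by rewrite psiK phiI.
have llQ : loopless Q.
  by apply: (hom_loopless hphi) => // y; exists (psi y); rewrite psiK.
pose th (b : arrow Q) : pathalg K (qp_quiver Pr) :=
  match b with inl a => arr K a | inr _ => 0 end.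
have thE b : idem K _ (tgt b) * th b * idem K _ (src b) = th b.
  by case: b => a; rewrite /= ?mulr0 ?mul0r // idem_arr arr_idem.
have hrho := path_lift_hom thE; set rho := path_lift th in hrho.
have h1 : alghom (pathalg_map (Q' := Q) id inl : pathalg K (qp_quiver Pr) -> _).
  exact: pathalg_map_hom.
have rho1 x : rho (pathalg_map (Q' := Q) id inl x) = x.
  apply: (hom_ext (hom_comp h1 hrho) (@hom_id _ _ _)) => b.
  by rewrite pathalg_map_arr // /rho (path_lift_arr thE).
have [D1 D2] := dsum_deriv fPr fPt.
have fdsum : finite_qp (dsum_qp Pr Pt).
  by apply: is_potentialD; apply: is_potential_map.
have phi_jac x : jacobi_ideal (qp_pot P) x ->
    jacobi_ideal (qp_pot (dsum_qp Pr Pt)) (phi x).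
  apply: (jacobi_hom hphi) => a.
  (* The potential of [P] is [psi] of its image, and that image is cyclically equivalent to the
     potential of the sum. The chain rule for [psi] then expresses the derivative through
     derivatives of the latter. *)
  rewrite cyc_derivE // -{1}[qp_pot P]phiK.
  rewrite (pderiv_cyc_equiv a hpsi phiW) -(hom1 hpsi) (pderiv_hom hpsi).
  have ts := jacobi_two_sided (qp_pot (dsum_qp Pr Pt)).
  rewrite (hom_sum hphi); apply: (ts_sum ts) => b _.
  apply: (pderiv_ideal (two_sided_preim hphi ts)).
  by rewrite psiK -cyc_derivE //; apply: jacobi_deriv.
have rho_jac x : jacobi_ideal (qp_pot (dsum_qp Pr Pt)) x ->
    jacobi_ideal (qp_pot Pr) (rho x).
  apply: (jacobi_hom hrho) => -[] a.
    by rewrite D1 rho1; apply: jacobi_deriv.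
  rewrite D2.
  suff -> : rho (pathalg_map (Q' := Q) id inr (cyc_deriv a (qp_pot Pt))) = 0.
    exact: ts0 (jacobi_two_sided _).
  rewrite /cyc_deriv linextE big_seq.
  have h2 : alghom (pathalg_map (Q' := Q) id inr : pathalg K (qp_quiver Pt) -> _).
    exact: pathalg_map_hom.
  have hc := hom_comp h2 hrho; rewrite (hom_sum hc) big1 // => p /fPt.
  case: p => [[v s] vs] /andP []; rewrite /psrc /ptgt /pword /= => s0 sv.
  rewrite (homZ hc) (hom_sum hc) big1 ?scaler0 // => i _.
  case E : (drop _ _ ++ _) => [|b t].
    case: s vs s0 sv i E => [|b [|b' s]] //= vs _ sv i.
      have /andP [/eqP bv _] := vs; have /eqP sb : src b == v := sv.
      by have := llQ (inr b); rewrite /= sb bv eqxx.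
    move=> E; have := congr1 size E; have := ltn_ord i.
    by rewrite size_cat size_drop size_takel ?(ltnW (ltn_ord i)) //=; lia.
  rewrite pathalg_map_mk //.
  have [bt|bt] := boolP (is_word (Q := Q) (src a) (map inr (b :: t))); last first.
    by rewrite (mkpath_eq0 _ bt) (hom0 hrho).
  by rewrite /rho path_lift_mk //= mul0r.
move=> v w x Fv Fw.
have [c /phi_jac /rho_jac] := cP v w (psi (pathalg_map (Q' := Q) id inl x)) Fv Fw.
rewrite (homB hphi) (homZ hphi) !(homM hphi) !(homI hphi) psiK.
rewrite (homB hrho) (homZ hrho) !(homM hrho) !(homI hrho) rho1 => Jx.
by exists c.
Qed.
End Reduction.

(** * Premutation of quivers with potential *)

Section Premutation.
Variables (K : fieldType) (V : finType) (k : V) (Q : quiver V).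
Variable W : pathalg K Q.
Hypotheses (llQ : loopless Q) (PW : is_potential W).

Let Q' := premut_quiver k Q.
Let W' : pathalg K Q' := qp_pot (premut_qp k (QP W)).
Let Delta : pathalg K Q' := premut_delta K k Q.

Let letter (b : through k Q + arrow Q) : arrow Q' := b.

Definition clean (b : arrow Q') : bool :=
  match b with inl _ => true | inr a => ~~ incident k a end.

Let thT (b : arrow Q') : pathalg K Q :=
  match b with
  | inl c => arr K (val c).2 * arr K (val c).1
  | inr a => if incident k a then 0 else arr K a
  end.

Let thP (b : arrow Q') : pathalg K Q' := if clean b then arr K b else 0.

(* [Theta] multiplies the composite arrows out, and both maps kill the
   reversed arrows. *)
Let Theta := path_lift thT.
Let Pi := path_lift thP.

Lemma through_tgt (c : through k Q) : tgt (val c).1 = k.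
Proof. by have /andP [/eqP -> _] := valP c. Qed.

Lemma through_src (c : through k Q) : src (val c).2 = k.
Proof. by have /andP [_ /eqP ->] := valP c. Qed.

Lemma thT_ends b : idem K Q (tgt b) * thT b * idem K Q (src b) = thT b.
Proof.
case: b => [c|a] /=; first by rewrite -!mulrA arr_idem !mulrA idem_arr.
by case: ifP => _; rewrite ?mulr0 ?mul0r // idem_arr arr_idem.
Qed.

Lemma thP_ends b : idem K Q' (tgt b) * thP b * idem K Q' (src b) = thP b.
Proof. by rewrite /thP; case: ifP => _; rewrite ?mulr0 ?mul0r // idem_arr arr_idem. Qed.

Let hT : alghom Theta := path_lift_hom thT_ends.
Let hP : alghom Pi := path_lift_hom thP_ends.

Let Theta_arr b : Theta (arr K b) = thT b := path_lift_arr thT_ends b.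
Let Pi_arr b : Pi (arr K b) = thP b := path_lift_arr thP_ends b.

Lemma Pi_idem x : Pi (Pi x) = Pi x.
Proof.
apply: (hom_ext (hom_comp hP hP) hP) => b; rewrite Pi_arr /thP.
by case: ifP => cb; rewrite ?(hom0 hP) // Pi_arr /thP cb.
Qed.

Lemma Theta_Pi x : Theta (Pi x) = Theta x.
Proof.
apply: (hom_ext (hom_comp hP hT) hT) => b; rewrite Pi_arr /thP.
case: ifP => // cb; rewrite (hom0 hT) Theta_arr.
by case: b cb => //= a /negbT; rewrite negbK => ->.
Qed.

Lemma Pi_mk v s : is_word v s -> Pi (mkpath K v s) = if all clean s then mkpath K v s else 0.
Proof.
elim: s v => [|b s IH] v vs; first by rewrite [LHS](homI hP).
have /andP [_ bs] := vs.
rewrite (mk_cons _ vs) (homM hP) IH // Pi_arr /thP /=.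
by case: (clean b) => /=; rewrite ?mul0r //; case: ifP => _; rewrite ?mulr0.
Qed.

Fixpoint unbracket (s : seq (arrow Q')) : seq (arrow Q) :=
  match s with
  | [::] => [::]
  | inl c :: s => [:: (val c).2, (val c).1 & unbracket s]
  | inr a :: s => a :: unbracket s
  end.

Lemma Theta_mk v s : is_word v s -> all clean s ->
  Theta (mkpath K v s) = mkpath K v (unbracket s).
Proof.
elim: s v => [|b s IH] v vs; first by rewrite [LHS](homI hT).
have /andP [/eqP bv bs] := vs.
move=> /= /andP [cb cs]; rewrite (mk_cons _ vs) (homM hT) (IH _ bs cs) Theta_arr -bv.
case: b cb {vs bv bs} => [c|a] /= ca.
  by rewrite -mulrA /arr !mk_mul // /wsrc /= through_tgt through_src.
by rewrite (negPf ca) /arr mk_mul.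
Qed.

Lemma unbracketK s : all clean s -> bracket_word k (unbracket s) = s.
Proof.
elim: s => [|[c|a] s IH] //=.
  by rewrite -surjective_pairing valK => /IH ->.
move=> /andP [ca /IH E]; rewrite -[in RHS]E; case: (unbracket s) => [|a' s'] //.
rewrite [LHS]/= insubN //= negb_and; move: ca; rewrite /incident negb_or.
by move=> /andP [-> _]; rewrite orbT.
Qed.

(** A clean word is recovered from its multiplied-out form by bracketing the passages through k, so
    [B] is a left inverse of [Theta] on the image of [Pi]. *)
Lemma Theta_inj x : Pi x = x -> Theta x = 0 -> x = 0.
Proof.
pose B := linext (fun p => mkpath K (ptgt p) (bracket_word k (pword p))) :
  pathalg K Q -> pathalg K Q'.
have BL c y z : B (c *: y + z) = c *: B y + B z by exact: linext_is_linear.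
have B0 : B 0 = 0 by exact: linext0.
have BT y : B (Theta (Pi y)) = Pi y.
  elim/pathalg_ind: y => [|v s|c y z IH IH'].
  - by rewrite (hom0 hP) (hom0 hT) B0.
  - have [vs|vs] := boolP (is_word v s); last first.
      by rewrite (mkpath_eq0 _ vs) (hom0 hP) (hom0 hT) B0.
    rewrite Pi_mk //; case: ifP => cs; last by rewrite (hom0 hT) B0.
    rewrite Theta_mk // /B (linext_mkpath (fun v s => mkpath K v (bracket_word k s))).
    rewrite unbracketK //; case: ifP => // /negP []; move: vs.
    elim: s v cs => //= b s IH v /andP [cb cs] /andP [/eqP bv bs].
    case: b cb bv bs => [c|a] /= ca bv bs.
      by rewrite bv eqxx through_tgt through_src eqxx IH.
    by move: bv bs; rewrite (negPf ca) => ->; rewrite eqxx; apply: IH.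
  - by rewrite (homP hP) (homP hT) BL IH IH'.
by move=> Px Tx; rewrite -Px -BT Px Tx B0.
Qed.

Lemma bracket_word_img v s : v != k -> wsrc v s != k -> is_word v s ->
  Theta (mkpath K v (bracket_word k s)) = mkpath K v s /\
  Pi (mkpath K v (bracket_word k s)) = mkpath K v (bracket_word k s).
Proof.
move=> vk sk vs; have [bs _] := is_word_bracket llQ vk sk vs.
suff [cs E] : all clean (bracket_word k s) /\ unbracket (bracket_word k s) = s.
  by rewrite Theta_mk // Pi_mk // cs E.
have [m] := ubnP (size s); elim: m s v vk sk vs {bs} => // m IH [|b [|a s]] v //= vk.
  rewrite /wsrc /= => bk /andP [/eqP bv _] _; split => //.
  by rewrite /incident bv (negPf vk) (negPf bk).
move=> wk /and3P [/eqP tb /eqP ta ws] sm.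
have [sb|sb] := eqVneq (src b) k.
  have h : (tgt (a, b).1 == k) && (src (a, b).2 == k) by rewrite /= ta sb eqxx.
  have ak : src a != k by rewrite -sb -ta llQ.
  have [cs E] := IH s (src a) ak wk ws (ltnW sm).
  by rewrite insubT /= cs E.
have aw : is_word (src b) (a :: s) by rewrite /= ta eqxx.
have [cs E] := IH (a :: s) (src b) sb wk aw sm.
rewrite insubN /= ?negb_and ?sb ?orbT //; split.
  by rewrite /incident tb (negPf sb) (negPf vk).
by congr cons.
Qed.

Lemma premut_delta_img : Theta Delta = 0 /\ Pi Delta = 0.
Proof.
have inc (c : through k Q) : incident k (val c).1.
  by rewrite /incident through_tgt eqxx orbT.
rewrite /Delta /premut_delta (hom_sum hT) (hom_sum hP); split; rewrite big1 // => c _.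
  have [ws _] := is_word_delta c.
  by rewrite (mk_cons _ ws) (homM hT) Theta_arr /= inc mul0r.
have [ws _] := is_word_delta c.
by rewrite (mk_cons _ ws) (homM hP) Pi_arr /thP /= inc mul0r.
Qed.

(** Cycles based at k are rotated before bracketing, so [Theta] returns the cycle only up to
    rotation. Hence the comparison of derivatives instead of elements. *)
Lemma bracket_cycle_img p a : is_cycle p ->
  pderiv a (Theta (bracket_cycle K k p)) 1 = pderiv a (pbasis K p) 1 /\
  Pi (bracket_cycle K k p) = bracket_cycle K k p.
Proof.
case: p => [[v s] vs]; rewrite /is_cycle /bracket_cycle /psrc basisE /pword /ptgt /=.
move=> /andP [s0 /eqP sv]; case: s s0 vs sv => [|b s] // _ vs sv.
have [bv bs] : tgt b = v /\ is_word (src b) s by case/andP: vs => /eqP.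
have [vk|vk] := eqVneq v k; last first.
  by have [|-> ->] := bracket_word_img vk _ vs; rewrite ?sv.
have bk : src b != k by rewrite -vk -bv llQ.
have wr : is_word (src b) (rcons s b).
  by rewrite -cats1 is_word_cat bs /= andbT bv -[X in X == _]sv.
have [|-> ->] := bracket_word_img bk _ wr.
  by rewrite /wsrc map_rcons last_rcons.
split=> //; rewrite (mk_cons _ vs).
have -> : mkpath K (src b) (rcons s b) = mkpath K (src b) s * arr K b.
  by rewrite /arr bv mk_mul ?cats1.
by rewrite pderiv_commutator.
Qed.

Lemma premut_potE : W' = linext (@bracket_cycle K V k Q) W + Delta.
Proof. by []. Qed.

(** [Pi] recovers the bracketed potential from [W'], so the two summands can be differentiated
    separately. *)
Lemma Pi_premut : W' = Pi W' + Delta.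
Proof.
have [_ PD] := premut_delta_img.
rewrite {2}premut_potE (homD hP) PD addr0 premut_potE; congr (_ + _).
rewrite linextE (hom_sum hP) !big_seq; apply: eq_bigr => p /PW cp.
(* [bracket_cycle_img] is stated for some arrow [a]. A cycle contains one, so the arrowless case is
   vacuous. *)
have [a _|noarr] := pickP (@predT (arrow Q)).
  by have [_ E'] := bracket_cycle_img a cp; rewrite (homZ hP) E'.
by case: p cp => [[v [|a s]] vs] /andP [] //; have := noarr a.
Qed.

Lemma pderiv_Theta_premut a : pderiv a (Theta W') 1 = pderiv a W 1.
Proof.
have [TD _] := premut_delta_img.
rewrite premut_potE (homD hT) TD addr0 [in RHS](pathalgE W) linextE (hom_sum hT) !pderiv_sum.
rewrite !big_seq; apply: eq_bigr => p /PW cp.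
have [E _] := bracket_cycle_img a cp.
by rewrite (homZ hT) !pderivZ E.
Qed.

Let D b := pderiv b W' 1.

Lemma jacobi_D b : jacobi_ideal W' (D b).
Proof.
rewrite /D -cyc_derivE; first exact: jacobi_deriv.
exact: (@is_potential_premut _ _ k (QP W) llQ PW).
Qed.

Lemma pderiv_Pi b : pderiv b (Pi W') 1 = if clean b then Pi (D b) else 0.
Proof.
rewrite -(hom1 hP) (pderiv_hom hP) (bigD1 b) //= big1 => [|c cb].
  rewrite addr0 Pi_arr /thP; case: ifP => cl; last by rewrite pderiv0.
  rewrite pderiv_arr eqxx -(homI hP) -(homI hP (tgt b)) -!(homM hP).
  by rewrite pderiv_ends.
rewrite Pi_arr /thP; case: ifP => cl; last by rewrite pderiv0.
by rewrite pderiv_arr (negPf cb).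
Qed.

Lemma D_clean b : clean b -> D b = Pi (D b) + pderiv b Delta 1.
Proof. by move=> cb; rewrite {1}/D Pi_premut pderivD pderiv_Pi cb. Qed.

Lemma D_star a : incident k a -> D (letter (inr a)) = pderiv (letter (inr a)) Delta 1.
Proof. by move=> ca; rewrite /D Pi_premut pderivD pderiv_Pi /= ca add0r. Qed.

(* The arrow [[beta alpha]]; 0 if alpha and beta do not compose through k. *)
Let brk (a b : arrow Q) : pathalg K Q' :=
  if insub (a, b) is Some c then arr K (letter (inl c)) else 0.

Let star (a : arrow Q) : pathalg K Q' := arr K (letter (inr a)).

Lemma brkE (c : through k Q) : brk (val c).1 (val c).2 = arr K (letter (inl c)).
Proof. by rewrite /brk -surjective_pairing valK. Qed.

Lemma Theta_brk a b : tgt a = k -> src b = k -> Theta (brk a b) = arr K b * arr K a.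
Proof.
move=> ta sb; have h : (tgt (a, b).1 == k) && (src (a, b).2 == k) by rewrite /= ta sb eqxx.
by rewrite /brk insubT Theta_arr.
Qed.

Lemma Pi_brk a b : Pi (brk a b) = brk a b.
Proof. by rewrite /brk; case: insub => [c|]; rewrite ?(hom0 hP) // Pi_arr. Qed.

Lemma star_idem a : incident k a ->
  idem K Q' (src a) * star a = star a /\ star a * idem K Q' (tgt a) = star a.
Proof.
by move=> ca; rewrite /star /arr idem_mk mk_idem /wsrc /letter /= ca !eqxx.
Qed.

Lemma inc1 (c : through k Q) : incident k (val c).1.
Proof. by rewrite /incident through_tgt eqxx orbT. Qed.

Lemma inc2 (c : through k Q) : incident k (val c).2.
Proof. by rewrite /incident through_src eqxx. Qed.

Lemma delta_prod (c : through k Q) :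
  mkpath K (src (val c).1) (delta_word c) = star (val c).1 * star (val c).2 * arr K (letter (inl c)).
Proof.
rewrite /star /arr /letter /= /incident through_tgt through_src !eqxx orbT /=.
by rewrite !mk_mul // /wsrc /= /incident ?through_tgt ?through_src eqxx ?orbT.
Qed.

Lemma pderiv_delta b : pderiv b Delta 1 = \sum_c pderiv b (star (val c).1 * star (val c).2 * arr K (letter (inl c))) 1.
Proof. by rewrite /Delta /premut_delta pderiv_sum; apply: eq_bigr => c _; rewrite delta_prod. Qed.

Lemma delta_inl c : pderiv (letter (inl c)) Delta 1 = star (val c).1 * star (val c).2.
Proof.
have E (c' : through k Q) a : (letter (inr a) == letter (inl c')) = false by [].
have E' (c' : through k Q) : (letter (inl c') == letter (inl c)) = (c' == c) by [].
rewrite pderiv_delta (bigD1 c) //= big1 => [|c' cc]; rewrite !pderivM !pderiv_arr !E E' ?eqxx.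
  have [x1 _] := star_idem (inc1 c); have [_ y2] := star_idem (inc2 c).
  by rewrite !add0r addr0 mul1r mulrA x1 -mulrA y2.
by rewrite (negPf cc) !addr0.
Qed.

Lemma delta_inr a : ~~ incident k a -> pderiv (letter (inr a)) Delta 1 = 0.
Proof.
rewrite /incident negb_or => /andP [sa ta].
have E (c : through k Q) : (letter (inl c) == letter (inr a)) = false by [].
have E' b : (letter (inr b) == letter (inr a)) = (b == a) by [].
rewrite pderiv_delta big1 // => c _; rewrite !pderivM !pderiv_arr E !E'.
case: eqP => [ca|_]; first by rewrite -ca through_tgt eqxx in ta.
case: eqP => [ca|_]; first by rewrite -ca through_src eqxx in sa.
by rewrite !addr0.
Qed.

Lemma delta_in a : tgt a = k ->
  pderiv (letter (inr a)) Delta 1 = \sum_(b | src b == k) star b * brk a b.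
Proof.
move=> ta; have inca : incident k a by rewrite /incident ta eqxx orbT.
have E (c : through k Q) : (letter (inl c) == letter (inr a)) = false by [].
have E' b : (letter (inr b) == letter (inr a)) = (b == a) by [].
rewrite pderiv_delta (reindex_omap (fun c : through k Q => (val c).2) (fun b => insub (a, b))) => [|b sb]; last first.
  have h : (tgt (a, b).1 == k) && (src (a, b).2 == k) by rewrite /= ta sb eqxx.
  by rewrite insubT.
rewrite [RHS]big_mkcond; apply: eq_bigr => c _.
rewrite !pderivM !pderiv_arr E !E'.
have sc2 : (val c).2 == a = false.
  by apply/eqP => ca; have := llQ a; rewrite ta -ca through_src eqxx.
rewrite sc2 !addr0 through_src eqxx /=; case: eqP => [ca|ca].
  have [y1 _] := star_idem (inc2 c); rewrite through_src in y1.
  rewrite -ca -surjective_pairing valK eqxx brkE mulr1 /= inc1 through_tgt.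
  by rewrite mulrA y1 -mulrA -{2}[arr K (letter (inl c))]arr_idem.
case: eqP => // Ec; case: ca.
by move: Ec; case: insubP => // c' _ Ec' [Ecc]; rewrite -Ecc Ec'.
Qed.

Lemma delta_out b : src b = k ->
  pderiv (letter (inr b)) Delta 1 = \sum_(a | tgt a == k) brk a b * star a.
Proof.
move=> sb; have incb : incident k b by rewrite /incident sb eqxx.
have E (c : through k Q) : (letter (inl c) == letter (inr b)) = false by [].
have E' a : (letter (inr a) == letter (inr b)) = (a == b) by [].
rewrite pderiv_delta (reindex_omap (fun c : through k Q => (val c).1) (fun a => insub (a, b))) => [|a ta]; last first.
  have h : (tgt (a, b).1 == k) && (src (a, b).2 == k) by rewrite /= ta sb eqxx.
  by rewrite insubT.
rewrite [RHS]big_mkcond; apply: eq_bigr => c _.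
rewrite !pderivM !pderiv_arr E !E'.
have sc1 : (val c).1 == b = false.
  by apply/eqP => cb; have := llQ b; rewrite sb -cb through_tgt eqxx.
rewrite sc1 add0r addr0 through_tgt eqxx /=; case: eqP => [cb|cb].
  have [_ y1] := star_idem (inc1 c); rewrite through_tgt in y1.
  rewrite -cb -surjective_pairing valK eqxx brkE mulr1 /= inc2 through_src.
  by rewrite mulrA -mulrA y1 -{2}[arr K (letter (inl c))]idem_arr.
case: eqP => // Ec; case: cb.
by move: Ec; case: insubP => // c' _ Ec' [Ecc]; rewrite -Ecc Ec'.
Qed.

Lemma sum_through_in a (F : arrow Q -> pathalg K Q') : tgt a = k ->
  \sum_(c : through k Q | (val c).1 == a) F (val c).2 = \sum_(b | src b == k) F b.
Proof.
move=> ta.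
rewrite [RHS](reindex_omap (fun c : through k Q => (val c).2) (fun b => insub (a, b))) => [|b sb]; last first.
  have h : (tgt (a, b).1 == k) && (src (a, b).2 == k) by rewrite /= ta sb eqxx.
  by rewrite insubT.
apply: eq_bigl => c; rewrite through_src eqxx /=; apply/eqP/eqP => [<-|].
  by rewrite -surjective_pairing valK.
by case: insubP => // c' _ Ec' [Ecc]; rewrite -Ecc Ec'.
Qed.

Lemma sum_through_out b (F : arrow Q -> pathalg K Q') : src b = k ->
  \sum_(c : through k Q | (val c).2 == b) F (val c).1 = \sum_(a | tgt a == k) F a.
Proof.
move=> sb.
rewrite [RHS](reindex_omap (fun c : through k Q => (val c).1) (fun a => insub (a, b))) => [|a ta]; last first.
  have h : (tgt (a, b).1 == k) && (src (a, b).2 == k) by rewrite /= ta sb eqxx.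
  by rewrite insubT.
apply: eq_bigl => c; rewrite through_tgt eqxx /=; apply/eqP/eqP => [<-|].
  by rewrite -surjective_pairing valK.
by case: insubP => // c' _ Ec' [Ecc]; rewrite -Ecc Ec'.
Qed.

Lemma pderiv_W_chain a : pderiv a W 1 =
  \sum_c pderiv a (arr K (val c).2 * arr K (val c).1) (Theta (D (letter (inl c))))
  + \sum_b pderiv a (if incident k b then 0 else arr K b) (Theta (D (letter (inr b)))).
Proof.
rewrite -pderiv_Theta_premut -(hom1 hT) (pderiv_hom hT) [LHS]big_sumType /=.
by congr (_ + _); apply: eq_bigr => x _; rewrite Theta_arr.
Qed.

Lemma deriv_far a : ~~ incident k a -> pderiv a W 1 = Theta (Pi (D (letter (inr a)))).
Proof.
move=> ca; rewrite pderiv_W_chain big1 ?add0r => [|c _]; last first.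
  rewrite pderivM !pderiv_arr; case: eqP => [E|_]; first by rewrite -E inc2 in ca.
  by case: eqP => [E|_]; rewrite ?addr0 //; rewrite -E inc1 in ca.
rewrite (bigD1 a) //= big1 => [|b ba]; last first.
  by case: ifP => _; rewrite ?pderiv0 // pderiv_arr (negPf ba).
rewrite (negPf ca) pderiv_arr eqxx addr0 Theta_Pi -!(homI hT) -!(homM hT).
have := pderiv_ends (letter (inr a)) W' 1; rewrite /= (negPf ca) -/(D _) => ->.
by [].
Qed.

Lemma D_inl_ends c : idem K Q' (src (val c).1) * D (letter (inl c)) * idem K Q' (tgt (val c).2)
  = D (letter (inl c)).
Proof. exact: (pderiv_ends (letter (inl c)) W' 1). Qed.

(** Up to rotation, each occurrence of [a] in W is followed by an arrow b leaving k and sits in a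
    letter [b a] of the bracketed potential. The chain rule for [Theta] collects these letters. *)
Lemma deriv_in a : tgt a = k -> pderiv a W 1 =
  \sum_(c : through k Q | (val c).1 == a) Theta (Pi (D (letter (inl c)))) * arr K (val c).2.
Proof.
move=> ta; rewrite pderiv_W_chain addrC big1 ?add0r => [|b _]; last first.
  rewrite /incident; case: ifP => cb; rewrite ?pderiv0 // pderiv_arr; case: eqP => // E.
  by rewrite E ta eqxx orbT in cb.
rewrite [RHS]big_mkcond; apply: eq_bigr => c _; rewrite pderivM !pderiv_arr.
have -> : (val c).2 == a = false.
  by apply/eqP => ca; have := llQ a; rewrite ta -ca through_src eqxx.
rewrite add0r; case: eqP => // <-; rewrite Theta_Pi -(homI hT) mulrA.
have E : Theta (idem K Q' (src (val c).1)) * Theta (D (letter (inl c))) = Theta (D (letter (inl c))).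
  by rewrite -(homM hT) -{1}D_inl_ends !mulrA idemK D_inl_ends.
by rewrite E -mulrA -{2}[arr K (val c).2]arr_idem through_tgt through_src.
Qed.

Lemma deriv_out b : src b = k -> pderiv b W 1 =
  \sum_(c : through k Q | (val c).2 == b) arr K (val c).1 * Theta (Pi (D (letter (inl c)))).
Proof.
move=> sb; rewrite pderiv_W_chain addrC big1 ?add0r => [|a _]; last first.
  rewrite /incident; case: ifP => ca; rewrite ?pderiv0 // pderiv_arr; case: eqP => // E.
  by rewrite E sb eqxx in ca.
rewrite [RHS]big_mkcond; apply: eq_bigr => c _; rewrite pderivM !pderiv_arr.
have -> : (val c).1 == b = false.
  by apply/eqP => cb; have := llQ b; rewrite sb -cb through_tgt eqxx.
rewrite addr0; case: eqP => // <-; rewrite Theta_Pi -[idem K Q (tgt _)](homI hT).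
have E : Theta (D (letter (inl c))) * Theta (idem K Q' (tgt (val c).2)) = Theta (D (letter (inl c))).
  by rewrite -(homM hT) -{1}D_inl_ends -!mulrA idemK !mulrA D_inl_ends.
by rewrite -!mulrA E mulrA -{2}[arr K (val c).1]idem_arr through_src through_tgt.
Qed.

Let tsJ := jacobi_two_sided W'.

Lemma Pi_D_inl c : Pi (D (letter (inl c))) = D (letter (inl c)) - star (val c).1 * star (val c).2.
Proof.
by rewrite [in RHS](@D_clean (letter (inl c)) isT) delta_inl addrK.
Qed.

(** The sum is a clean lift of [cyc_deriv a W] times a'. Modulo the ideal, the derivative of the
    bracketed potential along [b a] is minus a* b*, and the sum of the a* b* [b a'] is a* times the
    derivative of [W'] along the reversed arrow of a'. *)
Lemma jacobi_in a a' : tgt a = k -> tgt a' = k -> jacobi_ideal W'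
  (\sum_(c : through k Q | (val c).1 == a) Pi (D (letter (inl c))) * brk a' (val c).2).
Proof.
move=> ta ta'.
have -> : \sum_(c : through k Q | (val c).1 == a) Pi (D (letter (inl c))) * brk a' (val c).2
    = \sum_(c : through k Q | (val c).1 == a) D (letter (inl c)) * brk a' (val c).2
      - star a * D (letter (inr a')).
  rewrite D_star ?delta_in // /incident ?ta' ?eqxx ?orbT //.
  rewrite -(sum_through_in (fun b => star b * brk a' b) ta) mulr_sumr -sumrB.
  by apply: eq_bigr => c /eqP ca; rewrite Pi_D_inl mulrBl ca mulrA.
apply: (tsB tsJ); last by apply: (tsMl tsJ); apply: jacobi_D.
by apply: (ts_sum tsJ) => c _; apply: (tsMr tsJ); apply: jacobi_D.
Qed.

Lemma jacobi_out b b' : src b = k -> src b' = k -> jacobi_ideal W'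
  (\sum_(c : through k Q | (val c).2 == b) brk (val c).1 b' * Pi (D (letter (inl c)))).
Proof.
move=> sb sb'.
have -> : \sum_(c : through k Q | (val c).2 == b) brk (val c).1 b' * Pi (D (letter (inl c)))
    = \sum_(c : through k Q | (val c).2 == b) brk (val c).1 b' * D (letter (inl c))
      - D (letter (inr b')) * star b.
  rewrite D_star ?delta_out // /incident ?sb' ?eqxx //.
  rewrite -(sum_through_out (fun a => brk a b' * star a) sb) mulr_suml -sumrB.
  by apply: eq_bigr => c /eqP cb; rewrite Pi_D_inl mulrBr cb mulrA.
apply: (tsB tsJ); last by apply: (tsMr tsJ); apply: jacobi_D.
by apply: (ts_sum tsJ) => c _; apply: (tsMl tsJ); apply: jacobi_D.
Qed.

Lemma corner_lift v w x : v != k -> w != k ->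
  exists2 y, Pi y = y & Theta y = idem K Q v * x * idem K Q w.
Proof.
move=> vk wk; elim/pathalg_ind: x => [|v0 s|c x x' [y Py Ty] [y' Py' Ty']].
- by exists 0; rewrite ?(hom0 hP) // (hom0 hT) mulr0 mul0r.
- rewrite idem_mk; case: eqP => [<-|_]; last first.
    by exists 0; rewrite ?(hom0 hP) // (hom0 hT) mul0r.
  rewrite mk_idem; case: eqP => [sw|_]; last by exists 0; rewrite ?(hom0 hP) // (hom0 hT).
  have [vs|vs] := boolP (is_word v s); last first.
    by rewrite mkpath_eq0 //; exists 0; rewrite ?(hom0 hP) // (hom0 hT).
  have [|Ts Ps] := bracket_word_img vk _ vs; first by rewrite sw.
  by exists (mkpath K v (bracket_word k s)).
- exists (c *: y + y'); first by rewrite (homP hP) Py Py'.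
  by rewrite (homP hT) Ty Ty' mulrDr mulrDl scaleAr scaleAl.
Qed.

Lemma split_in w x : w != k -> exists h : arrow Q -> pathalg K Q,
  idem K Q k * x * idem K Q w = \sum_(a | tgt a == k) arr K a * (idem K Q (src a) * h a * idem K Q w).
Proof.
move=> wk; elim/pathalg_ind: x => [|v0 s|c x x' [h E] [h' E']].
- exists (fun _ => 0); rewrite mulr0 mul0r big1 // => a _.
  by rewrite mulr0 mul0r mulr0.
- suff [h E] : exists h : arrow Q -> pathalg K Q, idem K Q k * mkpath K v0 s * idem K Q w
      = \sum_(a | tgt a == k) arr K a * h a.
    exists h; rewrite -{1}[idem K Q w]idemK mulrA E mulr_suml; apply: eq_bigr => a _.
    by rewrite -{1}[arr K a]arr_idem !mulrA.
  rewrite idem_mk; case: eqP => [<-|_]; last first.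
    by exists (fun _ => 0); rewrite mul0r big1 // => a _; rewrite mulr0.
  rewrite mk_idem; case: eqP => [sw|_]; last first.
    by exists (fun _ => 0); rewrite big1 // => a _; rewrite mulr0.
  have [vs|vs] := boolP (is_word k s); last first.
    by exists (fun _ => 0); rewrite (mkpath_eq0 _ vs) big1 // => a _; rewrite mulr0.
  case: s sw vs => [/= E|a s _ vs]; first by rewrite -E /wsrc /= eqxx in wk.
  have [ak bs] : tgt a = k /\ is_word (src a) s by case/andP: vs => /eqP.
  exists (fun b => if b == a then mkpath K (src a) s else 0).
  rewrite (mk_cons _ vs) (bigD1 a) ?ak //= eqxx big1 ?addr0 // => b /andP [_ /negPf ->].
  by rewrite mulr0.
- exists (fun a => c *: h a + h' a); rewrite mulrDr mulrDl scaleAr scaleAl E E'.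
  rewrite scaler_sumr -big_split; apply: eq_bigr => a _.
  by rewrite /= mulrDr mulrDl mulrDr !(scaleAr, scaleAl).
Qed.

Lemma split_out v x : v != k -> exists h : arrow Q -> pathalg K Q,
  idem K Q v * x * idem K Q k = \sum_(b | src b == k) idem K Q v * h b * idem K Q (tgt b) * arr K b.
Proof.
move=> vk; elim/pathalg_ind: x => [|v0 s|c x x' [h E] [h' E']].
- exists (fun _ => 0); rewrite mulr0 mul0r big1 // => a _.
  by rewrite !(mulr0, mul0r).
- suff [h E] : exists h : arrow Q -> pathalg K Q, idem K Q v * mkpath K v0 s * idem K Q k
      = \sum_(b | src b == k) h b * arr K b.
    exists h.
    have -> : idem K Q v * mkpath K v0 s * idem K Q k
        = idem K Q v * (idem K Q v * mkpath K v0 s * idem K Q k) by rewrite !mulrA idemK.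
    rewrite E mulr_sumr.
    by apply: eq_bigr => b _; rewrite -!mulrA idem_arr.
  rewrite idem_mk; case: eqP => [<-|_]; last first.
    by exists (fun _ => 0); rewrite mul0r big1 // => a _; rewrite mul0r.
  rewrite mk_idem; case: eqP => [sk|_]; last first.
    by exists (fun _ => 0); rewrite big1 // => a _; rewrite mul0r.
  have [vs|vs] := boolP (is_word v s); last first.
    by exists (fun _ => 0); rewrite (mkpath_eq0 _ vs) big1 // => a _; rewrite mul0r.
  case/lastP: s sk vs => [/= E _|s b]; first by rewrite -E /wsrc /= eqxx in vk.
  rewrite /wsrc map_rcons last_rcons -cats1 is_word_cat => bk /and3P [vs /eqP bt _].
  exists (fun b' => if b' == b then mkpath K v s else 0).
  rewrite (bigD1 b) ?bk //= eqxx big1 ?addr0 => [|b' /andP [_ /negPf ->]]; last by rewrite mul0r.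
  by rewrite /arr bt mk_mul.
- exists (fun a => c *: h a + h' a); rewrite mulrDr mulrDl scaleAr scaleAl E E'.
  rewrite scaler_sumr -big_split; apply: eq_bigr => a _.
  by rewrite /= mulrDr !mulrDl !(scaleAr, scaleAl).
Qed.

(** A derivative along an arrow at k starts or ends at k and need not lift by itself. Since v and w
    differ from k, it is preceded by an arrow into k or followed by an arrow out of k, and the
    product with that arrow lifts by [jacobi_in] or [jacobi_out]. *)
Lemma corner_jacobi v w p a q : v != k -> w != k ->
  exists g, [/\ jacobi_ideal W' g, Pi g = g
    & Theta g = idem K Q v * (p * cyc_deriv a W * q) * idem K Q w].
Proof.
move=> vk wk; rewrite cyc_derivE //.
have split4 (X Y Z : pathalg K Q) : idem K Q v * (p * (X * Y * Z) * q) * idem K Q w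
  = (idem K Q v * p * X) * Y * (Z * q * idem K Q w) by rewrite !mulrA.
rewrite -[pderiv a W 1]pderiv_ends split4.
have [ca|ca] := boolP (incident k a); last first.
  have /andP [sk tk] : (src a != k) && (tgt a != k) by rewrite -negb_or.
  have [y Py Ty] := corner_lift p vk sk; have [z Pz Tz] := corner_lift q tk wk.
  exists (y * Pi (D (letter (inr a))) * z); split.
  - apply: (tsMr tsJ); apply: (tsMl tsJ).
    have := D_clean (b := letter (inr a)) ca; rewrite delta_inr // addr0 => <-.
    exact: jacobi_D.
  - by rewrite !(homM hP) Py Pz Pi_idem.
  - by rewrite !(homM hT) Ty Tz deriv_far.
have [ta|ta] := eqVneq (tgt a) k.
  have sk : src a != k by rewrite -ta llQ.
  have [y Py Ty] := corner_lift p vk sk.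
  have [h Eh] := split_in q wk.
  rewrite ta Eh (deriv_in ta).
  suff G : forall a', tgt a' = k -> exists g, [/\ jacobi_ideal W' g, Pi g = g
    & Theta g = idem K Q v * p * idem K Q (src a) *
     (\sum_(c : through k Q | (val c).1 == a) Theta (Pi (D (letter (inl c)))) * arr K (val c).2) *
     (arr K a' * (idem K Q (src a') * h a' * idem K Q w))].
    rewrite [X in exists g, [/\ _, _ & _ = X]]mulr_sumr.
    elim/big_rec: _ => [|a' x /eqP ta' [g [Jg Pg Tg]]].
      by exists 0; split; rewrite ?(hom0 hP) ?(hom0 hT) //; apply: (ts0 tsJ).
    have [g' [Jg' Pg' Tg']] := G a' ta'.
    exists (g' + g); rewrite (homD hP) (homD hT) Pg Pg' Tg Tg'; split=> //.
    exact: (tsD tsJ).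
  move=> a' ta'; have sk' : src a' != k by rewrite -ta' llQ.
  have [z Pz Tz] := corner_lift (h a') sk' wk.
  exists (y * (\sum_(c : through k Q | (val c).1 == a) Pi (D (letter (inl c))) * brk a' (val c).2) * z).
  split.
  - by apply: (tsMr tsJ); apply: (tsMl tsJ); apply: jacobi_in.
  - rewrite !(homM hP) Py Pz (hom_sum hP); congr (_ * _ * _); apply: eq_bigr => c _.
    by rewrite (homM hP) Pi_idem Pi_brk.
  - rewrite !(homM hT) Ty Tz (hom_sum hT) !mulrA; congr (_ * _ * _ * _).
    rewrite -!mulrA mulr_suml; congr (_ * (_ * (_ * _))); apply: eq_bigr => c _.
    by rewrite (homM hT) Theta_brk ?through_src // mulrA.
have sa : src a = k by apply/eqP; move: ca; rewrite /incident (negPf ta) orbF.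
have [z Pz Tz] := corner_lift q ta wk.
have [h Eh] := split_out p vk.
rewrite sa Eh (deriv_out sa).
suff G : forall b', src b' = k -> exists g, [/\ jacobi_ideal W' g, Pi g = g
  & Theta g = idem K Q v * h b' * idem K Q (tgt b') * arr K b' *
   (\sum_(c : through k Q | (val c).2 == a) arr K (val c).1 * Theta (Pi (D (letter (inl c))))) *
   (idem K Q (tgt a) * q * idem K Q w)].
  rewrite [X in exists g, [/\ _, _ & _ = X * _]]mulr_suml.
  rewrite [X in exists g, [/\ _, _ & _ = X]]mulr_suml.
  elim/big_rec: _ => [|b' x /eqP sb' [g [Jg Pg Tg]]].
    by exists 0; split; rewrite ?(hom0 hP) ?(hom0 hT) //; apply: (ts0 tsJ).
  have [g' [Jg' Pg' Tg']] := G b' sb'.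
  exists (g' + g); rewrite (homD hP) (homD hT) Pg Pg' Tg Tg'; split=> //.
  exact: (tsD tsJ).
move=> b' sb'; have tk' : tgt b' != k by rewrite -sb' eq_sym llQ.
have [y Py Ty] := corner_lift (h b') vk tk'.
exists (y * (\sum_(c : through k Q | (val c).2 == a) brk (val c).1 b' * Pi (D (letter (inl c)))) * z).
split.
- by apply: (tsMr tsJ); apply: (tsMl tsJ); apply: jacobi_out.
- rewrite !(homM hP) Py Pz (hom_sum hP); congr (_ * _ * _); apply: eq_bigr => c _.
  by rewrite (homM hP) Pi_idem Pi_brk.
- rewrite !(homM hT) Ty Tz (hom_sum hT); congr (_ * _).
  rewrite -!mulrA; congr (_ * (_ * (_ * _))); rewrite mulr_sumr; apply: eq_bigr => c _.
  by rewrite (homM hT) Theta_brk ?through_tgt // mulrA.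
Qed.

(** All arrows of the premutated quiver at k are reversed ones, so between other vertices they occur
    in consecutive pairs a* b*. Modulo the derivative [Dc] along [b a], such a pair is the clean
    element [- Pi Dc]. *)
Lemma corner_clean v w x : v != k -> w != k -> exists2 y, Pi y = y &
  jacobi_ideal W' (idem K Q' v * x * idem K Q' w - y).
Proof.
move=> vk wk; elim/pathalg_ind: x => [|v0 s|c x x' [y Py Jy] [y' Py' Jy']]; first last.
- exists (c *: y + y'); first by rewrite (homP hP) Py Py'.
  have -> : idem K Q' v * (c *: x + x') * idem K Q' w - (c *: y + y')
      = c *: (idem K Q' v * x * idem K Q' w - y) + (idem K Q' v * x' * idem K Q' w - y').
    by rewrite mulrDr mulrDl scaleAr scaleAl scalerBr opprD addrACA.
  by apply: (tsD tsJ) => //; apply: (tsZ tsJ).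
- have triv : exists2 y, Pi y = y & jacobi_ideal W' (0 - y).
    by exists 0; rewrite ?subr0 ?(hom0 hP) //; apply: (ts0 tsJ).
  rewrite idem_mk; case: eqP => [<-|_]; last by rewrite mul0r.
  rewrite mk_idem; case: eqP => [sw|_]; last by [].
  have [vs|vs] := boolP (is_word v s); last by rewrite mkpath_eq0.
  have [m] := ubnP (size s).
  elim: m s v vk vs sw => // m IH [|b s] v vk vs sw sm.
    exists (idem K Q' v); first by rewrite (homI hP).
    by rewrite subrr; apply: (ts0 tsJ).
  have [bv bs] : tgt b = v /\ is_word (src b) s by case/andP: vs => /eqP.
  have sw' : wsrc (src b) s = w by [].
  have [cb|cb] := boolP (clean b).
    have sbk : src b != k.
      case: b cb {vs sw bv bs sw' sm} => [c _|a ca] /=; first by have := llQ (val c).1; rewrite through_tgt.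
      by move: ca; rewrite /= => ca; rewrite (negPf ca); case/norP: ca.
    have [y Py Jy] := IH s _ sbk bs sw' sm.
    exists (arr K b * y); first by rewrite (homM hP) Py Pi_arr /thP cb.
    by rewrite (mk_cons _ vs) -mulrBr; apply: (tsMl tsJ).
  case: b cb vs bs bv sw sw' sm => // a /negPn ca vs bs bv sw sw' sm.
  rewrite /= ca in bv.
  have ta : tgt a = k by move: ca; rewrite /incident bv (negPf vk) /= => /eqP.
  have sk : src (inr a : arrow Q') = k by rewrite /= ca.
  case: s sm vs bs sw sw' => [|b2 s] sm vs bs sw sw'.
    by rewrite -sw' /wsrc /= ca ta eqxx in wk.
  have [b2v b2s] : tgt b2 = k /\ is_word (src b2) s.
    by case/andP: bs => /eqP E ?; rewrite -sk.
  case: b2 b2v b2s sw sw' vs bs sm => [c|a2] b2v b2s sw sw' vs bs sm.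
    by have := llQ (val c).2; rewrite [tgt _]b2v through_src eqxx.
  have ca2 : incident k a2.
    by apply: contraT => ca2; move: b2v; rewrite /= (negPf ca2) => E; rewrite /incident E eqxx orbT in ca2.
  have sa2 : src a2 = k by rewrite /= ca2 in b2v.
  have ta2 : tgt a2 != k by rewrite -sa2 eq_sym llQ.
  have h : (tgt (a, a2).1 == k) && (src (a, a2).2 == k) by rewrite /= ta sa2 eqxx.
  have [||y Py Jy] := IH s (tgt a2) ta2 _ _ (ltnW sm).
  - by move: b2s; rewrite /= ca2.
  - by move: sw'; rewrite /wsrc /= ca2.
  have Ec := Pi_D_inl (Sub (a, a2) h); move: Ec; set Dc := D _.
  move=> /= Ec; exists (- (Pi Dc * y)).
    by rewrite (homN hP) (homM hP) Py Pi_idem.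
  have -> : mkpath K v (letter (inr a) :: letter (inr a2) :: s) = star a * star a2 * mkpath K (tgt a2) s :> pathalg K Q'.
    rewrite (mk_cons _ vs) (mk_cons _ bs) mulrA; congr (_ * mkpath _ _ _).
    by rewrite /= ca2.
  have -> : star a * star a2 = Dc - Pi Dc by rewrite Ec opprB addrC subrK.
  set M := mkpath K _ s.
  have -> : (Dc - Pi Dc) * M - - (Pi Dc * y) = Dc * M - Pi Dc * (M - y).
    by rewrite mulrBl mulrBr opprK opprD opprK addrA.
  apply: (tsB tsJ); last by apply: (tsMl tsJ).
  by apply: (tsMr tsJ); apply: jacobi_D.
- by exists 0; rewrite ?(hom0 hP) // mulr0 mul0r subr0; apply: (ts0 tsJ).
Qed.

(** A clean representative is tested in the old corner through [Theta]. The relation found there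
    lifts to a clean relation, and injectivity of [Theta] on clean elements identifies the lift with
    [z]. *)
Lemma corner_premut (F : pred V) : ~~ F k -> corner F (QP W) ->
  corner F (premut_qp k (QP W)).
Proof.
move=> Fk cF v w x Fv Fw.
have vk : v != k by apply: contraNneq Fk => <-.
have wk : w != k by apply: contraNneq Fk => <-.
have [y Py Jy] := corner_clean x vk wk.
have [c [r Er]] := cF v w (Theta y) Fv Fw; exists c; rewrite /= in Er.
pose z := idem K Q' v * y * idem K Q' w - c *: (idem K Q' v * idem K Q' w).
have Tz : Theta z = idem K Q v * (\sum_(t <- r) t.1.1 * cyc_deriv t.1.2 W * t.2) * idem K Q w.
  rewrite -Er /z (homB hT) (homZ hT) !(homM hT) !(homI hT).
  by rewrite mulrBr mulrBl scaleAr scaleAl !mulrA !idemK -!mulrA !idemK.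
have Pz : Pi z = z by rewrite /z (homB hP) (homZ hP) !(homM hP) !(homI hP) Py.
have [g [Jg Pg Tg]] : exists g, [/\ jacobi_ideal W' g, Pi g = g & Theta g = Theta z].
  rewrite Tz mulr_sumr mulr_suml; elim/big_rec: _ => [|t x' _ [g [Jg Pg Tg]]].
    by exists 0; split; rewrite ?(hom0 hP) ?(hom0 hT) //; apply: (ts0 tsJ).
  have [g' [Jg' Pg' Tg']] := corner_jacobi t.1.1 t.1.2 t.2 vk wk.
  exists (g' + g); rewrite (homD hP) (homD hT) Pg Pg' Tg Tg'; split=> //.
  exact: (tsD tsJ).
have zg : z = g.
  apply/eqP; rewrite -subr_eq0; apply/eqP; apply: Theta_inj.
    by rewrite (homB hP) Pz Pg.
  by rewrite (homB hT) Tg subrr.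
have -> : idem K _ v * x * idem K _ w - c *: (idem K Q' v * idem K Q' w) =
    idem K Q' v * (idem K Q' v * x * idem K Q' w - y) * idem K Q' w + z.
  rewrite /z mulrBr mulrBl !mulrA !idemK -!mulrA !idemK !mulrA addrA.
  by rewrite subrK.
apply: (tsD tsJ); last by rewrite zg.
by apply: (tsMr tsJ); apply: (tsMl tsJ).
Qed.
End Premutation.

(** * Sign coherence from the frozen corner *)

Section FrozenPaths.
Variables (K : fieldType) (V : finType).

Lemma pcoef_jacobi (P : qp K V) (p : qpath (qp_quiver P)) x :
  finite_qp P -> reduced_qp P -> (size (pword p) <= 2)%N ->
  (forall a : arrow (qp_quiver P), size (pword p) = 2%N -> src a = ptgt p -> tgt a = psrc p -> False) ->
  jacobi_ideal (qp_pot P) x -> pcoef p x = 0.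
Proof.
case: P p x => Q W /= p x; rewrite /finite_qp /reduced_qp /= => fP rP sp noa [r ->].
rewrite pcoef_sum big1 // => -[[y a] z] _ /=.
rewrite /cyc_deriv linextE big_seq mulr_sumr mulr_suml pcoef_sum big1 // => -[[u l] ul] lW.
have /andP [l0 /eqP lu] := fP _ lW; have l3 := rP _ lW.
rewrite /pword /psrc /ptgt /= in l3 lu *.
rewrite scaleAr scaleAl pcoefZ mulr_sumr mulr_suml pcoef_sum big1 ?mulr0 // => i /eqP ia.
have arith m n : (2 < m -> n < m -> 1 < m - n.+1 + n)%N by lia.
have arith' m n o : (1 < n -> m + n + o <= 2 -> [/\ m = 0, n = 2 & o = 0])%N.
  by move=> *; split; lia.
have [_ wa] := is_word_deriv ul lu ia.
have sr : (2 <= size (drop i.+1 l ++ take i l))%N.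
  have := ltn_ord i; rewrite size_cat size_drop size_takel ?(ltnW (ltn_ord i)) //.
  by move=> il; exact: (arith _ _ l3 il).
move: (drop _ _ ++ _) wa sr => t wt st.
elim/pathalg_ind: y => [|v s|c y y' IH IH']; first by rewrite !mul0r pcoef0.
  elim/pathalg_ind: z => [|w s'|c z z' IH IH']; first by rewrite mulr0 pcoef0.
    have [sv|sv] := eqVneq (wsrc v s) (src a); last by rewrite mk_mul0 // mul0r pcoef0.
    have [tw|tw] := eqVneq (tgt a) w; last first.
      by rewrite mk_mul // mk_mul0 ?pcoef0 // wsrc_cat sv wt.
    rewrite !mk_mul ?wsrc_cat ?sv ?wt // pcoef_mk; case: eqP => // E.
    move: sp noa; rewrite /psrc /ptgt /pword -E /= !size_cat => sp noa.
    have [s0 t2 s'0] := arith' _ _ _ st sp.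
    case: (noa a); first by rewrite s0 t2 s'0.
      by rewrite -sv; case: s s0 {sv E sp noa}.
    by rewrite !wsrc_cat sv wt tw; case: s' s'0 {E sp noa}.
  by rewrite mulrDr scaleAr pcoefD pcoefZ IH IH' mulr0 addr0.
by rewrite !mulrDl !scaleAl pcoefD pcoefZ IH IH' mulr0 addr0.
Qed.

Lemma corner_coef (F : pred V) (P : qp K V) (p : qpath (qp_quiver P)) :
  corner F P -> finite_qp P -> reduced_qp P -> F (ptgt p) -> F (psrc p) ->
  (0 < size (pword p) <= 2)%N ->
  exists2 a : arrow (qp_quiver P), size (pword p) = 2%N & src a = ptgt p /\ tgt a = psrc p.
Proof.
move=> cP fP rP Ft Fs /andP [p0 p2].
have [a /and3P [/eqP sp /eqP sa /eqP ta]|noa] :=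
    pickP [pred a : arrow (qp_quiver P) | [&& size (pword p) == 2%N, src a == ptgt p & tgt a == psrc p]].
  by exists a.
have [c Jc] := cP _ _ (pbasis K p) Ft Fs.
have := pcoef_jacobi fP rP p2 _ Jc.
rewrite basisE idem_mk eqxx mk_idem eqxx idem_mulM -scaleN1r pcoefD !pcoefZ !pcoef_mk.
move=> /(_ _) E; have {E} : (((ptgt p, pword p) == val p)%:R : K) = 0.
  rewrite -[RHS]E; last first.
    move=> a sp sa ta; have := noa a; by rewrite /= sp sa ta !eqxx.
  suff -> : (ptgt p, [::]) == val p = false by rewrite !mulr0 addr0.
  by apply/eqP => E'; move: p0; rewrite /pword -E'.
by rewrite -surjective_pairing eqxx => /eqP; rewrite oner_eq0.
Qed.

Lemma corner_no_path (F : pred V) (P : qp K V) (a b : arrow (qp_quiver P)) :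
  corner F P -> finite_qp P -> reduced_qp P ->
  F (src a) -> tgt a = src b -> F (tgt b) -> False.
Proof.
move=> cP fP rP Fa ab Fb.
have w2 : is_word (tgt b) [:: b; a] by rewrite /= ab !eqxx.
have [//|//|//|c _ [sc tc]] := @corner_coef F P (exist _ (tgt b, [:: b; a]) w2) cP fP rP.
have w1 : is_word (tgt c) [:: c] by rewrite /= eqxx.
(* The arrow [c] opposite to the path joins two frozen vertices itself; applied to it as a path of
   length 1, [corner_coef] claims that its length is 2. *)
have [|||d //] := @corner_coef F P (exist _ (tgt c, [:: c]) w1) cP fP rP.
- by change (F (tgt c)); rewrite tc.
- by change (F (src c)); rewrite sc.
- by [].
Qed.
End FrozenPaths.

Definition frozen n : pred ('I_n + 'I_n)%type := fun v => if v is inr _ then true else false.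

Lemma corner_framed (K : fieldType) n (Q : quiver 'I_n) (W : pathalg K Q) :
  corner (@frozen n) (framed_qp W).
Proof.
move=> [//|i] [//|j] x _ _; elim/pathalg_ind: x => [|v s|c x x' [d Jd] [d' Jd']].
- by exists 0; rewrite mulr0 mul0r scale0r subr0; apply: (ts0 (jacobi_two_sided _)).
- have triv : exists c : K, jacobi_ideal (qp_pot (framed_qp W))
      (0 - c *: (idem K (framed Q) (inr i) * idem K (framed Q) (inr j))).
    by exists 0; rewrite scale0r subr0; apply: (ts0 (jacobi_two_sided _)).
  rewrite idem_mk; case: eqP => [<-|_]; last by rewrite mul0r.
  rewrite mk_idem; case: eqP => [sj|_]; last exact: triv.
  case: s sj => [E|a s _]; last by rewrite mkpath_eq0 //; case: a.
  exists 1; rewrite scale1r -E idem_mulM eqxx scale1r subrr.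
  exact: (ts0 (jacobi_two_sided _)).
- exists (c * d + d').
  set e := idem _ _ _ in Jd Jd' *; set e' := idem _ _ (inr j) in Jd Jd' *.
  have -> : e * (c *: x + x') * e' - (c * d + d') *: (e * e')
      = c *: (e * x * e' - d *: (e * e')) + (e * x' * e' - d' *: (e * e')).
    rewrite mulrDr mulrDl scaleAr scaleAl scalerBr scalerA scalerDl opprD.
    by rewrite addrACA.
  by apply: (tsD (jacobi_two_sided _)) => //; apply: (tsZ (jacobi_two_sided _)).
Qed.

(** * Arrow numbers under mutation *)

Section QuiverMutation.
Variable V : finType.
Implicit Types Q : quiver V.

(** Seeds depend on the quiver only through its arrow numbers. The truncated subtraction is the
    cancellation of 2-cycles. *)
Definition mutn (k : V) (q : V -> V -> nat) (i j : V) : nat :=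
  if (i == k) || (j == k) then q j i
  else (q i j + q i k * q k j - (q j i + q j k * q k i))%N.

(** For i = j this excludes loops, otherwise 2-cycles. *)
Definition antisym (q : V -> V -> nat) : Prop := forall i j, (q i j * q j i = 0)%N.

Let arrows Q (i j : V) : {set arrow Q} := [set a | (src a == i) && (tgt a == j)].

Lemma narrows_iso Q Q' i j : quiver_iso Q Q' -> narrows Q i j = narrows Q' i j.
Proof.
move=> [f bf fE]; have fi := bij_inj bf; rewrite /narrows -(card_imset _ fi).
apply: eq_card => b; have [g fK gK] := bf; rewrite -[b]gK mem_imset // !inE.
by have [-> ->] := fE (g b).
Qed.

(** Each cancelled 2-cycle takes one arrow in either direction, and by maximality the remaining
    arrows between i and j all point the same way. So the count does not depend on the chosen
    collection. *)
Lemma narrows_cancel Q i j : i != j ->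
  narrows (cancel_two_cycles Q) i j = (narrows Q i j - narrows Q j i)%N.
Proof.
rewrite /cancel_two_cycles /max_two_cycles; case: ex_maxset => C /= mC ij.
have /andP [/forall_inP C2 tC] := maxsetp mC.
have narrowsE u v : narrows (Quiver (fun a : {a | a \notin cover C} => src (val a))
    (fun a => tgt (val a))) u v = #|arrows Q u v :\: cover C|.
  rewrite /narrows -(card_imset _ val_inj); apply: eq_card => a.
  apply/imsetP/idP => [[b]|]; first by rewrite !inE => h ->; rewrite (valP b).
  by rewrite !inE => /andP [aC h]; exists (Sub a aC); rewrite ?inE.
have cardC : #|arrows Q i j :&: cover C| = #|arrows Q j i :&: cover C|.
  have E u v : #|arrows Q u v :&: cover C| =
      (\sum_(c in C) \sum_(a in c) (a \in arrows Q u v))%N.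
    rewrite -big_trivIset //= -sum1_card big_mkcond [RHS]big_mkcond.
    by apply: eq_bigr => a _; rewrite in_setI; do 2!case: (a \in _).
  rewrite !E; apply: eq_bigr => c /C2 /existsP [a /existsP [b]].
  move=> /and4P [sa /eqP sb /eqP tb /eqP ->].
  have ab : a != b by apply: contraNneq sa => E'; rewrite -sb E'.
  rewrite !big_setU1 ?inE // !big_set1 !inE sb tb /= addnC.
  by rewrite [(src a == j) && _]andbC [(tgt a == j) && _]andbC.
have maxC a b : a \in arrows Q i j :\: cover C -> b \in arrows Q j i :\: cover C -> False.
  rewrite !inE => /andP [aC /andP [/eqP sa /eqP ta]] /andP [bC /andP [/eqP sb /eqP tb]].
  have /maxsetP [_ maxC] := mC.
  have : [set a; b] |: C = C.
    apply: maxC; last exact: subsetUr.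
    apply/andP; split.
      apply/forall_inP => c; rewrite !inE => /orP [/eqP ->|/C2 //].
      apply/existsP; exists a; apply/existsP; exists b.
      by rewrite sa ta sb tb ij !eqxx.
    apply/trivIsetP => c d; rewrite !inE.
    have disj e : e \in C -> [disjoint [set a; b] & e].
      move=> eC; rewrite -setI_eq0; apply/eqP/setP => x; rewrite !inE.
      apply/negP => /andP [/orP [] /eqP -> xe].
        by case/negP: aC; apply/bigcupP; exists e.
      by case/negP: bC; apply/bigcupP; exists e.
    move=> /orP [/eqP ->|cC] /orP [/eqP ->|dC] cd.
    - by rewrite eqxx in cd.
    - exact: disj.
    - by rewrite disjoint_sym; apply: disj.
    - by have /trivIsetP := tC; apply.
  move=> E; case/negP: aC; apply/bigcupP; exists [set a; b]; rewrite ?inE ?eqxx //.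
  by rewrite -E !inE eqxx.
have D u v : narrows Q u v = (#|arrows Q u v :&: cover C| + #|arrows Q u v :\: cover C|)%N.
  by rewrite cardsID.
rewrite narrowsE !D cardC.
have [->|[a aR]] := set_0Vmem (arrows Q i j :\: cover C).
  by rewrite cards0 addn0; lia.
have [->|[b bR]] := set_0Vmem (arrows Q j i :\: cover C).
  by rewrite cards0; lia.
by case: (maxC a b aR bR).
Qed.

Lemma narrows_cancel_le Q i j : (narrows (cancel_two_cycles Q) i j <= narrows Q i j)%N.
Proof.
rewrite /narrows -(card_imset _ val_inj); apply: subset_leq_card.
by apply/subsetP => a /imsetP [b]; rewrite !inE => h ->.
Qed.

Lemma narrows_loopless Q : (forall i, narrows Q i i = 0%N) -> loopless Q.
Proof.
move=> q0 a; apply/negP => /eqP sa; have := q0 (tgt a).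
suff : (0 < narrows Q (tgt a) (tgt a))%N by lia.
by apply/card_gt0P; exists a; rewrite inE sa eqxx.
Qed.

Lemma antisym_diag (q : V -> V -> nat) j : antisym q -> q j j = 0%N.
Proof. by move=> aq; have := aq j j; lia. Qed.

Lemma narrows_premut k Q i j : loopless Q -> narrows (premut_quiver k Q) i j =
  if (i == k) || (j == k) then narrows Q j i
  else (narrows Q i j + narrows Q i k * narrows Q k j)%N.
Proof.
move=> ll; have -> : narrows (premut_quiver k Q) i j =
    (#|[set c : through k Q | (src (val c).1 == i) && (tgt (val c).2 == j)]|
     + #|[set a : arrow Q | ((if incident k a then tgt a else src a) == i)
           && ((if incident k a then src a else tgt a) == j)]|)%N.
  rewrite /narrows -!sum1dep_card big_mkcond [LHS]big_sumType /=.
  by congr (_ + _)%N; rewrite [RHS]big_mkcond.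
have -> : #|[set c : through k Q | (src (val c).1 == i) && (tgt (val c).2 == j)]|
    = (narrows Q i k * narrows Q k j)%N.
  rewrite -(card_imset _ val_inj) /narrows -cardsX; apply: eq_card => -[a b].
  apply/imsetP/idP => [[c]|].
    rewrite !inE => /andP [/eqP h1 /eqP h2] ->; rewrite h1 h2 !eqxx.
    by have /andP [-> ->] := valP c.
  rewrite !inE /= => /andP [/andP [si ta] /andP [sb tj]].
  have h : (tgt (a, b).1 == k) && (src (a, b).2 == k) by rewrite /= ta sb.
  by exists (Sub (a, b) h); rewrite // inE /= si tj.
have loop0 u : narrows Q u u = 0%N.
  apply: eq_card0 => a; rewrite inE; apply/negP => /andP [/eqP s1 /eqP t1].
  by have := ll a; rewrite s1 t1 eqxx.
case: ifP => [ijk|/norP [ik jk]].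
  have -> : (narrows Q i k * narrows Q k j = 0)%N.
    by case/orP: ijk => /eqP ->; rewrite loop0 ?muln0.
  rewrite add0n; apply: eq_card => a; rewrite !inE /incident.
  have [sk|sk] := eqVneq (src a) k; have [tk|tk] := eqVneq (tgt a) k => /=; rewrite 1?andbC //.
  apply/idP/idP => /andP [/eqP h1 /eqP h2]; move: sk tk; rewrite h1 h2;
    by case/orP: ijk => /eqP ->; rewrite eqxx.
rewrite addnC; congr (_ + _)%N; apply: eq_card => a; rewrite !inE /incident.
have [sk|sk] := eqVneq (src a) k; have [tk|tk] := eqVneq (tgt a) k => //=;
  rewrite ?sk ?tk ?[k == i]eq_sym ?[k == j]eq_sym ?(negPf ik) ?(negPf jk) ?andbF //.
Qed.

Lemma narrows_mut k Q i j : antisym (narrows Q) ->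
  narrows (mut_quiver k Q) i j = mutn k (narrows Q) i j.
Proof.
move=> aQ; have q0 u : narrows Q u u = 0%N by exact: antisym_diag.
have ll := narrows_loopless q0.
rewrite /mut_quiver /mutn; have [->|ij] := eqVneq i j.
  (* The diagonal needs its own argument, because cancellation never touches loops; premutation
     creates none, since there is no 2-cycle through k. *)
  have := narrows_cancel_le (premut_quiver k Q) j j.
  rewrite narrows_premut // orbb; case: eqP => [->|_]; first by rewrite q0; lia.
  by rewrite q0 add0n aQ subnn; lia.
rewrite narrows_cancel // !narrows_premut // [(j == k) || _]orbC.
by case: ifP => // ijk; have := aQ i j; nia.
Qed.

Lemma mutn_antisym k q : antisym q -> antisym (mutn k q).
Proof.
move=> aq i j; rewrite /mutn [(j == k) || _]orbC; case: ifP => _; first by rewrite mulnC aq.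
by set x := (q i j + _)%N; set y := (q j i + _)%N; nia.
Qed.
End QuiverMutation.

(** * Laurent phenomenon *)

Section GeneratedSubring.
Variable F : fieldType.

Inductive gen (G : F -> Prop) : F -> Prop :=
  | gen_base z : G z -> gen G z
  | gen1 : gen G 1
  | genB x y : gen G x -> gen G y -> gen G (x - y)
  | genM x y : gen G x -> gen G y -> gen G (x * y).

Record subring (A : F -> Prop) : Prop := Subring {
  sr1 : A 1;
  srB : forall x y, A x -> A y -> A (x - y);
  srM : forall x y, A x -> A y -> A (x * y) }.

Lemma gen_subring G : subring (gen G).
Proof. by split; [apply: gen1 | apply: genB | apply: genM]. Qed.

Lemma gen_min G A : subring A -> (forall z, G z -> A z) -> forall z, gen G z -> A z.
Proof.
move=> hA GA z; elim=> {z} [z /GA //||x y _ Ax _ Ay|x y _ Ax _ Ay].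
- exact: sr1.
- exact: srB.
- exact: srM.
Qed.

Section Subring.
Variable A : F -> Prop.
Hypothesis hA : subring A.

Lemma sr0 : A 0.
Proof. by rewrite -(subrr 1); apply: srB => //; apply: sr1. Qed.
Lemma srN x : A x -> A (- x).
Proof. by move=> Ax; rewrite -sub0r; apply: srB => //; apply: sr0. Qed.
Lemma srD x y : A x -> A y -> A (x + y).
Proof. by move=> Ax Ay; rewrite -[y]opprK; apply: srB => //; apply: srN. Qed.
Lemma srX x n : A x -> A (x ^+ n).
Proof.
move=> Ax; elim: n => [|n IH]; first by rewrite expr0; apply: sr1.
by rewrite exprS; apply: srM.
Qed.
Lemma sr_sum I (r : seq I) (P : pred I) f :
  (forall i, P i -> A (f i)) -> A (\sum_(i <- r | P i) f i).
Proof. by move=> Af; elim/big_ind: _ => //; [apply: sr0 | apply: srD]. Qed.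
Lemma sr_prod I (r : seq I) (P : pred I) f :
  (forall i, P i -> A (f i)) -> A (\prod_(i <- r | P i) f i).
Proof. by move=> Af; elim/big_ind: _ => //; [apply: sr1 | apply: srM]. Qed.
End Subring.

Section Clearing.
Variables (A : F -> Prop) (x P : F).
Hypotheses (hA : subring A) (x0 : x != 0) (P0 : P != 0) (AP : A P).
Hypothesis trans : forall f : {poly F}, (forall i, A f`_i) -> f.[x] = 0 -> f = 0.

Let S := gen (fun z => [\/ A z, z = x | z = P / x]).

(* The elements of [A[x, P/x]] are the Laurent polynomials in x over A whose
   coefficient of [x^-m] is divisible by [P^m] for every m > 0. *)
Let T z := exists M (g : {poly F}), z * x ^+ M = g.[x] /\
  forall i, exists2 h, A h & g`_i = P ^+ (M - i) * h.

Let Tcoef M (g : {poly F}) : (forall i, exists2 h, A h & g`_i = P ^+ (M - i) * h) ->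
  forall i, A g`_i.
Proof. by move=> Tg i; have [h Ah ->] := Tg i; apply: (srM hA) => //; apply: (srX hA). Qed.

Let Traise M L (g : {poly F}) : (forall i, exists2 h, A h & g`_i = P ^+ (M - i) * h) ->
  forall i, exists2 h, A h & (g * 'X^L)`_i = P ^+ (M + L - i) * h.
Proof.
move=> Tg i; rewrite coefMXn; case: ltnP => iL.
  by exists 0; rewrite ?mulr0 //; apply: (sr0 hA).
by have [h Ah ->] := Tg (i - L)%N; exists h => //; congr (_ ^+ _ * _); lia.
Qed.

Let S_T z : S z -> T z.
Proof.
apply: gen_min => [|y [Ay|->|->]]; last 3 first.
- exists 0%N, y%:P; rewrite expr0 mulr1 hornerC; split=> // i.
  by rewrite sub0n expr0 coefC; case: eqP; [exists y | exists 0] => //;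
    rewrite ?mul1r ?mulr0 //; apply: (sr0 hA).
- exists 0%N, 'X; rewrite expr0 mulr1 hornerX; split=> // i.
  by exists ('X)`_i; rewrite ?mul1r // coefX; case: eqP => _; [apply: (sr1 hA)|apply: (sr0 hA)].
- exists 1%N, P%:P; rewrite expr1 hornerC divfK //; split=> // i.
  rewrite coefC; case: eqP => [->|_]; first by exists 1; rewrite ?mulr1 //; apply: (sr1 hA).
  by exists 0; rewrite ?mulr0 //; apply: (sr0 hA).
split=> [|y y' [M [g [yE Tg]]] [M' [g' [zE Tg']]]|y y' [M [g [yE Tg]]] [M' [g' [zE Tg']]]].
- exists 0%N, 1; rewrite expr0 mulr1 hornerC; split=> // i.
  by exists (1 : {poly F})`_i; rewrite ?mul1r // coef1; case: eqP => _; [apply: (sr1 hA)|apply: (sr0 hA)].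
- exists (M + M')%N, (g * 'X^M' - g' * 'X^M); split.
    by rewrite hornerD hornerN !hornerM !hornerXn -yE -zE exprD; ring.
  move=> i; have [h Ah E] := Traise M' Tg i; have [h' Ah' E'] := Traise M Tg' i.
  by exists (h - h'); [apply: (srB hA) | rewrite coefB E E' mulrBr [(M' + M)%N]addnC].
- exists (M + M')%N, (g * g'); split; first by rewrite hornerM -yE -zE exprD; ring.
  move=> i; rewrite coefM.
  apply: (big_ind (fun s => exists2 h, A h & s = P ^+ (M + M' - i) * h)).
  + by exists 0; rewrite ?mulr0 //; apply: (sr0 hA).
  + by move=> a b [h Ah ->] [h' Ah' ->]; exists (h + h'); rewrite ?mulrDr //; apply: (srD hA).
  move=> [j ji] _ /=; have [h Ah ->] := Tg j; have [h' Ah' ->] := Tg' (i - j)%N.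
  exists (P ^+ ((M - j) + (M' - (i - j)) - (M + M' - i)) * (h * h')).
    by apply: (srM hA); [apply: (srX hA) | apply: (srM hA)].
  rewrite mulrA -exprD mulrACA -exprD; congr (_ ^+ _ * _).
  by move: ji; rewrite ltnS; lia.
Qed.

Variable d : {poly F}.
Hypothesis Ad : forall i, A d`_i.
Hypothesis reg : forall f g, A f -> A g -> d`_0 * f = P * g -> exists2 h, A h & f = P * h.

Let reg_exp n s f g : A f -> A g -> d`_0 ^+ n * f = P ^+ s * g ->
  exists2 h, A h & f = P ^+ s * h.
Proof.
have reg1 m f' g' : A f' -> A g' -> d`_0 ^+ m * f' = P * g' -> exists2 h, A h & f' = P * h.
  elim: m f' g' => [|m IH] f' g' Af Ag; first by rewrite expr0 mul1r => ->; exists g'.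
  rewrite exprS -mulrA => /reg [||h Ah E] //; last exact: IH E.
  by apply: (srM hA) => //; apply: (srX hA).
elim: s f => [|s IH] f Af Ag E; first by exists f; rewrite ?mul1r.
have [||h Ah fE] := reg1 n f (P ^+ s * g) Af.
- by apply: (srM hA) => //; apply: (srX hA).
- by rewrite E exprS mulrA.
have [|h' Ah' hE] := IH h Ah Ag.
  by apply: (mulfI P0); rewrite mulrCA -fE E exprS mulrA.
by exists h'; rewrite // fE hE exprS mulrA.
Qed.

(** As x is transcendental over A, the hypothesis becomes an identity of polynomials [dn * f' = g'].
    Its coefficients are compared from the lowest up: that of [f'] at i carries the factor d(0)^n,
    the remaining terms involve lower coefficients that are already divisible by enough powers of P,
    and regularity of d(0) passes the divisibility on. *)
Lemma clear_denominator z n N (f : {poly F}) : (forall i, A f`_i) ->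
  z * x ^+ N = f.[x] -> S (d.[x] ^+ n * z) -> S z.
Proof.
move=> Af zE /S_T [M [g [gE Tg]]].
have sS : subring S by apply: gen_subring.
have AS y : A y -> S y by move=> Ay; apply: gen_base; constructor 1.
have APoly (p q : {poly F}) : (forall i, A p`_i) -> (forall i, A q`_i) ->
    forall i, A (p * q)`_i.
  by move=> Ap Aq i; rewrite coefM; apply: (sr_sum hA) => // j _; apply: (srM hA).
have AX m i : A ('X^m : {poly F})`_i.
  by rewrite coefXn; case: eqP => _; [apply: (sr1 hA) | apply: (sr0 hA)].
pose f' := f * 'X^M; pose g' := g * 'X^N; pose dn := d ^+ n.
have Adn : forall i, A dn`_i.
  rewrite /dn; elim: (n) => [|m IH] i; last by rewrite exprS; apply: APoly.
  by rewrite expr0 coef1; case: eqP => _; [apply: (sr1 hA)|apply: (sr0 hA)].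
have Af' : forall i, A f'`_i by apply: APoly.
have Tg' := Traise N Tg; rewrite -/g' in Tg'.
have E : dn * f' = g'.
  apply/eqP; rewrite -subr_eq0; apply/eqP; apply: trans.
    by move=> i; rewrite coefB; apply: (srB hA) => //; [apply: APoly | apply: Tcoef Tg' i].
  rewrite hornerD hornerN !hornerM !hornerXn horner_exp -zE -gE.
  by apply/eqP; rewrite subr_eq0; apply/eqP; ring.
have dn0 : dn`_0 = d`_0 ^+ n by rewrite -!horner_coef0 horner_exp.
have Tf' i : exists2 h, A h & f'`_i = P ^+ (M + N - i) * h.
  have [m] := ubnP i; elim: m i => // m IH i im.
  have [h' Ah' Eh'] : exists2 h, A h & dn`_0 * f'`_i = P ^+ (M + N - i) * h.
    have -> : dn`_0 * f'`_i = g'`_i - \sum_(j < i) dn`_j.+1 * f'`_(i - j.+1).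
      rewrite -E coefM big_ord_recl /= subn0; apply/eqP; rewrite -subr_eq opprK.
      by rewrite eq_sym; apply/eqP; congr (_ + _); rewrite addrK.
    have [h1 Ah1 ->] := Tg' i.
    suff [h2 Ah2 ->] : exists2 h, A h & \sum_(j < i) dn`_j.+1 * f'`_(i - j.+1)
        = P ^+ (M + N - i) * h.
      by exists (h1 - h2); [apply: (srB hA) | rewrite mulrBr].
    apply: (big_ind (fun s => exists2 h, A h & s = P ^+ (M + N - i) * h)).
    - by exists 0; rewrite ?mulr0 //; apply: (sr0 hA).
    - by move=> a b [h Ah ->] [h' Ah' ->]; exists (h + h'); rewrite ?mulrDr //; apply: (srD hA).
    move=> [j ji] _ /=; have [|h Ah ->] := IH (i - j.+1)%N; first by lia.
    exists (dn`_j.+1 * (P ^+ (M + N - (i - j.+1) - (M + N - i)) * h)).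
      by apply: (srM hA) => //; apply: (srM hA) => //; apply: (srX hA).
    rewrite [RHS]mulrCA; congr (_ * _); rewrite mulrA -exprD.
    by congr (_ ^+ _ * _); lia.
  by rewrite dn0 in Eh'; apply: reg_exp Eh'.
have -> : z = \sum_(i < size f') f'`_i * x ^+ i / x ^+ (M + N).
  rewrite -mulr_suml -horner_coef hornerM hornerXn -zE exprD.
  by rewrite -!mulrA [x ^+ N * _]mulrA [x ^+ N * x ^+ M]mulrC mulfV ?mulr1 // mulf_neq0 ?expf_neq0.
apply: (sr_sum sS) => // -[i _] _ /=.
have [iL|iL] := leqP (M + N) i.
  rewrite -(subnK iL) exprD mulrA mulfK ?expf_neq0 //.
  by apply: (srM sS) => //; [apply: AS | apply: (srX sS) => //; apply: gen_base; constructor 2].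
have [h Ah ->] := Tf' i.
have -> : P ^+ (M + N - i) * h * x ^+ i / x ^+ (M + N) = h * (P / x) ^+ (M + N - i).
  rewrite -{2}(subnK (ltnW iL)) exprD expr_div_n.
  by field; rewrite !expf_neq0.
by apply: (srM sS) => //; [apply: AS | apply: (srX sS) => //; apply: gen_base; constructor 3].
Qed.
End Clearing.
End GeneratedSubring.


(** * Laurent polynomials in algebraically independent elements *)

Section LaurentRings.
Variable N : nat.
Local Notation mpol := {mpoly rat[N]}.

Lemma mpoly_gen_ind (P : mpol -> Prop) : (forall c, P c%:MP) -> (forall i, P 'X_i) ->
  (forall p q, P p -> P q -> P (p + q)) -> (forall p q, P p -> P q -> P (p * q)) ->
  forall p, P p.
Proof.
move=> PC PX PD PM p; rewrite (mpolyE p); elim/big_rec: _ => [|m x _ Px].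
  by rewrite -mpolyC0.
apply: (PD) => //; rewrite -mul_mpolyC; apply: (PM) => //; rewrite mpolyXE_id.
elim/big_rec: _ => [|i y _ Py]; first by rewrite -mpolyC1.
apply: (PM) => //; elim: (m i) => [|l IH]; first by rewrite expr0 -mpolyC1.
by rewrite exprS; apply: (PM).
Qed.

Lemma mpolyU_neq0 (i : 'I_N) : 'X_i != 0 :> mpol.
Proof. by rewrite -msupp_eq0 msuppX. Qed.

Definition override (T : Type) (j : 'I_N) (x : T) (u : 'I_N -> T) i :=
  if i == j then x else u i.

Lemma override_eq (T : Type) (j : 'I_N) (x : T) u : override j x u j = x.
Proof. by rewrite /override eqxx. Qed.

Lemma override_neq (T : Type) (j i : 'I_N) (x : T) u : i != j -> override j x u i = u i.
Proof. by rewrite /override => /negPf ->. Qed.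

Lemma mmap1_override (R : comNzRingType) j (x : R) u (m : 'X_{1..N}) : m j = 0%N ->
  mmap1 (override j x u) m = mmap1 u m.
Proof.
move=> mj; apply: eq_bigr => i _; rewrite /override.
by case: eqP => [->|//]; rewrite mj !expr0.
Qed.

Definition mbinom (a b : 'X_{1..N}) : mpol := 'X_[a] + 'X_[b].

Section Weights.
Variable l : 'I_N -> int.

Definition weight (m : 'X_{1..N}) : int := \sum_i l i *+ m i.

Lemma weightD a b : weight (a + b)%MM = weight a + weight b.
Proof. by rewrite /weight -big_split; apply: eq_bigr => i _; rewrite mnmDE mulrnDr. Qed.

Let comp d (f : mpol) : mpol := \sum_(m <- msupp f | weight m == d) f@_m *: 'X_[m].

Let mcoeff_comp d f m : (comp d f)@_m = if weight m == d then f@_m else 0.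
Proof.
rewrite raddf_sum /= (eq_bigr (fun m' => if m' == m then f@_m else 0)) => [|m' _]; last first.
  by rewrite mcoeffZ mcoeffX; case: eqP => [->|_]; rewrite ?mulr1 ?mulr0.
have [mf|mf] := boolP (m \in msupp f); last first.
  rewrite (memN_msupp_eq0 mf) if_same big1 // => m' _; exact: if_same.
rewrite big_mkcond (bigD1_seq m) ?msupp_uniq //= eqxx big1 ?addr0 // => m' /negPf ->.
exact: if_same.
Qed.

Let compD d f g : comp d (f + g) = comp d f + comp d g.
Proof.
by apply/mpolyP => m; rewrite mcoeffD !mcoeff_comp mcoeffD; case: ifP; rewrite ?addr0.
Qed.

Let compX d a f : comp d ('X_[a] * f) = 'X_[a] * comp (d - weight a) f.
Proof.
have comp0 c : comp c 0 = 0 by rewrite /comp msupp0 big_nil.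
rewrite (mpolyE f); elim/big_rec: _ => [|m x _ IH]; first by rewrite mulr0 !comp0 mulr0.
rewrite mulrDr !compD IH mulrDr; congr (_ + _).
have compM c z k : comp c (z *: 'X_[k]) = if weight k == c then z *: 'X_[k] else 0.
  apply/mpolyP => k'; rewrite mcoeff_comp.
  have [->|kk'] := eqVneq k' k; first by case: ifP; rewrite ?mcoeff0.
  rewrite mcoeffZ mcoeffX [k == k']eq_sym (negPf kk') mulr0 if_same.
  by case: ifP; rewrite ?mcoeff0 // mcoeffZ mcoeffX [k == k']eq_sym (negPf kk') mulr0.
rewrite -scalerAr -mpolyXD !compM weightD [weight a + _]addrC.
rewrite [weight m == d - _]eq_sym subr_eq [d == _]eq_sym.
by case: ifP => _; rewrite ?mulr0 // -scalerAr -mpolyXD.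
Qed.

(* Modulo a homogeneous binomial, a binomial with terms of different weights
   has an invertible lowest term. *)
Lemma mbinom_regular a1 a2 b1 b2 f g :
  weight a1 != weight a2 -> weight b1 = weight b2 ->
  mbinom a1 a2 * f = mbinom b1 b2 * g ->
  exists m h, 'X_[m] * f = mbinom b1 b2 * h.
Proof.
wlog lt12 : a1 a2 / weight a1 < weight a2 => [W|] a12 b12 E.
  have [lt|lt|eq12] := ltgtP (weight a1) (weight a2).
  - exact: (W a1 a2).
  - by apply: (W a2 a1) => //; rewrite 1?eq_sym // -E /mbinom addrC.
  - by rewrite eq12 eqxx in a12.
set P := mbinom b1 b2.
have [B hB] : exists B : nat, forall m, m \in msupp f -> - B%:Z <= weight m.
  elim: (msupp f) => [|m s [B hB]]; first by exists 0%N.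
  exists (B + absz (weight m))%N => m'; rewrite inE => /predU1P [->|/hB]; lia.
(* In degree [d + weight a1] the equation relates [comp d f] to the component of f of weight
   [d + weight a1 - weight a2], which is smaller than d. Divisibility by P up to a monomial thus
   climbs from the lower bound [- B], below which all components vanish. *)
have compf n d : d < - B%:Z + n%:Z -> exists m h, 'X_[m] * comp d f = P * h.
  elim: n d => [|n IH] d dn.
    exists 0%MM, 0; rewrite mulr0 /comp big_seq_cond big1 ?mulr0 // => m.
    by move=> /andP [/hB hm /eqP dm]; exfalso; lia.
  have [|m [h mh]] := IH (d + weight a1 - weight a2); first by lia.
  have := congr1 (comp (d + weight a1)) E.
  rewrite /mbinom !mulrDl !compD !compX addrK b12 -mulrDl -/(mbinom _ _) -/P => Ed.
  exists (m + a1)%MM, ('X_[m] * comp (d + weight a1 - weight b2) g - 'X_[a2] * h).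
  rewrite mpolyXD -mulrA (canRL (addrK _) Ed) mulrBr mulrBr; congr (_ - _).
    by rewrite mulrCA.
  by rewrite mulrCA mh mulrCA.
have split_f : f = \sum_(d <- undup (map weight (msupp f))) comp d f.
  apply/mpolyP => m; rewrite raddf_sum /=.
  rewrite (eq_bigr (fun d => if d == weight m then f@_m else 0)) => [|d _]; last first.
    by rewrite mcoeff_comp eq_sym.
  have [mf|mf] := boolP (m \in msupp f); last first.
    by rewrite (memN_msupp_eq0 mf) big1 // => d _; rewrite if_same.
  rewrite (bigD1_seq (weight m)) ?undup_uniq ?mem_undup ?map_f //= eqxx.
  by rewrite big1 ?addr0 // => d /negPf ->.
rewrite split_f; elim: (undup _) => [|d s [m [h mh]]].
  by exists 0%MM, 0; rewrite big_nil !mulr0.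
have [m' [h' mh']] := compf (absz (d + B%:Z)).+1 d ltac:(lia).
exists (m + m')%MM, ('X_[m] * h' + 'X_[m'] * h).
rewrite big_cons mpolyXD !mulrDr; congr (_ + _).
  by rewrite -mulrA mh' mulrCA.
by rewrite [_ * 'X_[m']]mulrC -mulrA mh mulrCA.
Qed.
End Weights.

Section Independence.
Variables (F : fieldType) (iota : {rmorphism rat -> F}).
Implicit Type u : 'I_N -> F.

Definition independent u := forall p : mpol, mmap iota u p = 0 -> p = 0.

Definition laurent_gen u (E : pred 'I_N) (z : F) : Prop :=
  (exists c, z = iota c) \/ exists2 i, E i & z = u i \/ z = (u i)^-1.

Definition laurent u (E : pred 'I_N) := gen (laurent_gen u E).

Lemma laurent_subring u E : subring (laurent u E).
Proof. exact: gen_subring. Qed.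

Lemma laurent_var u (E : pred 'I_N) i : E i -> laurent u E (u i).
Proof. by move=> Ei; apply: gen_base; right; exists i => //; left. Qed.

Lemma laurent_inv u (E : pred 'I_N) i : E i -> laurent u E (u i)^-1.
Proof. by move=> Ei; apply: gen_base; right; exists i => //; right. Qed.

Lemma laurent_const u E c : laurent u E (iota c).
Proof. by apply: gen_base; left; exists c. Qed.

Lemma laurentP u (E : pred 'I_N) z : (forall i, u i != 0) -> laurent u E z ->
  exists m p, z * mmap1 u m = mmap iota u p.
Proof.
move=> u0; elim=> {z} [z [[c ->]|[i _ [->|->]]]||x y _ [m [p xE]] _ [m' [p' yE]]
    |x y _ [m [p xE]] _ [m' [p' yE]]].
- by exists 0%MM, c%:MP; rewrite mmap11 mulr1 mmapC.
- by exists 0%MM, 'X_i; rewrite mmap11 mulr1 mmapX mmap1U.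
- by exists U_(i)%MM, 1; rewrite mmap1U mulVf // rmorph1.
- by exists 0%MM, 1; rewrite mmap11 mulr1 rmorph1.
- exists (m + m')%MM, (p * 'X_[m'] - p' * 'X_[m]).
  rewrite rmorphB !rmorphM /= -xE -yE !mmapX commr_mmap1_M; last by move=> *; apply: mulrC.
  by ring.
- exists (m + m')%MM, (p * p').
  rewrite rmorphM /= -xE -yE commr_mmap1_M; last by move=> *; apply: mulrC.
  by ring.
Qed.

Lemma independent_neq0 u : independent u -> forall i, u i != 0.
Proof.
move=> iu i; apply/eqP => ui0.
have /iu /eqP : mmap iota u 'X_i = 0 by rewrite mmapX mmap1U.
by rewrite (negPf (mpolyU_neq0 i)).
Qed.

Lemma mmap1_neq0 u m : (forall i, u i != 0) -> mmap1 u m != 0.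
Proof. by move=> u0; apply/prodf_neq0 => i _; rewrite expf_neq0. Qed.

Section OmitVariable.
Variables (u : 'I_N -> F) (j : 'I_N).
Hypothesis iu : independent u.

Let A := laurent u (predC1 j).
(** Elements of [A] do not involve [u j]. Evaluation at [w] keeps polynomial values in [A] and
    monomials invertible there; on polynomials the same effect is obtained by [hat], which replaces
    X_j by 1. *)
Let w := override j 1 u.
Let hA : subring A := laurent_subring u _.

Let w0 i : w i != 0.
Proof. by rewrite /w /override; case: (i == j); rewrite ?oner_neq0 ?(independent_neq0 iu). Qed.

Lemma omitP z : A z -> exists m p, z * mmap1 w m = mmap iota w p.
Proof.
move=> Az; apply: (laurentP (E := predT)) => //; apply: gen_min Az; first exact: gen_subring.
move=> {}z [[c ->]|[i ij zE]]; first exact: laurent_const.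
have wi : u i = w i by rewrite /w /override; move: ij; rewrite /= => /negPf ->.
by case: zE => ->; rewrite wi; [apply: laurent_var | apply: laurent_inv].
Qed.

Lemma omit_mmap p : A (mmap iota w p).
Proof.
elim/mpoly_gen_ind: p => [c|i|p q Ap Aq|p q Ap Aq].
- by rewrite mmapC; apply: laurent_const.
- rewrite mmapX mmap1U /w /override; case: eqP => [_|/eqP ij]; first exact: (sr1 hA).
  exact: laurent_var.
- by rewrite rmorphD; apply: (srD hA).
- by rewrite rmorphM; apply: (srM hA).
Qed.

Lemma omit_monomV m : A (mmap1 w m)^-1.
Proof.
rewrite /mmap1 -prodfV; apply: (sr_prod hA) => i _; rewrite -exprVn.
apply: (srX hA); rewrite /w /override; case: eqP => [_|/eqP ij].
  by rewrite invr1; apply: (sr1 hA).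
exact: laurent_inv.
Qed.

Let hat : mpol -> mpol := mmap (@mpolyC N rat) (override j 1 (fun i => 'X_i)).

Let mmap_hat p : mmap iota u (hat p) = mmap iota w p.
Proof.
elim/mpoly_gen_ind: p => [c|i|p q IH IH'|p q IH IH'].
- by rewrite /hat !mmapC.
- rewrite /hat !mmapX !mmap1U /w /override; case: eqP => _; first by rewrite rmorph1.
  by rewrite mmapX mmap1U.
- by rewrite /hat !rmorphD /= -!/(hat _) IH IH'.
- by rewrite /hat !rmorphM /= -!/(hat _) IH IH'.
Qed.

(** Cleared of denominators, a relation over [A] is a polynomial relation among the [u i], hence
    trivial. [th] reads it as a univariate polynomial in X_j and isolates the coefficients. *)
Lemma omit_transcendental (f : {poly F}) :
  (forall i, A f`_i) -> f.[u j] = 0 -> f = 0.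
Proof.
move=> Af f0.
have [m [p pE]] : exists m, exists p : nat -> mpol,
    forall i, (i < size f)%N -> f`_i * mmap1 w m = mmap iota w (p i).
  elim: (size f) => [|n [m [p pE]]]; first by exists 0%MM, (fun=> 0).
  have [m' [p' E]] := omitP (Af n).
  exists (m + m')%MM, (fun i => if i == n then p' * 'X_[m] else p i * 'X_[m']) => i.
  rewrite ltnS leq_eqVlt commr_mmap1_M; last by move=> *; apply: mulrC.
  case: eqP => [-> _|_ /= /pE pi]; rewrite rmorphM /= mmapX -?E -?pi; ring.
pose th := mmap (polyC \o @mpolyC N rat) (override j 'X (fun i => ('X_i)%:P)).
have th_hat p' : th (hat p') = (hat p')%:P.
  elim/mpoly_gen_ind: p' => [c|i|q q' IH IH'|q q' IH IH'].
  - by rewrite /th /hat !mmapC.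
  - rewrite /th /hat !mmapX !mmap1U /override; case: eqP => [_|/eqP ij].
      by rewrite !rmorph1.
    by rewrite mmapX mmap1U (negPf ij).
  - by rewrite /hat rmorphD /= -!/(hat _) /th rmorphD /= -!/(th _) IH IH' polyCD.
  - by rewrite /hat rmorphM /= -!/(hat _) /th rmorphM /= -!/(th _) IH IH' polyCM.
have th_X : th 'X_j = 'X by rewrite /th mmapX mmap1U /override eqxx.
have sum0 : \sum_(i < size f) hat (p i) * 'X_j ^+ i = 0.
  apply: iu; rewrite rmorph_sum /=.
  rewrite (eq_bigr (fun i : 'I_(size f) => f`_i * u j ^+ i * mmap1 w m)) => [|i _].
    by rewrite -mulr_suml -horner_coef f0 mul0r.
  by rewrite rmorphM rmorphXn /= mmap_hat -pE // mmapX mmap1U; ring.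
apply/polyP => i; rewrite coef0.
have [iS|iS] := ltnP i (size f); last by rewrite nth_default.
have := congr1 (fun g => (th g)`_i) sum0.
rewrite /th rmorph0 coef0 rmorph_sum /= coef_sum (bigD1 (Ordinal iS)) //= big1 => [|k ki].
  rewrite rmorphM rmorphXn /= -!/(th _) th_hat th_X coefCM coefXn eqxx mulr1 addr0 => h0.
  have := pE i iS; rewrite -mmap_hat h0 rmorph0 => /eqP.
  by rewrite mulf_eq0 (negPf (mmap1_neq0 _ w0)) orbF => /eqP.
rewrite rmorphM rmorphXn /= -!/(th _) th_hat th_X coefCM coefXn.
by rewrite eq_sym -[(k : nat) == i]/(k == Ordinal iS) (negPf ki) mulr0.
Qed.

(** Clearing denominators leads to [mbinom_regular]. The quotient it yields may involve X_j;
    evaluation at [w] brings it back to [A], while the binomials, free of X_j, keep their values. *)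
Lemma omit_regular l (a1 a2 b1 b2 : 'X_{1..N}) f g :
  a1 j = 0%N -> a2 j = 0%N -> b1 j = 0%N -> b2 j = 0%N ->
  weight l a1 != weight l a2 -> weight l b1 = weight l b2 -> A f -> A g ->
  mmap iota u (mbinom a1 a2) * f = mmap iota u (mbinom b1 b2) * g ->
  exists2 h, A h & f = mmap iota u (mbinom b1 b2) * h.
Proof.
move=> a1j a2j b1j b2j a12 b12 /omitP [m [p fE]] /omitP [m' [p' gE]] E.
have binE (c1 c2 : 'X_{1..N}) : c1 j = 0%N -> c2 j = 0%N ->
    mmap iota u (mbinom c1 c2) = mmap iota w (mbinom c1 c2).
  by move=> c1j c2j; rewrite !rmorphD /= !mmapX !mmap1_override.
have hatX c : mmap1 w c = mmap iota u (hat 'X_[c]) by rewrite mmap_hat mmapX.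
have E' : mbinom a1 a2 * (hat p * hat 'X_[m']) = mbinom b1 b2 * (hat p' * hat 'X_[m]).
  apply/eqP; rewrite -subr_eq0; apply/eqP/iu; rewrite rmorphB !rmorphM /= -!hatX !mmap_hat.
  rewrite -fE -gE; apply/eqP; rewrite subr_eq0; apply/eqP.
  by rewrite -!mulrA mulrA E; ring.
have [c [h ch]] := mbinom_regular a12 b12 E'.
have := congr1 (mmap iota w) ch; rewrite !rmorphM /= -binE // mmapX.
have hat_w q : mmap iota w (hat q) = mmap iota w q.
  elim/mpoly_gen_ind: q => [x|i|q q' IH IH'|q q' IH IH'].
  - by rewrite /hat !mmapC.
  - rewrite /hat !mmapX !mmap1U /override; case: eqP => [->|_].
      by rewrite rmorph1 /w /override eqxx.
    by rewrite mmapX mmap1U.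
  - by rewrite /hat !rmorphD /= -!/(hat _) IH IH'.
  - by rewrite /hat !rmorphM /= -!/(hat _) IH IH'.
rewrite !hat_w mmapX -fE => Ew.
exists (mmap iota w h * ((mmap1 w c)^-1 * (mmap1 w m)^-1 * (mmap1 w m')^-1)).
  by apply: (srM hA); [apply: omit_mmap|do !apply: (srM hA); apply: omit_monomV].
rewrite mulrA -Ew; field.
by rewrite !mmap1_neq0.
Qed.
End OmitVariable.
End Independence.

(** The polynomial q is chosen before the field, so that the same q can be evaluated at a given
    cluster and at a generic one. *)
Lemma clear_substitution (k : 'I_N) (P p : mpol) : exists (q : mpol) (M : nat),
  forall (F : fieldType) (iota : {rmorphism rat -> F}) (w : 'I_N -> F), w k != 0 ->
  mmap iota w q = w k ^+ M * mmap iota (override k (mmap iota w P / w k) w) p.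
Proof.
elim/mpoly_gen_ind: p => [c|i|p p' [q [M E]] [q' [M' E']]|p p' [q [M E]] [q' [M' E']]].
- by exists c%:MP, 0%N => F iota w _; rewrite !mmapC mul1r.
- have [->|ik] := eqVneq i k.
    exists P, 1%N => F iota w wk; rewrite mmapX mmap1U /override eqxx expr1.
    by rewrite mulrC divfK.
  by exists 'X_i, 0%N => F iota w wk; rewrite !mmapX !mmap1U /override (negPf ik) mul1r.
- exists (q * 'X_k ^+ M' + q' * 'X_k ^+ M), (M + M')%N => F iota w wk.
  rewrite !rmorphD !rmorphM !rmorphXn /= E // E' // mmapX mmap1U exprD.
  by ring.
- exists (q * q'), (M + M')%N => F iota w wk.
  by rewrite !rmorphM /= E // E' // exprD; ring.
Qed.

Lemma mmap_tofrac p :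
  mmap (@tofrac mpol \o @mpolyC N rat) (fun i => tofrac 'X_i) p = tofrac p.
Proof.
elim/mpoly_gen_ind: p => [c|i|p q IH IH'|p q IH IH'].
- by rewrite mmapC.
- by rewrite mmapX mmap1U.
- by rewrite rmorphD /= IH IH' tofracD.
- by rewrite rmorphM /= IH IH' tofracM.
Qed.

Lemma independent_tofrac :
  independent (@tofrac mpol \o @mpolyC N rat) (fun i => tofrac 'X_i).
Proof. by move=> p /eqP; rewrite mmap_tofrac tofrac_eq0 => /eqP. Qed.

(** A relation p among the new elements gives a relation q among the old ones, so q = 0. Evaluated
    at the mutated generic point [y], where the exchange leads back to the generic point [x], this
    says that p vanishes at [x]. *)
Lemma independent_exchange (F : fieldType) (iota : {rmorphism rat -> F}) u k (a b : 'X_{1..N}) :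
  a k = 0%N -> b k = 0%N -> independent iota u ->
  independent iota (override k (mmap iota u (mbinom a b) / u k) u).
Proof.
move=> ak bk iu p p0; have uk := independent_neq0 iu k.
have [q [M qE]] := clear_substitution k (mbinom a b) p.
have q0 : q = 0 by apply: iu; rewrite qE // p0 mulr0.
pose F0 : fieldType := {fraction {mpoly rat[N]}}.
pose iota0 : {rmorphism rat -> F0} := @tofrac {mpoly rat[N]} \o @mpolyC N rat.
pose x i : F0 := tofrac 'X_i.
have xE r : mmap iota0 x r = tofrac r by exact: mmap_tofrac.
have x0 i : x i != 0 by rewrite /x tofrac_eq0 mpolyU_neq0.
have binE (G : fieldType) (j : {rmorphism rat -> G}) y (w : 'I_N -> G) :
    mmap j (override k y w) (mbinom a b) = mmap j w (mbinom a b).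
  by rewrite !rmorphD /= !mmapX !mmap1_override.
have B0 : mmap iota0 x (mbinom a b) != 0.
  (* With all variables equal to 1 a sum of two monomials has the value 2. *)
  rewrite xE tofrac_eq0; apply/eqP => /(congr1 (mmap idfun (fun=> 1))).
  rewrite rmorph0 rmorphD /= !mmapX /mmap1 !big1 => [/eqP|i _|i _]; rewrite ?expr1n //.
set c := mmap iota0 x (mbinom a b) in B0.
pose y := override k (c / x k) x.
have yk : y k = c / x k by exact: override_eq.
have yk0 : y k != 0 by rewrite yk; exact: (mulf_neq0 B0 (invr_neq0 (x0 k))).
have yc : mmap iota0 y (mbinom a b) = c by exact: binE.
have := qE F0 iota0 y yk0; rewrite q0 rmorph0 => /esym /eqP.
rewrite mulf_eq0 (negPf (expf_neq0 _ yk0)) /= yc.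
have -> : mmap iota0 (override k (c / y k) y) p = mmap iota0 x p.
  apply: eq_bigr => m _; congr (_ * _); apply: eq_bigr => i _; congr (_ ^+ _).
  have [->|ik] := eqVneq i k; last by rewrite override_neq //; exact: override_neq.
  by rewrite override_eq yk invf_div mulrCA (mulfV B0) mulr1.
by rewrite xE tofrac_eq0 => /eqP.
Qed.
End LaurentRings.

(** * Exchange polynomials and upper bounds under mutation *)

Section SeedMutation.
Variables (N : nat) (F : fieldType) (iota : {rmorphism rat -> F}).
Implicit Types (q : 'I_N -> 'I_N -> nat) (u : 'I_N -> F).

Definition exch_val q u j : F := \prod_i u i ^+ q i j + \prod_i u i ^+ q j i.

Definition mutu q u k := override k (exch_val q u k / u k) u.

Definition in_exp q j : 'X_{1..N} := [multinom q i j | i < N].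
Definition out_exp q j : 'X_{1..N} := [multinom q j i | i < N].

(* The Laurent polynomials in the cluster that stay Laurent after mutation at
   j, in the form [A[u_j, u_j']] with A the Laurent polynomials without u_j. *)
Definition upper q u j :=
  gen (fun z => [\/ laurent iota u (predC1 j) z, z = u j | z = exch_val q u j / u j]).

Lemma exch_valE q u j :
  exch_val q u j = mmap iota u (mbinom (in_exp q j) (out_exp q j)).
Proof.
rewrite rmorphD /= !mmapX /mmap1; congr (_ + _); apply: eq_bigr => i _;
  by rewrite mnmE.
Qed.

Lemma mbinom_neq0 (a b : 'X_{1..N}) : mbinom a b != 0.
Proof.
apply/eqP => /(congr1 (mmap idfun (fun=> 1))).
by rewrite rmorph0 rmorphD /= !mmapX /mmap1 !big1 => [/eqP|i _|i _]; rewrite ?expr1n.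
Qed.

Lemma exch_val_neq0 q u j : independent iota u -> exch_val q u j != 0.
Proof.
move=> iu; rewrite exch_valE; apply/eqP => /iu /eqP.
by rewrite (negPf (mbinom_neq0 _ _)).
Qed.

Lemma exch_val_override q u j k x : q j k = 0%N -> q k j = 0%N ->
  exch_val q (override k x u) j = exch_val q u j.
Proof.
move=> jk kj; rewrite /exch_val; congr (_ + _); apply: eq_bigr => i _;
  by rewrite /override; case: eqP => // ->; rewrite ?jk ?kj !expr0.
Qed.

(** Mutation reverses the arrows at k, which swaps the two exchange monomials, and neither contains
    the variable at k. *)
Lemma exch_val_mut q u k : antisym q ->
  exch_val (mutn k q) (mutu q u k) k = exch_val q u k.
Proof.
move=> aq; have kk : mutn k q k k = 0%N by rewrite /mutn eqxx antisym_diag.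
rewrite /mutu exch_val_override // /exch_val addrC; congr (_ + _); apply: eq_bigr => i _;
  by rewrite /mutn eqxx ?orbT.
Qed.

Lemma independent_mut q u k : antisym q -> independent iota u ->
  independent iota (mutu q u k).
Proof.
move=> aq iu; rewrite /mutu exch_valE; apply: independent_exchange => //;
  by rewrite mnmE antisym_diag.
Qed.

Section Descent.
Variables (q : 'I_N -> 'I_N -> nat) (u : 'I_N -> F) (j : 'I_N).
Hypotheses (aq : antisym q) (iu : independent iota u).

Let A := laurent iota u (predC1 j).
Let S := upper q u j.
Let hA : subring A := laurent_subring iota u _.
Let hS : subring S := gen_subring _.
Let u0 := independent_neq0 iu.

Let A_S z : A z -> S z.
Proof. by move=> Az; apply: gen_base; constructor 1. Qed.

Let A_var i : i != j -> A (u i).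
Proof. by move=> ij; apply: laurent_var. Qed.

Let A_inv i : i != j -> A (u i)^-1.
Proof. by move=> ij; apply: laurent_inv. Qed.

Let S_var i : S (u i).
Proof.
have [->|ij] := eqVneq i j; first by apply: gen_base; constructor 2.
by apply: A_S; apply: A_var.
Qed.

Let A_prod (P : pred 'I_N) (m : 'I_N -> nat) : (forall i, P i -> m i != 0%N -> i != j) ->
  A (\prod_(i | P i) u i ^+ m i) /\ A (\prod_(i | P i) u i ^+ m i)^-1.
Proof.
move=> mj; rewrite -prodfV; split; apply: (sr_prod hA) => i Pi.
  case: (eqVneq (m i) 0%N) => [->|mi]; first by rewrite expr0; apply: (sr1 hA).
  by apply: (srX hA); apply: A_var; apply: mj.
rewrite -exprVn; case: (eqVneq (m i) 0%N) => [->|mi]; first by rewrite expr0; apply: (sr1 hA).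
by apply: (srX hA); apply: A_inv; apply: mj.
Qed.

Let S_prod (P : pred 'I_N) (m : 'I_N -> nat) : S (\prod_(i | P i) u i ^+ m i).
Proof. by apply: (sr_prod hS) => i _; apply: (srX hS); apply: S_var. Qed.

(** The new exchange value has to be expressed through [u j] and [P / u j], which is done by
    eliminating [Out] between the old and the new exchange polynomial. Arrows in the other direction
    are handled later by reversing the whole quiver. *)
Lemma upper_mut_exch k : j != k -> q j k = 0%N ->
  S (exch_val (mutn k q) (mutu q u k) j / u j).
Proof.
move=> jk qjk; set a := q k j; set Pk := exch_val q u k; set P := exch_val q u j.
set q' := mutn k q; set u' := mutu q u k.
pose In := \prod_(i | i != k) u i ^+ q i j.
pose Out := \prod_(i | i != k) u i ^+ q j i.
pose K1 := \prod_i u i ^+ q i k.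
pose K2 := \prod_(i | i != j) u i ^+ q k i.
(* [M] collects the 2-cycles at j that the mutation cancels; multiplying by it restores the
   untruncated exponents. *)
pose M := \prod_(i | i != k) u i ^+ minn (q i j + a * q i k) (q j i).
have u'k : u' k = Pk / u k by rewrite /u' /mutu /override eqxx.
have u'i i : i != k -> u' i = u i by move=> /negPf ik; rewrite /u' /mutu /override ik.
have PE : P = u k ^+ a * In + Out.
  by rewrite /P /exch_val (bigD1 k) //= [X in _ + X](bigD1 k) //= qjk expr0 mul1r.
have PkE : Pk = K1 + u j ^+ a * K2 by rewrite /Pk /exch_val [X in _ + X](bigD1 j).
have K1E : K1 = \prod_(i | i != k) u i ^+ q i k.
  by rewrite /K1 (bigD1 k) //= antisym_diag // expr0 mul1r.
have P'E : M * exch_val q' u' j = In * K1 ^+ a + u' k ^+ a * Out.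
  have q'kj : q' k j = 0%N by rewrite /q' /mutn eqxx.
  have q'jk : q' j k = a by rewrite /q' /mutn eqxx orbT.
  have q'ij i : i != k -> q' i j = (q i j + a * q i k - q j i)%N /\
                          q' j i = (q j i - (q i j + a * q i k))%N.
    move=> /negPf ik; rewrite /q' /mutn ik (negPf jk) /= qjk.
    by rewrite mul0n !addn0 [(q k j * _)%N]mulnC [(q i k * q k j)%N]mulnC -/a.
  rewrite /exch_val (bigD1 k) //= [X in _ * (_ + X)](bigD1 k) //= q'kj q'jk expr0 mul1r.
  rewrite mulrDr mulrCA; congr (_ + _ * _).
    rewrite K1E -prodrXl -!big_split; apply: eq_bigr => i ik /=.
    have [-> _] := q'ij i ik; rewrite u'i // -exprM -!exprD; congr (_ ^+ _).
    by rewrite [(q i k * a)%N]mulnC; lia.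
  rewrite -big_split; apply: eq_bigr => i ik /=.
  by have [_ ->] := q'ij i ik; rewrite u'i // -exprD; congr (_ ^+ _); lia.
have M0 : M != 0 by apply/prodf_neq0 => i _; apply: expf_neq0.
(* Here [Out] is replaced by [P - u k ^+ a * In]. For a > 0 the difference [Pk - K1] is divisible by
   [u j], hence so is [Pk ^+ a - K1 ^+ a]. *)
have -> : exch_val q' u' j / u j =
    M^-1 * (u k)^-1 ^+ a * (Pk ^+ a * (P / u j) - u k ^+ a * In * ((Pk ^+ a - K1 ^+ a) / u j)).
  apply: (mulfI M0); rewrite [LHS]mulrA P'E PE u'k expr_div_n exprVn.
  move: (u0 j) M0 (expf_neq0 a (u0 k)).
  move: (u j) (M : F) (u k ^+ a) (Pk ^+ a) (K1 ^+ a) (In : F) (Out : F).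
  by move=> x y t v w s r x0 y0 t0; field; rewrite x0 y0 t0.
have SPk : S Pk by apply: (srD hS); apply: S_prod.
have SM : S M^-1.
  apply: A_S; apply: (A_prod _).2 => i ik mi; apply: contraNneq mi => ->.
  by rewrite antisym_diag // qjk muln0.
have Suk : S ((u k)^-1 ^+ a) by apply: (srX hS); apply: A_S; apply: A_inv; rewrite eq_sym.
apply: (srM hS); first exact: (srM hS).
apply: (srB hS).
  by apply: (srM hS); [apply: (srX hS)|apply: gen_base; constructor 3].
apply: (srM hS); first by apply: (srM hS); [apply: (srX hS) | apply: S_prod].
have [->|a0] := posnP a; first by rewrite !expr0 subrr mul0r; apply: (sr0 hS).
rewrite subrXX; set s := \sum_(i < a) _.
have Ss : S s by apply: (sr_sum hS) => i _; apply: (srM hS); apply: (srX hS) => //; apply: S_prod.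
have -> : Pk - K1 = u j * (u j ^+ a.-1 * K2).
  by rewrite PkE addrC addKr mulrA -exprS prednK.
have -> : u j * (u j ^+ a.-1 * K2) * s / u j = u j ^+ a.-1 * K2 * s by rewrite mulrC -mulrA mulKf.
by apply: (srM hS) => //; apply: (srM hS); [apply: (srX hS) | apply: S_prod].
Qed.
End Descent.

Lemma exch_val_tr q u j : exch_val (fun a b => q b a) u j = exch_val q u j.
Proof. by rewrite /exch_val addrC. Qed.

Lemma mutn_tr (k : 'I_N) q i j : mutn k (fun a b => q b a) i j = mutn k q j i.
Proof.
rewrite /mutn [(j == k) || _]orbC; case: ifP => // _.
by rewrite [(q k i * _)%N]mulnC [(q k j * _)%N]mulnC.
Qed.

(** One inclusion in the mutation invariance of upper bounds. Membership at j puts z into [S] up to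
    a power of [Pk], the only new denominator, as the inverse of [u' k] is [u k / Pk]. Membership at
    k makes z Laurent in [u j] over [A]. [clear_denominator] combines the two, with [Pk] viewed as a
    polynomial [d] in [u j]. *)
Lemma upper_mut q u j k z : antisym q -> independent iota u -> j != k ->
  (q j k = 0%N -> q k j = 0%N -> exists2 l, weight l (in_exp q k) != weight l (out_exp q k)
     & weight l (in_exp q j) = weight l (out_exp q j)) ->
  upper (mutn k q) (mutu q u k) j z -> upper (mutn k q) (mutu q u k) k z ->
  upper q u j z.
Proof.
move=> aq iu jk hreg Uj Uk; set q' := mutn k q in Uj Uk; set u' := mutu q u k in Uj Uk.
have u0 := independent_neq0 iu.
pose A := laurent iota u (predC1 j); have hA : subring A by exact: laurent_subring.
set S := upper q u j; have hS : subring S by exact: gen_subring.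
set Pk := exch_val q u k; have Pk0 : Pk != 0 by exact: exch_val_neq0.
have u'k : u' k = Pk / u k by rewrite /u' /mutu /override eqxx.
have u'i i : i != k -> u' i = u i by move=> /negPf ik; rewrite /u' /mutu /override ik.
have Ai i : i != j -> A (u i) by move=> ij; apply: laurent_var.
have AVi i : i != j -> A (u i)^-1 by move=> ij; apply: laurent_inv.
have kj : k != j by rewrite eq_sym.
have AS y : A y -> S y by move=> Ay; apply: gen_base; constructor 1.
have S_exch : S (exch_val q' u' j / u j).
  have /eqP := aq j k; rewrite muln_eq0 => /orP [] /eqP qjk; first exact: upper_mut_exch.
  have aq' : antisym (fun a b => q b a) by move=> a b; apply: aq.
  have := upper_mut_exch aq' iu jk qjk.
  have -> : exch_val (mutn k (fun a b => q b a)) (mutu (fun a b => q b a) u k) j = exch_val q' u' j.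
    rewrite -[RHS]exch_val_tr /exch_val; congr (_ + _); apply: eq_bigr => i _;
      rewrite mutn_tr /q' /u'; congr (_ ^+ _);
      by rewrite /mutu /override exch_val_tr.
  apply: gen_min => // y [Ay|->|->]; first exact: AS.
    by apply: gen_base; constructor 2.
  by rewrite exch_val_tr; apply: gen_base; constructor 3.
pose C1 := \prod_(i | i != j) u i ^+ q i k; pose C2 := \prod_(i | i != j) u i ^+ q k i.
have AC m : A (\prod_(i | i != j) u i ^+ m i) /\ A (\prod_(i | i != j) u i ^+ m i)^-1.
  rewrite -prodfV; split; apply: (sr_prod hA) => i ij.
    by apply: (srX hA); apply: Ai.
  by rewrite -exprVn; apply: (srX hA); apply: AVi.
have C0 m : \prod_(i | i != j) u i ^+ m i != 0 by apply/prodf_neq0 => i _; apply: expf_neq0.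
pose d : {poly F} := C1%:P * 'X^(q j k) + C2%:P * 'X^(q k j).
have dE : d.[u j] = Pk.
  rewrite hornerD !hornerM !hornerC !hornerXn /Pk /exch_val.
  by rewrite (bigD1 j) //= [X in _ = _ + X](bigD1 j) //= [C1 * _]mulrC [C2 * _]mulrC.
have Ad i : A d`_i.
  rewrite coefD !coefCM !coefXn; apply: (srD hA); (apply: (srM hA); first exact: (AC _).1);
    by case: (i == _); [apply: (sr1 hA) | apply: (sr0 hA)].
have AP : A (exch_val q u j).
  apply: (srD hA); apply: (sr_prod hA) => i _; (have [->|ij] := eqVneq i j;
    first by rewrite antisym_diag // expr0; apply: (sr1 hA));
    by apply: (srX hA); apply: Ai.
have reg f g : A f -> A g -> d`_0 * f = exch_val q u j * g ->
    exists2 h, A h & f = exch_val q u j * h.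
  move=> Af Ag; rewrite coefD !coefCM !coefXn.
  have inv m : \prod_(i | i != j) u i ^+ m i * f = exch_val q u j * g ->
      exists2 h, A h & f = exch_val q u j * h.
    move=> E; exists ((\prod_(i | i != j) u i ^+ m i)^-1 * g).
      by apply: (srM hA) => //; apply: (AC _).2.
    by rewrite mulrCA -E mulKf.
  (* If j and k are joined by arrows, the constant term of [d] is a monomial and invertible in [A].
     Otherwise it is all of [Pk], and [hreg] makes it regular modulo the exchange polynomial at
     j. *)
  have := aq j k; case Ejk: (q j k) => [|a]; case Ekj: (q k j) => [|b] // _.
  - rewrite !mulr1 => E; have [l l12 l34] := hreg Ejk Ekj.
    rewrite !exch_valE in E *; apply: (omit_regular iu _ _ _ _ l12 l34 Af Ag);
      rewrite ?mnmE ?antisym_diag // -E -exch_valE -/Pk -dE.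
    by rewrite hornerD !hornerM !hornerC !hornerXn Ejk Ekj !mulr1.
  - by rewrite mulr1 mulr0 addr0; apply: inv.
  - by rewrite mulr1 mulr0 add0r; apply: inv.
have [L [f [Af zE]]] : exists L (f : {poly F}), (forall i, A f`_i) /\ z * u j ^+ L = f.[u j].
  have AX m i : A ('X^m : {poly F})`_i.
    by rewrite coefXn; case: eqP => _; [apply: (sr1 hA) | apply: (sr0 hA)].
  have AM (f g : {poly F}) : (forall i, A f`_i) -> (forall i, A g`_i) -> forall i, A (f * g)`_i.
    by move=> Af Ag i; rewrite coefM; apply: (sr_sum hA) => l _; apply: (srM hA).
  have AC' c : A c -> forall i, A (c%:P)`_i.
    by move=> Ac i; rewrite coefC; case: eqP => // _; apply: (sr0 hA).
  pose T y := exists L (f : {poly F}), (forall i, A f`_i) /\ y * u j ^+ L = f.[u j].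
  have TA y : A y -> T y.
    by move=> Ay; exists 0%N, y%:P; rewrite mulr1 hornerC; split=> //; apply: AC'.
  have Tj : T (u j) by exists 0%N, 'X^1; rewrite mulr1 hornerXn.
  have TVj : T (u j)^-1 by exists 1%N, 1%:P; rewrite hornerC mulVf //; split=> //; apply: AC'; apply: (sr1 hA).
  have hT : subring T.
    split=> [|x y [M [g [Ag xE]]] [M' [g' [Ag' yE]]]|x y [M [g [Ag xE]]] [M' [g' [Ag' yE]]]].
    - exact/TA/(sr1 hA).
    - exists (M + M')%N, (g * 'X^M' - g' * 'X^M); split.
        by move=> i; rewrite coefB; apply: (srB hA); apply: AM.
      by rewrite hornerD hornerN !hornerM !hornerXn -xE -yE exprD; ring.
    - exists (M + M')%N, (g * g'); split; first exact: AM.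
      by rewrite hornerM -xE -yE exprD; ring.
  apply: (gen_min hT) Uk => y [Ay|->|->].
  - apply: gen_min Ay => // {}y [[c ->]|[i ik yE]]; first by apply: TA; apply: laurent_const.
    have [ij|ij] := eqVneq i j; first by case: yE => ->; rewrite ij u'i.
    by case: yE => ->; rewrite u'i //; apply: TA; [apply: Ai | apply: AVi].
  - rewrite u'k mulrC; apply: (srM hT); first exact/TA/AVi.
    by exists 0%N, d; rewrite mulr1 dE.
  - rewrite exch_val_mut // u'k -/Pk invf_div mulrCA mulfV // mulr1.
    exact/TA/Ai.
have [n Sn] : exists n, S (Pk ^+ n * z).
  have SPk : S Pk.
    rewrite -dE horner_coef; apply: (sr_sum hS) => i _; apply: (srM hS); first exact/AS/Ad.
    by apply: (srX hS); apply: gen_base; constructor 2.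
  pose T y := exists n, S (Pk ^+ n * y).
  have TS y : S y -> T y by move=> Sy; exists 0%N; rewrite mul1r.
  have hT : subring T.
    split=> [|x y [m Sx] [m' Sy]|x y [m Sx] [m' Sy]]; first by apply: TS; apply: (sr1 hS).
      exists (m + m')%N.
      have -> : Pk ^+ (m + m') * (x - y) = Pk ^+ m' * (Pk ^+ m * x) - Pk ^+ m * (Pk ^+ m' * y).
        by rewrite exprD; ring.
      by apply: (srB hS); apply: (srM hS) => //; apply: (srX hS).
    exists (m + m')%N; have -> : Pk ^+ (m + m') * (x * y) = Pk ^+ m * x * (Pk ^+ m' * y).
      by rewrite exprD; ring.
    exact: (srM hS).
  apply: (gen_min hT) Uj => y [Ay|->|->].
  - apply: gen_min Ay => // {}y [[c ->]|[i ij yE]].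
      by apply/TS/AS; apply: laurent_const.
    have [ik|ik] := eqVneq i k; last first.
      by case: yE => ->; rewrite u'i //; apply/TS/AS; [apply: Ai|apply: AVi].
    case: yE => ->; rewrite ik u'k.
      by apply: TS; apply: (srM hS) => //; apply/AS/AVi.
    by exists 1%N; rewrite expr1 invf_div mulrC divfK //; apply/AS/Ai.
  - by rewrite u'i //; apply: TS; apply: gen_base; constructor 2.
  - by rewrite [u' j]u'i //; apply: TS.
have trans := @omit_transcendental _ _ _ _ j iu.
by apply: (clear_denominator hA (u0 j) (exch_val_neq0 _ _ iu) AP trans Ad reg Af zE);
  rewrite dE; apply: Sn.
Qed.

(** Mutation at k interchanges the generators [u k] and [exch_val q u k / u k]. *)
Lemma upper_mut_self q u k z : antisym q -> independent iota u ->
  upper (mutn k q) (mutu q u k) k z -> upper q u k z.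
Proof.
move=> aq iu; have u0 := independent_neq0 iu; have Pk0 := exch_val_neq0 q k iu.
have u'k : mutu q u k k = exch_val q u k / u k by rewrite /mutu /override eqxx.
apply: gen_min => [|y [Ay|->|->]]; first exact: gen_subring.
- apply: gen_base; constructor 1; apply: gen_min Ay; first exact: laurent_subring.
  move=> {}y [[c ->]|[i ik yE]]; first exact: laurent_const.
  have ui : mutu q u k i = u i by rewrite /mutu /override (negPf ik).
  by case: yE => ->; rewrite ui; [apply: laurent_var | apply: laurent_inv].
- by rewrite u'k; apply: gen_base; constructor 3.
- rewrite exch_val_mut // u'k invf_div mulrCA mulfV // mulr1.
  by apply: gen_base; constructor 2.
Qed.

Lemma upper_var q u j i : upper q u j (u i).
Proof.
have [->|ij] := eqVneq i j; apply: gen_base; first by constructor 2.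
by constructor 1; apply: laurent_var.
Qed.

Lemma upper_laurent q u j z : upper q u j z -> laurent iota u predT z.
Proof.
have hL := laurent_subring iota u predT.
apply: gen_min => // y [Ay|->|->]; last 2 first.
- exact: laurent_var.
- apply: (srM hL); last exact: laurent_inv.
  by apply: (srD hL); apply: (sr_prod hL) => i _; apply: (srX hL); apply: laurent_var.
apply: gen_min Ay => // {}y [[c ->]|[i _ [->|->]]].
- exact: laurent_const.
- exact: laurent_var.
- exact: laurent_inv.
Qed.
End SeedMutation.

(** * C-vectors and values at y = 0 *)

Section SignCoherence.
Variable n : nat.
Local Notation N := (n + n)%N.
Local Notation mu := (@lshift n n).
Local Notation fr := (@rshift n n).
Implicit Type q : 'I_N -> 'I_N -> nat.

Definition cvec q (j i : 'I_n) : int := (q (fr i) (mu j))%:Z - (q (mu j) (fr i))%:Z.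

Definition coherent q k : Prop :=
  (forall i, q (mu k) (fr i) = 0%N) \/ (forall i, q (fr i) (mu k) = 0%N).

Definition cvec_inv q (D : 'I_n -> 'I_n -> int) : Prop :=
  forall k j, \sum_i D k i * cvec q j i = (k == j)%:R.

Lemma lshift_eq (i j : 'I_n) : (mu i == mu j) = (i == j).
Proof. exact: (inj_eq (@lshift_inj n n)). Qed.

Lemma rshift_lshift (i j : 'I_n) : (fr i == mu j) = false.
Proof. by apply/eqP => /(congr1 val) /= E; have := ltn_ord j; rewrite -E; lia. Qed.

(** Only the paths i* -> k -> j, or only the paths j -> k -> i*, contribute, according to the sign
    of the c-vector at k; [e j] counts their arrows between k and j. The truncations drop out of the
    difference of the two counts. *)
Lemma cvec_mut q k : antisym q -> coherent q k ->
  exists e : 'I_n -> int, e k = 0 /\ forall j i,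
    cvec (mutn (mu k) q) j i = if j == k then - cvec q k i else cvec q j i + e j * cvec q k i.
Proof.
move=> aq ck; have ckk i : cvec (mutn (mu k) q) k i = - cvec q k i.
  by rewrite /cvec /mutn eqxx orbT /= opprB.
case: ck => ck; [exists (fun j => (q (mu k) (mu j))%:Z)|exists (fun j => (q (mu j) (mu k))%:Z)];
  (split; first by rewrite antisym_diag); move=> j i;
  case: eqP => [->//|/eqP jk];
  rewrite /cvec /mutn rshift_lshift lshift_eq (negPf jk) /= ck; nia.
Qed.

Lemma cvec_inv_mut q k D : antisym q -> coherent q k -> cvec_inv q D ->
  exists D', cvec_inv (mutn (mu k) q) D'.
Proof.
move=> aq ck hD; have [e [ek eE]] := cvec_mut aq ck.
have De x y z : \sum_i D x i * (cvec q y i + z * cvec q k i) = (x == y)%:R + z * (x == k)%:R.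
  rewrite -!hD mulr_sumr -big_split; apply: eq_bigr => i _ /=; ring.
(* Dual of the column operation: since only multiples of the k-th column are added, only the k-th
   row of the inverse changes. *)
exists (fun x i => if x == k then - D k i + \sum_j e j * D j i else D x i) => x j.
rewrite (eq_bigr (fun i => (if x == k then - D k i + \sum_j e j * D j i else D x i) *
  (if j == k then - cvec q k i else cvec q j i + e j * cvec q k i))) => [|i _]; last first.
  by rewrite eE.
have [->|xk] := eqVneq x k; last first.
  have [->|jk] := eqVneq j k; last by rewrite De (negPf xk) mulr0 addr0.
  by under eq_bigr do rewrite mulrN; rewrite sumrN hD (negPf xk) oppr0.
have sum_swap (v : 'I_n -> int) : \sum_i (- D k i + \sum_j e j * D j i) * v i =
    - (\sum_i D k i * v i) + \sum_l e l * \sum_i D l i * v i.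
  rewrite -sumrN [X in _ + X](eq_bigr (fun l => \sum_i e l * (D l i * v i))); last first.
    by move=> l _; rewrite mulr_sumr.
  rewrite exchange_big -big_split /=; apply: eq_bigr => i _.
  rewrite mulrDl mulNr mulr_suml; congr (_ + _).
  by apply: eq_bigr => l _; rewrite mulrA.
rewrite sum_swap; have [_|jk] := eqVneq j k.
  under [X in - X]eq_bigr do rewrite mulrN; rewrite sumrN hD eqxx opprK.
  rewrite big1 ?addr0 // => l _; under eq_bigr do rewrite mulrN.
  by rewrite sumrN hD; case: eqP => [->|_]; rewrite ?ek ?mul0r // oppr0 mulr0.
rewrite De eqxx [k == j]eq_sym (negPf jk) add0r mulr1.
under eq_bigr do rewrite De.
rewrite (bigD1 j) //= eqxx (negPf jk) mulr0 addr0 mulr1 big1 ?addr0 ?addNr // => l lj.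
rewrite (negPf lj) add0r; case: eqP => [->|_]; last by rewrite !mulr0.
by rewrite ek !mul0r.
Qed.

Lemma cvec_weight q (l : 'I_n -> int) j :
  let l' v := if split v is inr i then l i else 0 in
  weight l' (in_exp q (mu j)) - weight l' (out_exp q (mu j)) = \sum_i l i * cvec q j i.
Proof.
move=> l'; have wE m : weight l' m = \sum_i l i *+ m (fr i).
  rewrite /weight big_split_ord /= big1 ?add0r => [|i _].
    by apply: eq_bigr => i _; rewrite /l' (unsplitK (inr i)).
  by rewrite /l' (unsplitK (inl i)) mul0rn.
rewrite !wE -sumrB; apply: eq_bigr => i _; rewrite !mnmE /cvec.
by rewrite mulrBr -[l i *+ q _ _]mulr_natr -[l i *+ q (mu j) _]mulr_natr natz (natz (q (mu j) _)).
Qed.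

Lemma cvec_regular q D j k : cvec_inv q D -> j != k ->
  exists2 l, weight l (in_exp q (mu k)) != weight l (out_exp q (mu k))
    & weight l (in_exp q (mu j)) = weight l (out_exp q (mu j)).
Proof.
move=> hD jk; exists (fun v => if split v is inr i then D k i else 0).
  by rewrite -subr_eq0 cvec_weight hD eqxx.
by apply/eqP; rewrite -subr_eq0 cvec_weight hD [k == j]eq_sym (negPf jk).
Qed.

Let frac := ratfun n.
Let iota : {rmorphism rat -> frac} := @tofrac {mpoly rat[N]} \o @mpolyC N rat.

Definition at0 (p : {mpoly rat[N]}) : rat := (specialize p)@_0%MM.

(* [z] is regular with value [c] at the point [X_j = 1, X_{j*} = 0]. *)
Definition has_value (z : frac) (c : rat) : Prop := exists a b : {mpoly rat[N]},
  [/\ at0 a = c, at0 b = 1 & z * tofrac b = tofrac a].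

Lemma at0D a b : at0 (a + b) = at0 a + at0 b.
Proof. by rewrite /at0 /specialize !rmorphD. Qed.

Lemma at0M a b : at0 (a * b) = at0 a * at0 b.
Proof. by rewrite /at0 /specialize !rmorphM. Qed.

Lemma at01 : at0 1 = 1.
Proof. by rewrite /at0 /specialize !rmorph1. Qed.

Lemma tofrac_at0 b : at0 b = 1 -> tofrac b != 0 :> frac.
Proof.
move=> b1; rewrite tofrac_eq0; apply: contra_eqN b1 => /eqP ->.
by rewrite /at0 /specialize !rmorph0 eq_sym oner_neq0.
Qed.

Lemma has_value1 : has_value 1 1.
Proof. by exists 1, 1; rewrite at01 mul1r. Qed.

Lemma has_valueM x y c d : has_value x c -> has_value y d -> has_value (x * y) (c * d).
Proof.
move=> [a [b [<- b1 E]]] [a' [b' [<- b'1 E']]]; exists (a * a'), (b * b').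
by rewrite !at0M b1 b'1 mulr1 !tofracM -E -E' mulrACA.
Qed.

Lemma has_valueD x y c d : has_value x c -> has_value y d -> has_value (x + y) (c + d).
Proof.
move=> [a [b [<- b1 E]]] [a' [b' [<- b'1 E']]]; exists (a * b' + a' * b), (b * b').
rewrite at0D !at0M b1 b'1 !mulr1 tofracD !tofracM -E -E' mulrDl; split=> //.
by congr (_ + _); rewrite -!mulrA; congr (_ * _); rewrite mulrC.
Qed.

Lemma has_valueX x c m : has_value x c -> has_value (x ^+ m) (c ^+ m).
Proof.
move=> xc; elim: m => [|m IH]; first by rewrite !expr0; apply: has_value1.
by rewrite !exprS; apply: has_valueM.
Qed.

Lemma has_valueV x : has_value x 1 -> has_value x^-1 1.
Proof.
move=> [a [b [a1 b1 E]]]; exists b, a; split=> //; rewrite -E mulKf //.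
by apply: contra_neqN (tofrac_at0 a1) => /eqP x0; rewrite -E x0 mul0r.
Qed.

Lemma has_value_prod (I : finType) (x : I -> frac) (c : I -> rat) :
  (forall i, has_value (x i) (c i)) -> has_value (\prod_i x i) (\prod_i c i).
Proof.
move=> xc; elim/big_rec2: _ => [|i y d _ IH]; first exact: has_value1.
exact: has_valueM.
Qed.

Definition val0 (v : 'I_N) : rat := if split v is inl _ then 1 else 0.

Lemma val0_mut q u k D : antisym q -> coherent q k -> cvec_inv q D ->
  (forall v, has_value (u v) (val0 v)) ->
  forall v, has_value (mutu q u (mu k) v) (val0 v).
Proof.
move=> aq ck hD uv v; rewrite /mutu /override; case: eqP => // ->.
rewrite /val0 (unsplitK (inl k)) -[1]mulr1.
apply: has_valueM; last by apply: has_valueV; have := uv (mu k); rewrite /val0 (unsplitK (inl k)).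
(* A monomial takes the value 1 if it is free of frozen variables and 0 otherwise. *)
have prodE (m : 'I_N -> nat) : has_value (\prod_v u v ^+ m v)
    ([forall i, m (fr i) == 0%N])%:R.
  have -> : ([forall i, m (fr i) == 0%N])%:R = \prod_v val0 v ^+ m v.
    rewrite big_split_ord /= big1 ?mul1r => [|i _]; last by rewrite /val0 (unsplitK (inl i)) expr1n.
    case: forallP => [m0|/forallP].
      by rewrite big1 // => i _; rewrite (eqP (m0 i)) expr0.
    rewrite negb_forall => /existsP [i mi]; rewrite (bigD1 i) //=.
    by rewrite /val0 (unsplitK (inr i)) expr0n (negPf mi) mul0r.
  by apply: has_value_prod => w; apply: has_valueX.
have := has_valueD (prodE (fun i => q i (mu k))) (prodE (fun i => q (mu k) i)).
rewrite /exch_val; congr (has_value _ _).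
have nz : ~ (forall i, cvec q k i = 0).
  by move=> c0; have := hD k k; rewrite eqxx big1 // => i _; rewrite c0 mulr0.
case: ck => ck.
  have -> : [forall i, q (mu k) (fr i) == 0%N] by apply/forallP => i; rewrite ck.
  case: forallP => [q0|_]; last by rewrite add0r.
  by case: nz => i; rewrite /cvec ck (eqP (q0 i)).
have -> : [forall i, q (fr i) (mu k) == 0%N] by apply/forallP => i; rewrite ck.
case: forallP => [q0|_]; last by rewrite addr0.
by case: nz => i; rewrite /cvec ck (eqP (q0 i)).
Qed.

Fixpoint coherent_path q (ks : seq 'I_n) : Prop :=
  if ks is k :: ks' then coherent q k /\ coherent_path (mutn (mu k) q) ks' else True.

Definition mut_step (s : ('I_N -> 'I_N -> nat) * ('I_N -> frac)) (k : 'I_n) :=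
  (mutn (mu k) s.1, mutu s.1 s.2 (mu k)).

(** The induction peels off the first mutation, which changes the cluster in which the variable is
    to be Laurent; hence the generality in the seed. Memberships at all mutable j are carried along
    because pulling back at j uses those at j and k. *)
Lemma coherent_path_variable ks q u D : antisym q -> independent iota u -> cvec_inv q D ->
  (forall v, has_value (u v) (val0 v)) -> coherent_path q ks ->
  forall i, has_value ((foldl mut_step (q, u) ks).2 (mu i)) 1 /\
    forall j, upper iota q u (mu j) ((foldl mut_step (q, u) ks).2 (mu i)).
Proof.
elim: ks q u D => [|k ks IH] q u D aq iu hD uv /=.
  move=> _ i; split; last by move=> j; apply: upper_var.
  by have := uv (mu i); rewrite /val0 (unsplitK (inl i)).
move=> [ck cks] i; have [D' hD'] := cvec_inv_mut aq ck hD.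
have aq' : antisym (mutn (mu k) q) by exact: mutn_antisym.
have [v1 U] := IH _ _ D' aq' (independent_mut aq iu) hD' (val0_mut aq ck hD uv) cks i.
split=> // j; have [->|jk] := eqVneq j k.
  exact: upper_mut_self (U k).
apply: (upper_mut aq iu _ _ (U j) (U k)); first by rewrite lshift_eq.
by move=> _ _; apply: cvec_regular hD jk.
Qed.
End SignCoherence.

(** * Division by monomials when the cofactor has constant term 1 *)

Section MonomialDivisibility.
Variable n : nat.
Implicit Types p a b : {mpoly rat[n]}.

Lemma mul_affine (R : comNzRingType) (a b x f g : R) :
  (a + x * f) * (b + x * g) = a * b + x * (a * g + f * b + x * f * g).
Proof. by ring. Qed.

(** The constant term of b survives setting X_i to 0, so [cut b] is not 0 and the equation forces
    [cut p = 0]. *)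
Lemma mvar_dvd (i : 'I_n) p a b : b@_0%MM = 1 -> 'X_i * a = p * b ->
  exists f, p = 'X_i * f.
Proof.
pose cut : {mpoly rat[n]} -> {mpoly rat[n]} :=
  mmap (@mpolyC n rat) (override i 0 (fun j => 'X_j)).
have cutE x : exists f, x = cut x + 'X_i * f.
  elim/mpoly_gen_ind: x => [c|j|x y [f xE] [g yE]|x y [f xE] [g yE]].
  - by exists 0; rewrite /cut mmapC mulr0 addr0.
  - rewrite /cut mmapX mmap1U /override; case: eqP => [->|_].
      by exists 1; rewrite add0r mulr1.
    by exists 0; rewrite mulr0 addr0.
  - by exists (f + g); rewrite {1}xE {1}yE /cut rmorphD /= mulrDr addrACA.
  - exists (cut x * g + f * cut y + 'X_i * f * g).
    rewrite {1}xE {1}yE /cut rmorphM /= -!/(cut _).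
    exact: mul_affine.
move=> b1 E; have [f pE] := cutE p; exists f; rewrite pE.
suff -> : cut p = 0 by rewrite add0r.
have /eqP : cut p * cut b = 0.
  by rewrite /cut -rmorphM -E rmorphM /= mmapX mmap1U /override eqxx mul0r.
rewrite mulf_eq0 => /orP [/eqP //|/eqP b0]; have [g bE] := cutE b.
have := b1; rewrite bE b0 add0r rmorphM /= mcoeffX.
have -> : (U_(i) == 0)%MM = false.
  by apply/eqP => /mnmP /(_ i); rewrite mnm1E eqxx mnm0E.
by rewrite mul0r => /eqP; rewrite eq_sym oner_eq0.
Qed.

(** The list stands for a specialised monomial, in which unfrozen variables have become 1 and frozen
    ones have become variables y_j. *)
Lemma monomial_dvd (gs : seq {mpoly rat[n]}) p a b : b@_0%MM = 1 ->
  (forall g, g \in gs -> g = 1 \/ exists i, g = 'X_i) ->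
  (\prod_(g <- gs) g) * a = p * b -> exists f, p = (\prod_(g <- gs) g) * f.
Proof.
move=> b1; elim: gs a p => [|g gs IH] a p gsX; first by exists p; rewrite big_nil mul1r.
rewrite big_cons -mulrA => E.
have [f pE] : exists f, p = g * f.
  case: (gsX g (mem_head _ _)) => [->|[i gE]]; first by exists p; rewrite mul1r.
  by rewrite gE in E *; apply: mvar_dvd b1 E.
have g0 : g != 0.
  case: (gsX g (mem_head _ _)) => [->|[i ->]]; first exact: oner_neq0.
  exact: mpolyU_neq0.
have [||f' fE] := IH a f.
- by move=> h hgs; apply: gsX; rewrite inE hgs orbT.
- by apply: (mulfI g0); rewrite E pE mulrA.
by exists f'; rewrite pE fE mulrA.
Qed.

Lemma mpolyX_prod_seq (m : 'X_{1..n}) :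
  exists s : seq 'I_n, 'X_[m] = \prod_(v <- s) 'X_v :> {mpoly rat[n]}.
Proof.
rewrite mpolyXE_id; elim/big_ind: _ => [|x y [s ->] [t ->]|i _].
- by exists [::]; rewrite big_nil.
- by exists (s ++ t); rewrite big_cat.
- exists (nseq (m i) i); elim: (m i) => [|l IH]; first by rewrite expr0 big_nil.
  by rewrite exprS IH big_cons.
Qed.
End MonomialDivisibility.

(** * From mutations of the framed quiver with potential to arrow numbers *)

Section Framing.
Variable n : nat.
Local Notation mu := (@lshift n n).
Local Notation fr := (@rshift n n).
Local Notation VV := ('I_n + 'I_n)%type.

Lemma split_lshift (k : 'I_n) : split (mu k) = inl k.
Proof. exact: (unsplitK (inl k)). Qed.

Lemma split_rshift (k : 'I_n) : split (fr k) = inr k.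
Proof. exact: (unsplitK (inr k)). Qed.

Lemma split_eq_inl (v : 'I_(n + n)) (k : 'I_n) : (split v == inl k) = (v == mu k).
Proof. by rewrite -split_lshift (can_eq (@splitK n n)). Qed.

Lemma antisym_split (Q : quiver VV) (q : 'I_(n + n) -> 'I_(n + n) -> nat) :
  (forall v w, narrows Q (split v) (split w) = q v w) -> antisym q -> antisym (narrows Q).
Proof.
by move=> E aq v w; rewrite -[v]unsplitK -[w]unsplitK !E.
Qed.

Lemma narrows_mut_split (Q : quiver VV) q k v w :
  (forall v w, narrows Q (split v) (split w) = q v w) -> antisym q ->
  narrows (mut_quiver (inl k) Q) (split v) (split w) = mutn (mu k) q v w.
Proof.
move=> E aq; rewrite narrows_mut; last exact: antisym_split E aq.
by rewrite /mutn !split_eq_inl -!split_lshift !E.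
Qed.

Lemma coherent_corner (K : fieldType) (P : qp K VV) q k :
  (forall v w, narrows (qp_quiver P) (split v) (split w) = q v w) ->
  finite_qp P -> reduced_qp P -> corner (@frozen n) P -> coherent q k.
Proof.
move=> E fP rP cP; case: (boolP [forall i, q (mu k) (fr i) == 0%N]) => [/forallP h|].
  by left=> i; apply/eqP.
rewrite negb_forall => /existsP [l]; rewrite -E split_lshift split_rshift -lt0n.
move=> /card_gt0P [b]; rewrite inE => /andP [/eqP sb /eqP tb].
right=> j; apply/eqP; rewrite -leqn0 leqNgt -E split_lshift split_rshift.
apply/negP => /card_gt0P [a]; rewrite inE => /andP [/eqP sa /eqP ta].
by apply: (corner_no_path (a := a) (b := b) cP fP rP); rewrite ?sa ?ta ?sb ?tb.
Qed.

(** Coherence is assumed for the first quiver, where it comes from the shape of the framing; from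
    then on each [P'] is reduced and [coherent_corner] supplies it. *)
Lemma coherent_path_qp (K : fieldType) ks (P : qp K VV) q :
  (forall v w, narrows (qp_quiver P) (split v) (split w) = q v w) -> antisym q ->
  finite_qp P -> corner (@frozen n) P -> (forall k, coherent q k) ->
  succ_f_mutatable P [seq inl k | k <- ks] -> coherent_path q ks.
Proof.
elim: ks P q => [|k ks IH] // P q E aq fP cP cq /= [P' [[redP' isoP'] sP']].
split; first exact: cq.
have aP := antisym_split E aq.
have q0 v : narrows (qp_quiver P) v v = 0%N by exact: antisym_diag.
have llP := narrows_loopless q0.
(* A loop in the premutation would be a composite arrow coming from a 2-cycle through k. *)
have llP1 : loopless (qp_quiver (premut_qp (inl k) P)).
  apply: narrows_loopless => v; rewrite narrows_premut // orbb.
  by case: ifP => _; rewrite q0 // aP.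
have [fP' rP' _] := redP'.
have cP' : corner (@frozen n) P'.
  apply: corner_reduced llP1 _ _ redP'; first exact: is_potential_premut.
  by case: (P) llP fP cP => Q W llQ fW cW; apply: corner_premut.
have E' v w : narrows (qp_quiver P') (split v) (split w) = mutn (mu k) q v w.
  by rewrite (narrows_iso _ _ isoP'); apply: narrows_mut_split.
apply: (IH P') => //; first exact: mutn_antisym.
by move=> k'; apply: coherent_corner E' fP' rP' cP'.
Qed.

Lemma foldl_mut_seed (S : seed (ratfun n) VV) q u ks :
  (forall v w, narrows (seed_quiver S) (split v) (split w) = q v w) ->
  (forall v, seed_var S (split v) = u v) -> antisym q ->
  forall i, seed_var (foldl (fun S k => mut_seed (inl k) S) S ks) (inl i) =
    (foldl (@mut_step n) (q, u) ks).2 (mu i).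
Proof.
elim: ks S q u => [|k ks IH] S q u E Eu aq i /=; first by rewrite -Eu split_lshift.
apply: IH; last exact: mutn_antisym.
  by move=> v w; apply: narrows_mut_split.
move=> v; rewrite /= split_eq_inl /mutu /override; case: eqP => // _.
have bs : bijective (@split n n) by exists (@unsplit n n); [apply: splitK | apply: unsplitK].
rewrite -(split_lshift k) Eu mulrC /exch_val; congr ((_ + _) / _);
  rewrite (reindex _ (onW_bij _ bs)); apply: eq_bigr => w _ /=;
  by rewrite Eu E.
Qed.

Section FramedQuiver.
Variable Q : quiver 'I_n.

Lemma narrows_framed_frozen (v : VV) i : narrows (framed Q) v (inr i) = 0%N.
Proof. by apply: eq_card0 => -[a|j]; rewrite inE andbF. Qed.

Lemma narrows_framing i j : narrows (framed Q) (inr i) (inl j) = (i == j).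
Proof.
rewrite /narrows; have [->|ij] := eqVneq i j.
  by rewrite -[RHS](cards1 (inr j : arrow (framed Q))); apply: eq_card => -[a|k]; rewrite !inE // andbb.
apply: eq_card0 => -[a|k]; rewrite inE //.
by apply/andP => -[/eqP [->] /eqP [E]]; rewrite E eqxx in ij.
Qed.

Lemma antisym_framed : loopless Q -> (forall c : {set arrow Q}, ~~ two_cycle c) ->
  antisym (narrows (framed Q)).
Proof.
move=> ll nc [i|i] [j|j]; rewrite ?narrows_framed_frozen ?muln0 //.
apply/eqP; rewrite -leqn0 leqNgt muln_gt0; apply/negP => /andP [].
move=> /card_gt0P [a']; rewrite inE; case: a' => [a|//] /andP [/eqP [sa] /eqP [ta]].
move=> /card_gt0P [b']; rewrite inE; case: b' => [b|//] /andP [/eqP [sb] /eqP [tb]].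
case/negP: (nc [set a; b]); apply/existsP; exists a; apply/existsP; exists b.
by rewrite ll sb ta tb sa !eqxx.
Qed.
End FramedQuiver.
End Framing.

Theorem theorem8p8 (R : realType) (n : nat) (Q : quiver 'I_n)
    (W : pathalg R[i] Q) (ks : seq 'I_n)
    (Q_loopless : loopless Q)
    (Q_no_two_cycles : forall c : {set arrow Q}, ~~ two_cycle c)
    (W_potential : is_potential W)
    (mutatable : succ_f_mutatable (framed_qp W) [seq inl k | k <- ks])
    (i : 'I_n) :
  exists f : {mpoly rat[n]}, is_Fpoly Q ks i f /\ f@_0%MM = 1.
Proof.
pose q v w := narrows (framed Q) (split v) (split w).
pose u (v : 'I_(n + n)) : ratfun n := tofrac 'X_v.
have aq : antisym q by move=> v w; apply: antisym_framed.
have cq k : coherent q k.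
  by left=> j; rewrite /q split_rshift narrows_framed_frozen.
have path : coherent_path q ks.
  apply: (coherent_path_qp (P := framed_qp W)) mutatable => //.
    exact: is_potential_map.
  exact: corner_framed.
have hD : cvec_inv q (fun k j => (k == j)%:R).
  move=> k j; rewrite (bigD1 k) //= eqxx mul1r big1 ?addr0 => [|l lk].
    by rewrite /cvec /q split_lshift split_rshift narrows_framed_frozen narrows_framing subr0 natz.
  by rewrite eq_sym (negPf lk) mul0r.
have uv v : has_value (u v) (val0 v).
  exists 'X_v, 1; split; rewrite ?at01 ?tofrac1 ?mulr1 //.
  rewrite /at0 /specialize comp_mpolyXU -tnth_nth tnth_mktuple /val0.
  case: (split v) => j; first by rewrite rmorph1.
  by rewrite mcoeffX; case: eqP => // /mnmP /(_ j); rewrite mnm1E mnm0E eqxx.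
have [v1 U] := coherent_path_variable aq (@independent_tofrac _) hD uv path i.
have zE : FZ Q ks i = (foldl (@mut_step n) (q, u) ks).2 (lshift n i).
  apply: foldl_mut_seed => // v; rewrite /= /u.
  by case: splitP => j vj; congr (tofrac 'X_ _); apply: val_inj.
rewrite -zE in v1 U; set z := FZ Q ks i in zE v1 U.
have u0 v : u v != 0 by apply: independent_neq0 (@independent_tofrac _) v.
have [m [p zm]] := laurentP u0 (upper_laurent (U i)).
have {}zm : z * tofrac 'X_[m] = tofrac p.
  by rewrite -[in RHS]mmap_tofrac -zm -[X in _ * X]mmap_tofrac mmapX.
have [a [b [a1 b1 zb]]] := v1.
(* The cluster variable is p divided by a monomial and also a / b with b of value 1.
   Cross-multiplied, this is an identity of polynomials and can be specialised. *)
have E : 'X_[m] * a = p * b.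
  apply/eqP; rewrite -(tofrac_eq (R := {mpoly rat[n + n]})) !tofracM -zb -zm.
  by rewrite mulrCA mulrA.
have [s sE] := mpolyX_prod_seq m.
have sX : specialize 'X_[m] = \prod_(g <- [seq specialize 'X_v | v <- s]) g.
  by rewrite big_map sE /specialize rmorph_prod.
have Es : (\prod_(g <- [seq specialize 'X_v | v <- s]) g) * specialize a = specialize p * specialize b.
  by rewrite -sX -!rmorphM /= E.
have sv g : g \in [seq specialize 'X_v | v <- s] -> g = 1 \/ exists j, g = 'X_j.
  move=> /mapP [v _ ->]; rewrite /specialize comp_mpolyXU -tnth_nth tnth_mktuple.
  by case: (split v) => j; [left | right; exists j].
(* The specialised monomial divides the specialised numerator. The quotient f is the F-polynomial,
   and comparing it with a / b shows that its constant term is the value of a. *)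
have [f pf] := monomial_dvd b1 sv Es.
have m0 : \prod_(g <- [seq specialize 'X_v | v <- s]) g != 0.
  rewrite prodf_seq_neq0; apply/allP => g /sv [->|[j ->]]; first exact: oner_neq0.
  exact: mpolyU_neq0.
have af : specialize a = f * specialize b by apply: (mulfI m0); rewrite Es pf mulrA.
exists f; split; last first.
  by have := a1; rewrite /at0 af rmorphM /= -/(at0 b) b1 mulr1.
exists a, b; split=> //.
  by apply: contra_eq_neq b1 => b0; rewrite /at0 b0 mcoeff0 eq_sym oner_neq0.
by rewrite -zb mulfK // tofrac_at0.
Qed.
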